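(* Let $U_1=\{\sigma+it\in\mathbb{C}:\alpha_1<\sigma<\beta_1\}$ and $U_2=\{\sigma+it\in\mathbb{C}:\alpha_2<\sigma<\beta_2\}$ with $U_1\cap U_2\neq\emptyset$. Let $\Lambda_1=\{\lambda_1,\lambda_2,\ldots\}$ and $\Lambda_2=\{\mu_1,\mu_2,\ldots\}$ be two countable sets of real numbers, each of which is linearly independent over $\mathbb{Q}$. Let $f_1\in AP(U_1,\mathbb{C})$ and $f_2\in AP(U_2,\mathbb{C})$ be two almost periodic functions whose sets of Fourier exponents are $\Lambda_1$ and $\Lambda_2$, respectively. Then $f_1$ is $^*$-equivalent to $f_2$ if and only if there exists a nonempty open interval $(\alpha,\beta)\subset(\alpha_1,\beta_1)\cap(\alpha_2,\beta_2)$ such that $$\bigcup_{\sigma\in E}\operatorname{Img}\left(f_1(\sigma+it)\right)=\bigcup_{\sigma\in E}\operatorname{Img}\left(f_2(\sigma+it)\right)$$ for every open set $E\subset(\alpha,\beta)$ of real numbers.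
   Context: Throughout $s=\sigma+it$ with $\sigma,t\in\mathbb{R}$, and $-\infty\le\alpha_k<\beta_k\le\infty$ for $k=1,2$. For an open vertical strip $U=\{\sigma+it:\alpha<\sigma<\beta\}$ ($-\infty\le\alpha<\beta\le\infty$), a reduced strip of $U$ is a set $\{\sigma+it:\sigma_1\le\sigma\le\sigma_2\}$ with $\alpha<\sigma_1\le\sigma_2<\beta$. $AP(U,\mathbb{C})$ is the set of analytic functions $f:U\to\mathbb{C}$ such that for every $\varepsilon>0$ and every reduced strip $K$ of $U$ there is $l>0$ such that every real interval of length $l$ contains a number $\tau$ with $|f(s+i\tau)-f(s)|\le\varepsilon$ for all $s\in K$. Dirichlet series and Fourier exponents: for $f\in AP(U,\mathbb{C})$ and $\lambda\in\mathbb{R}$, the Fourier coefficient is $a(\lambda)=\lim_{T\to\infty}\frac{1}{2T}\int_{-T}^{T}f(\sigma+it)e^{-\lambda(\sigma+it)}\,dt$, which exists and does not depend on $\sigma\in(\alpha,\beta)$. The set of $\lambda$ with $a(\lambda)\ne0$ is countable (finite or infinite); it is the set of Fourier exponents of $f$. The formal series $\sum_\lambda a(\lambda)e^{\lambda s}$ over this set is the Dirichlet series of $f$. $^*$-equivalence: let $\Lambda=\{\lambda_1,\lambda_2,\ldots\}$ be a countable (finite or infinite) set of distinct reals with cardinality $\sharp\Lambda$. Two formal exponential sums $\sum_{j\ge1}a_je^{\lambda_js}$ and $\sum_{j\ge1}b_je^{\lambda_js}$ ($a_j,b_j\in\mathbb{C}$) are $^*$-equivalent if for each integer $n\ge1$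 with $n\le\sharp\Lambda$ there is a $\mathbb{Q}$-linear map $\psi_n:V_n\to\mathbb{R}$, where $V_n$ is the $\mathbb{Q}$-vector space generated by $\{\lambda_1,\ldots,\lambda_n\}$, such that $b_j=a_je^{i\psi_n(\lambda_j)}$ for $j=1,\ldots,n$. Two almost periodic functions $f_1\in AP(U_1,\mathbb{C})$, $f_2\in AP(U_2,\mathbb{C})$ are $^*$-equivalent if their Dirichlet series are $^*$-equivalent; in particular this requires their sets of Fourier exponents to coincide. Notation: $\operatorname{Img}(f(\sigma+it))=\{f(\sigma+it):t\in\mathbb{R}\}$ for fixed $\sigma$. *)

(* Defs.v *)
(* Stdlib reals with Coquelicot.  A function on a strip U is a total function
   C -> C, of which only the values on U are ever constrained or used. *)
From Stdlib Require Import Reals QArith Qreals List.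
From Coquelicot Require Import Coquelicot.
Open Scope R_scope.

Definition in_interval (alpha beta : Rbar) (x : R) : Prop :=
  Rbar_lt alpha x /\ Rbar_lt x beta.

Definition in_strip (alpha beta : Rbar) (s : C) : Prop :=
  in_interval alpha beta (Re s).

Definition Cexp (z : C) : C := (exp (Re z) * cos (Im z), exp (Re z) * sin (Im z)).

Definition analytic_on_strip (alpha beta : Rbar) (f : C -> C) : Prop :=
  forall s : C, in_strip alpha beta s ->
    ex_derive (K := C_AbsRing) (V := C_NormedModule) f s.

(* The reduced strips of U are the sets sigma1 <= Re s <= sigma2. *)
Definition AP (alpha beta : Rbar) (f : C -> C) : Prop :=
  analytic_on_strip alpha beta f /\
  forall (eps sigma1 sigma2 : R),
    0 < eps ->
    Rbar_lt alpha sigma1 -> sigma1 <= sigma2 -> Rbar_lt sigma2 beta ->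
    exists l : R, 0 < l /\
      forall x : R, exists tau : R, x <= tau <= x + l /\
        forall s : C, sigma1 <= Re s <= sigma2 ->
          Cmod (f (s + Ci * tau) - f s)%C <= eps.

(* The mean value exists and does not depend on the abscissa; accordingly
   "a is the coefficient" means that every abscissa of the strip yields a. *)
Definition is_fourier_coeff (alpha beta : Rbar) (f : C -> C)
    (lambda : R) (a : C) : Prop :=
  forall sigma : R, in_interval alpha beta sigma ->
    filterlim
      (fun T : R => scal (V := C_R_NormedModule) (/ (2 * T))
         (RInt (V := C_R_CompleteNormedModule)
            (fun t : R => (f (sigma, t) * Cexp (- (lambda * (sigma, t))))%C)
            (- T) T))
      (Rbar_locally p_infty) (locally (T := C_UniformSpace) a).

Definition fourier_exponent (alpha beta : Rbar) (f : C -> C) (lambda : R) : Prop :=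
  exists a : C, a <> RtoC 0 /\ is_fourier_coeff alpha beta f lambda a.

(* Cardinality of a countable set: [Some N] if it has N elements, [None] if it
   is infinite.  Enumerations are indexed from 0. *)
Definition lt_card (j : nat) (card : option nat) : Prop :=
  match card with Some N => (j < N)%nat | None => True end.

Definition le_card (n : nat) (card : option nat) : Prop :=
  match card with Some N => (n <= N)%nat | None => True end.

Definition enumerates (card : option nat) (lam : nat -> R) (L : R -> Prop) : Prop :=
  (forall i j : nat, lt_card i card -> lt_card j card -> lam i = lam j -> i = j) /\
  (forall x : R, L x <-> exists j : nat, lt_card j card /\ lam j = x).

Definition countable_set (L : R -> Prop) : Prop :=
  exists (card : option nat) (lam : nat -> R), enumerates card lam L.

Definition Qcomb (q : R -> Q) (l : list R) : R :=
  fold_right Rplus 0 (map (fun x => Q2R (q x) * x) l).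

Definition Q_independent (L : R -> Prop) : Prop :=
  forall (l : list R) (q : R -> Q),
    NoDup l -> (forall x : R, In x l -> L x) ->
    Qcomb q l = 0 -> forall x : R, In x l -> (q x == 0)%Q.

Definition Qspan (l : list R) (x : R) : Prop := exists q : R -> Q, x = Qcomb q l.

(* A map V -> R is represented by a total map, whose values outside V do not matter. *)
Definition Q_linear_on (V : R -> Prop) (psi : R -> R) : Prop :=
  (forall x y : R, V x -> V y -> psi (x + y) = psi x + psi y) /\
  (forall (q : Q) (x : R), V x -> psi (Q2R q * x) = Q2R q * psi x).

(* *-equivalence of the formal sums with exponents lam and coefficients a, b. *)
Definition star_equiv_sums (card : option nat) (lam : nat -> R)
    (a b : nat -> C) : Prop :=
  forall n : nat, (1 <= n)%nat -> le_card n card ->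
    exists psi : R -> R,
      Q_linear_on (Qspan (map lam (seq 0 n))) psi /\
      forall j : nat, (j < n)%nat -> b j = (a j * Cexp (Ci * psi (lam j)))%C.

(* The Dirichlet series of f1 and f2 are written over a common enumeration of
   their exponents, so the two sets of exponents coincide. *)
Definition star_equiv (alpha1 beta1 : Rbar) (f1 : C -> C)
    (alpha2 beta2 : Rbar) (f2 : C -> C) : Prop :=
  exists (card : option nat) (lam : nat -> R) (a b : nat -> C),
    enumerates card lam (fourier_exponent alpha1 beta1 f1) /\
    enumerates card lam (fourier_exponent alpha2 beta2 f2) /\
    (forall j : nat, lt_card j card ->
       is_fourier_coeff alpha1 beta1 f1 (lam j) (a j) /\
       is_fourier_coeff alpha2 beta2 f2 (lam j) (b j)) /\
    star_equiv_sums card lam a b.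

Definition Img (f : C -> C) (sigma : R) (w : C) : Prop :=
  exists t : R, w = f (sigma, t).

(* Main.v *)
(* A function in AP(U, C) with Q-independent exponents is the sum of its Dirichlet series,
   which converges absolutely.  Absolute convergence comes from testing f against products of
   Fejer kernels in the variables lambda_j t: by independence only the exponents themselves
   contribute to the mean, so the sum of |a_j| e^(lambda_j sigma) is at most the supremum
   of |f| on the line Re s = sigma.  The sum of the series then has the same Fourier means as f,
   and a uniformly almost periodic function with vanishing Fourier means is zero.

   If f1 and f2 are *-equivalent, the exponents are independent and the moduli of the
   coefficients agree, so by Kronecker's theorem some vertical translates of f1 converge to f2
   locally uniformly, and Hurwitz's argument shows that every value of f2 above E is a value of f1.

   Conversely, shrinking E to a point shows that sup |f1| = sup |f2| on each line, that is,
   the sums of |a_j| e^(lambda_j sigma) and |b_j| e^(mu_j sigma) agree on an interval.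
   By analytic continuation they agree on a vertical line, where their Fourier means
   determine the exponents and the moduli; independence of the exponents makes the phases
   of the coefficients irrelevant. *)
Require Import Defs.
From Stdlib Require Import Reals QArith Qreals List Lra Lia ZArith Classical ClassicalEpsilon.
From Coquelicot Require Import Coquelicot.
Open Scope R_scope.

(** The hypothesis compares values over open sets of abscissae, never over one line, so statements
    about a line must survive a small change of abscissa. Absolute convergence gives this: it yields
    Taylor discs whose radius and remainder bound are the same at all heights of a line. These discs
    also take the place of the identity theorem and of Cauchy's estimates. The Fejer test works
    because a product of kernels is nonnegative with mean 1 and, once rotated to the phases of the
    coefficients, picks each of them with weight m/(m+1). Kronecker's theorem comes from the same
    inequality: if prescribed phases phi_j could not be approached, the polynomial 1 + sum of e^(-i
    phi_j) e^(i lambda_j t) would stay below n + 1 by a fixed amount, although its coefficients have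
    total modulus n + 1. Independence excludes the exponent 0. Hence a function with at least one
    exponent is nonconstant on every line, as Hurwitz's argument requires; without exponents both
    functions vanish. *)

(** * Complex exponentials and moduli *)

Definition cis (x : R) : C := (cos x, sin x).

Lemma Cexp_cis (z : C) : Cexp z = (exp (Re z) * cis (Im z))%C.
Proof. unfold Cexp, cis, Cmult; simpl. f_equal; ring. Qed.

Lemma cis_plus (x y : R) : cis (x + y) = (cis x * cis y)%C.
Proof. unfold cis, Cmult; simpl. rewrite cos_plus, sin_plus. f_equal; ring. Qed.

Lemma cis_0 : cis 0 = RtoC 1.
Proof. unfold cis. now rewrite cos_0, sin_0. Qed.

Lemma Cmod_cis (x : R) : Cmod (cis x) = 1.
Proof.
  unfold Cmod, cis; simpl.
  replace (_ + _) with 1; [apply sqrt_1 |].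
  generalize (sin2_cos2 x); unfold Rsqr; lra.
Qed.

Lemma Cexp_plus (z w : C) : Cexp (z + w) = (Cexp z * Cexp w)%C.
Proof.
  rewrite !Cexp_cis. change (Re (z + w)) with (Re z + Re w).
  change (Im (z + w)) with (Im z + Im w). rewrite exp_plus, cis_plus, RtoC_mult. ring.
Qed.

Lemma Cmod_Cexp (z : C) : Cmod (Cexp z) = exp (Re z).
Proof.
  rewrite Cexp_cis, Cmod_mult, Cmod_cis, Cmod_R, Rabs_pos_eq; [ring |].
  left; apply exp_pos.
Qed.

Lemma Cexp_0 : Cexp 0 = RtoC 1.
Proof. unfold Cexp; simpl. now rewrite exp_0, cos_0, sin_0, Rmult_1_r, Rmult_0_r. Qed.

Lemma Cmod_le_Re_Im (z : C) : Cmod z <= Rabs (Re z) + Rabs (Im z).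
Proof.
  destruct z as [x y]. unfold Re, Im; simpl.
  replace ((x, y)) with (RtoC x + Ci * RtoC y)%C.
  2: unfold Ci, Cplus, Cmult, RtoC; simpl; f_equal; ring.
  eapply Rle_trans; [apply Cmod_triangle |].
  rewrite Cmod_mult, Cmod_Ci, !Cmod_R. lra.
Qed.

Lemma im_le_Cmod (c : C) : Rabs (Im c) <= Cmod c.
Proof. eapply Rle_trans; [apply Rmax_r | apply Rmax_Cmod]. Qed.

Lemma Cmod_minus_sym (z w : C) : Cmod (z - w) = Cmod (w - z).
Proof. rewrite <- Cmod_opp. f_equal. ring. Qed.

Lemma Cmod_triangle_minus (x y z : C) : Cmod (x - z) <= Cmod (x - y) + Cmod (y - z).
Proof. replace (x - z)%C with ((x - y) + (y - z))%C by ring. apply Cmod_triangle. Qed.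

Lemma Cmod_triangle_rev (x y : C) : Cmod x - Cmod y <= Cmod (x - y).
Proof.
  generalize (Cmod_triangle (x - y) y). replace (x - y + y)%C with x by ring. lra.
Qed.

(** * Continuity of complex-valued functions *)

Lemma continuous_C_pair {T : UniformSpace} (f : T -> C) (x : T) :
  continuous (U := R_UniformSpace) (fun t => Re (f t)) x ->
  continuous (U := R_UniformSpace) (fun t => Im (f t)) x ->
  continuous (U := C_UniformSpace) f x.
Proof.
  intros Hr Hi P [eps HP].
  generalize (Hr _ (locally_ball (Re (f x)) eps)) (Hi _ (locally_ball (Im (f x)) eps)).
  unfold filtermap. intros H1 H2.
  generalize (filter_and _ _ H1 H2). apply filter_imp.
  intros y [A B]. apply HP. split; assumption.
Qed.

Lemma continuous_C_Re {T : UniformSpace} (f : T -> C) (x : T) :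
  continuous (U := C_UniformSpace) f x ->
  continuous (U := R_UniformSpace) (fun t => Re (f t)) x.
Proof.
  intros H P [eps HP].
  generalize (H _ (locally_ball (f x) eps)). unfold filtermap. apply filter_imp.
  intros y [A B]. apply HP. exact A.
Qed.

Lemma continuous_C_Im {T : UniformSpace} (f : T -> C) (x : T) :
  continuous (U := C_UniformSpace) f x ->
  continuous (U := R_UniformSpace) (fun t => Im (f t)) x.
Proof.
  intros H P [eps HP].
  generalize (H _ (locally_ball (f x) eps)). unfold filtermap. apply filter_imp.
  intros y [A B]. apply HP. exact B.
Qed.

Lemma continuous_Cplus {T : UniformSpace} (f g : T -> C) (x : T) :
  continuous (U := C_UniformSpace) f x -> continuous (U := C_UniformSpace) g x ->
  continuous (U := C_UniformSpace) (fun t => f t + g t)%C x.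
Proof.
  intros Hf Hg. apply continuous_C_pair.
  - apply (continuous_plus (V := R_NormedModule) (fun t => Re (f t)) (fun t => Re (g t)));
      apply continuous_C_Re; assumption.
  - apply (continuous_plus (V := R_NormedModule) (fun t => Im (f t)) (fun t => Im (g t)));
      apply continuous_C_Im; assumption.
Qed.

Lemma continuous_Cmult {T : UniformSpace} (f g : T -> C) (x : T) :
  continuous (U := C_UniformSpace) f x -> continuous (U := C_UniformSpace) g x ->
  continuous (U := C_UniformSpace) (fun t => f t * g t)%C x.
Proof.
  intros Hf Hg.
  assert (Hfr := continuous_C_Re _ _ Hf). assert (Hfi := continuous_C_Im _ _ Hf).
  assert (Hgr := continuous_C_Re _ _ Hg). assert (Hgi := continuous_C_Im _ _ Hg).
  apply continuous_C_pair; simpl.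
  - apply (continuous_minus (V := R_NormedModule)
             (fun t => Re (f t) * Re (g t)) (fun t => Im (f t) * Im (g t)));
      apply (continuous_mult (K := R_AbsRing)); assumption.
  - apply (continuous_plus (V := R_NormedModule)
             (fun t => Re (f t) * Im (g t)) (fun t => Im (f t) * Re (g t)));
      apply (continuous_mult (K := R_AbsRing)); assumption.
Qed.

Lemma continuous_Cconst {T : UniformSpace} (c : C) (x : T) :
  continuous (U := C_UniformSpace) (fun _ => c) x.
Proof. apply continuous_const. Qed.

Lemma continuous_Copp {T : UniformSpace} (f : T -> C) (x : T) :
  continuous (U := C_UniformSpace) f x ->
  continuous (U := C_UniformSpace) (fun t => - f t)%C x.
Proof.
  intros Hf. apply continuous_ext with (fun t => - (1) * f t)%C.
  { intros t. change (- (1) * f t = - f t)%C. ring. }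
  apply continuous_Cmult; [apply continuous_Cconst | exact Hf].
Qed.

Lemma continuous_Cminus {T : UniformSpace} (f g : T -> C) (x : T) :
  continuous (U := C_UniformSpace) f x -> continuous (U := C_UniformSpace) g x ->
  continuous (U := C_UniformSpace) (fun t => f t - g t)%C x.
Proof. intros Hf Hg. apply continuous_Cplus; [exact Hf | apply continuous_Copp, Hg]. Qed.

Lemma continuous_cis_lin (a x : R) :
  continuous (T := R_UniformSpace) (U := C_UniformSpace) (fun t => cis (a * t)) x.
Proof.
  apply continuous_C_pair; simpl; apply continuity_pt_filterlim; reg.
Qed.

(** The balls of [C_UniformSpace] are products of intervals, squares instead of discs; the form with
    [Cmod] is the one in which all later estimates are made. *)
Lemma continuous_C_eps_R (f : R -> C) (x : R) :
  continuous (T := R_UniformSpace) (U := C_UniformSpace) f x <->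
  forall eps : R, 0 < eps -> exists d : R, 0 < d /\
    forall y : R, Rabs (y - x) < d -> Cmod (f y - f x) < eps.
Proof.
  split.
  - intros H eps He.
    assert (He2 : 0 < eps / 2) by lra.
    generalize (H _ (locally_ball (f x) (mkposreal _ He2))). intros [d Hd].
    exists d. split; [apply cond_pos |]. intros y Hy.
    destruct (Hd y Hy) as [A B].
    eapply Rle_lt_trans; [apply Cmod_le_Re_Im |].
    unfold ball in A, B; simpl in A, B. unfold AbsRing_ball, abs, minus, plus, opp in A, B; simpl in A, B.
    unfold Re, Im, Cminus, Cplus, Copp; simpl. unfold Rminus in *. lra.
  - intros H P [eps HP].
    destruct (H eps (cond_pos eps)) as [d [Hd Hy]].
    exists (mkposreal d Hd). intros y B. apply HP.
    apply C_NormedModule_mixin_compat1. unfold minus, plus, opp; simpl. apply (Hy y). exact B.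
Qed.

Lemma continuous_C_eps_C (f : C -> C) (x : C) :
  continuous (T := C_UniformSpace) (U := C_UniformSpace) f x <->
  forall eps : R, 0 < eps -> exists d : R, 0 < d /\
    forall y : C, Cmod (y - x) < d -> Cmod (f y - f x) < eps.
Proof.
  split.
  - intros H eps He.
    assert (He2 : 0 < eps / 2) by lra.
    generalize (H _ (locally_ball (f x) (mkposreal _ He2))). intros [d Hd].
    exists d. split; [apply cond_pos |]. intros y Hy.
    assert (By : ball (M := C_UniformSpace) x d y).
    { apply C_NormedModule_mixin_compat1. exact Hy. }
    destruct (Hd y By) as [A B].
    eapply Rle_lt_trans; [apply Cmod_le_Re_Im |].
    unfold ball in A, B; simpl in A, B. unfold AbsRing_ball, abs, minus, plus, opp in A, B; simpl in A, B.
    unfold Re, Im, Cminus, Cplus, Copp; simpl. unfold Rminus in *. lra.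
  - intros H P [eps HP].
    destruct (H eps (cond_pos eps)) as [d [Hd Hy]].
    assert (Hs : 0 < sqrt 2) by (apply sqrt_lt_R0; lra).
    (* A square of half-side d / sqrt 2 lies inside the disc of radius d. *)
    exists (mkposreal (d / sqrt 2) (Rdiv_lt_0_compat _ _ Hd Hs)). intros y B. apply HP.
    apply C_NormedModule_mixin_compat1. unfold minus, plus, opp; simpl. apply (Hy y).
    assert (B2 := C_NormedModule_mixin_compat2 _ _ _ B). simpl in B2.
    replace (sqrt 2 * (d / sqrt 2)) with d in B2 by (field; lra). exact B2.
Qed.

(** * Integrals of complex-valued functions of a real variable *)

(** Taken componentwise so that the theory of real integrals applies; [RInt_C_Cint] connects it with
    the integral in [is_fourier_coeff]. *)
Definition Cint (f : R -> C) (a b : R) : C :=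
  (RInt (fun t => Re (f t)) a b, RInt (fun t => Im (f t)) a b).

Definition cont_on (a b : R) (f : R -> C) : Prop :=
  forall x : R, a <= x <= b -> continuous (T := R_UniformSpace) (U := C_UniformSpace) f x.

Lemma ex_RInt_Re (f : R -> C) (a b : R) :
  a <= b -> cont_on a b f -> ex_RInt (fun t => Re (f t)) a b.
Proof.
  intros Hab H. apply (ex_RInt_continuous (V := R_CompleteNormedModule)).
  rewrite Rmin_left, Rmax_right by exact Hab. intros z Hz. apply continuous_C_Re, H, Hz.
Qed.

Lemma ex_RInt_Im (f : R -> C) (a b : R) :
  a <= b -> cont_on a b f -> ex_RInt (fun t => Im (f t)) a b.
Proof.
  intros Hab H. apply (ex_RInt_continuous (V := R_CompleteNormedModule)).
  rewrite Rmin_left, Rmax_right by exact Hab. intros z Hz. apply continuous_C_Im, H, Hz.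
Qed.

Lemma RInt_C_Cint (f : R -> C) (a b : R) :
  a <= b -> cont_on a b f ->
  RInt (V := C_R_CompleteNormedModule) f a b = Cint f a b.
Proof.
  intros Hab H. unfold Cint. symmetry.
  apply (RInt_fct_extend_pair (U := R_NormedModule) (V := R_NormedModule)
           (fun f a b => RInt f a b) (fun f a b => RInt f a b)).
  - intros g c d l Hl. apply is_RInt_unique, Hl.
  - intros g c d l Hl. apply is_RInt_unique, Hl.
  - apply (RInt_correct (V := C_R_CompleteNormedModule)).
    apply (ex_RInt_continuous (V := C_R_CompleteNormedModule)).
    rewrite Rmin_left, Rmax_right by exact Hab. exact H.
Qed.

Lemma Cint_ext (f g : R -> C) (a b : R) :
  a <= b -> (forall x, a <= x <= b -> f x = g x) -> Cint f a b = Cint g a b.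
Proof.
  intros Hab H. unfold Cint. f_equal; apply RInt_ext;
    rewrite Rmin_left, Rmax_right by exact Hab; intros x Hx; rewrite H; auto; lra.
Qed.

Lemma Cint_plus (f g : R -> C) (a b : R) :
  a <= b -> cont_on a b f -> cont_on a b g ->
  Cint (fun t => f t + g t)%C a b = (Cint f a b + Cint g a b)%C.
Proof.
  intros Hab Hf Hg. unfold Cint, Cplus; simpl. f_equal.
  - rewrite <- (RInt_plus (V := R_CompleteNormedModule)); [reflexivity | |];
      apply ex_RInt_Re; assumption.
  - rewrite <- (RInt_plus (V := R_CompleteNormedModule)); [reflexivity | |];
      apply ex_RInt_Im; assumption.
Qed.

Lemma Cint_scal (c : C) (f : R -> C) (a b : R) :
  a <= b -> cont_on a b f ->
  Cint (fun t => c * f t)%C a b = (c * Cint f a b)%C.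
Proof.
  intros Hab Hf.
  assert (Hr := ex_RInt_Re f a b Hab Hf). assert (Hi := ex_RInt_Im f a b Hab Hf).
  unfold Cint, Cmult; simpl. f_equal.
  - rewrite <- !(RInt_scal (V := R_CompleteNormedModule)) by assumption.
    rewrite <- (RInt_minus (V := R_CompleteNormedModule)).
    + reflexivity.
    + exact (ex_RInt_scal (V := R_NormedModule) _ _ _ _ Hr).
    + exact (ex_RInt_scal (V := R_NormedModule) _ _ _ _ Hi).
  - rewrite <- !(RInt_scal (V := R_CompleteNormedModule)) by assumption.
    rewrite <- (RInt_plus (V := R_CompleteNormedModule)).
    + reflexivity.
    + exact (ex_RInt_scal (V := R_NormedModule) _ _ _ _ Hi).
    + exact (ex_RInt_scal (V := R_NormedModule) _ _ _ _ Hr).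
Qed.

Lemma Cint_minus (f g : R -> C) (a b : R) :
  a <= b -> cont_on a b f -> cont_on a b g ->
  Cint (fun t => f t - g t)%C a b = (Cint f a b - Cint g a b)%C.
Proof.
  intros Hab Hf Hg.
  rewrite (Cint_ext _ (fun t => f t + (- (1)) * g t)%C) by (intros; try ring; assumption).
  rewrite Cint_plus, Cint_scal; auto; [ring |].
  intros x Hx. apply continuous_Cmult; [apply continuous_Cconst | auto].
Qed.

Lemma Cint_const (c : C) (a b : R) : Cint (fun _ => c) a b = (RtoC (b - a) * c)%C.
Proof.
  unfold Cint. rewrite !RInt_const. unfold scal, Cmult, RtoC; simpl. unfold mult; simpl.
  unfold Re, Im. f_equal; ring.
Qed.

Lemma cont_on_sub (a b c d : R) (f : R -> C) :
  a <= c -> d <= b -> cont_on a b f -> cont_on c d f.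
Proof. intros H1 H2 H x Hx. apply H. lra. Qed.

Lemma Cint_Chasles (f : R -> C) (a b c : R) :
  a <= b -> b <= c -> cont_on a c f -> (Cint f a b + Cint f b c)%C = Cint f a c.
Proof.
  intros H1 H2 H.
  assert (A : cont_on a b f) by (apply (cont_on_sub a c); auto; lra).
  assert (B : cont_on b c f) by (apply (cont_on_sub a c); auto; lra).
  unfold Cint, Cplus; simpl. f_equal.
  - apply (RInt_Chasles (V := R_CompleteNormedModule)); apply ex_RInt_Re; assumption.
  - apply (RInt_Chasles (V := R_CompleteNormedModule)); apply ex_RInt_Im; assumption.
Qed.

Lemma Cint_translate (f : R -> C) (h a b : R) :
  a <= b -> cont_on (a + h) (b + h) f ->
  Cint (fun t => f (t + h)) a b = Cint f (a + h) (b + h).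
Proof.
  intros Hab H. assert (Hab' : a + h <= b + h) by lra.
  assert (Hr := ex_RInt_Re f _ _ Hab' H). assert (Hi := ex_RInt_Im f _ _ Hab' H).
  replace (a + h) with (1 * a + h) in * by ring. replace (b + h) with (1 * b + h) in * by ring.
  unfold Cint. f_equal.
  - rewrite <- (RInt_comp_lin (V := R_CompleteNormedModule) _ 1 h a b Hr).
    apply RInt_ext. intros x _. unfold scal; simpl; unfold mult; simpl.
    now rewrite !Rmult_1_l.
  - rewrite <- (RInt_comp_lin (V := R_CompleteNormedModule) _ 1 h a b Hi).
    apply RInt_ext. intros x _. unfold scal; simpl; unfold mult; simpl.
    now rewrite !Rmult_1_l.
Qed.

Lemma Cint_bound_fun (f : R -> C) (g : R -> R) (a b : R) :
  a <= b -> cont_on a b f -> ex_RInt g a b ->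
  (forall x, a <= x <= b -> Cmod (f x) <= g x) ->
  Cmod (Cint f a b) <= RInt g a b.
Proof.
  intros Hab H Hg HB.
  assert (HB0 : 0 <= RInt g a b).
  { apply RInt_ge_0; auto. intros x Hx. eapply Rle_trans; [apply Cmod_ge_0 | apply HB; lra]. }
  set (I := Cint f a b).
  destruct (Req_dec (Cmod I) 0) as [E | E]; [rewrite E; exact HB0 |].
  assert (HI : 0 < Cmod I) by (generalize (Cmod_ge_0 I); lra).
  (* Project the integrand onto the direction of the integral. *)
  assert (E1 : (Cconj I * I)%C = Cint (fun t => Cconj I * f t)%C a b)
    by (symmetry; apply Cint_scal; assumption).
  assert (E2 : Cmod I ^ 2 = RInt (fun t => Re (Cconj I * f t)%C) a b).
  { change (RInt (fun t => Re (Cconj I * f t)%C) a b) with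
      (Re (Cint (fun t => Cconj I * f t)%C a b)).
    rewrite <- E1, Cmod2_alt. unfold Re, Im, Cconj, Cmult; simpl. ring. }
  assert (Hc : cont_on a b (fun t => Cconj I * f t)%C).
  { intros x Hx. apply continuous_Cmult; [apply continuous_Cconst | auto]. }
  assert (L : RInt (fun t => Re (Cconj I * f t)%C) a b <= RInt (fun t => Cmod I * g t) a b).
  { apply RInt_le; auto.
    - apply (ex_RInt_Re (fun t => Cconj I * f t)%C); assumption.
    - exact (ex_RInt_scal (V := R_NormedModule) _ _ _ _ Hg).
    - intros t Ht. eapply Rle_trans; [apply Rle_abs |]. eapply Rle_trans; [apply re_le_Cmod |].
      rewrite Cmod_mult, Cmod_conj. apply Rmult_le_compat_l; [apply Cmod_ge_0 | apply HB; lra]. }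
  rewrite <- E2 in L.
  assert (L2 : RInt (fun t => Cmod I * g t) a b = Cmod I * RInt g a b)
    by (apply (RInt_scal (V := R_CompleteNormedModule)); exact Hg).
  rewrite L2 in L.
  apply Rmult_le_reg_l with (Cmod I); auto. nra.
Qed.

Lemma Cint_bound (f : R -> C) (a b B : R) :
  a <= b -> cont_on a b f -> (forall x, a <= x <= b -> Cmod (f x) <= B) ->
  Cmod (Cint f a b) <= B * (b - a).
Proof.
  intros Hab H HB. rewrite Rmult_comm.
  replace ((b - a) * B) with (RInt (fun _ => B) a b) by (rewrite RInt_const; reflexivity).
  apply Cint_bound_fun; auto. apply ex_RInt_const.
Qed.

Lemma Cint_derive (F f : R -> C) (a b : R) :
  a <= b ->
  (forall x, a <= x <= b -> is_derive (fun t => Re (F t)) x (Re (f x))) ->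
  (forall x, a <= x <= b -> is_derive (fun t => Im (F t)) x (Im (f x))) ->
  cont_on a b f -> Cint f a b = (F b - F a)%C.
Proof.
  intros Hab H1 H2 Hc. unfold Cint.
  apply injective_projections; simpl.
  - apply is_RInt_unique. apply (is_RInt_derive (V := R_CompleteNormedModule)
      (fun t => Re (F t)) (fun t => Re (f t))); rewrite Rmin_left, Rmax_right by exact Hab; auto.
    intros x Hx. apply continuous_C_Re, Hc, Hx.
  - apply is_RInt_unique. apply (is_RInt_derive (V := R_CompleteNormedModule)
      (fun t => Im (F t)) (fun t => Im (f t))); rewrite Rmin_left, Rmax_right by exact Hab; auto.
    intros x Hx. apply continuous_C_Im, Hc, Hx.
Qed.

(** * Finite sums *)

Fixpoint csum (f : nat -> C) (n : nat) : C :=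
  match n with O => RtoC 0 | S m => (csum f m + f m)%C end.

Fixpoint rsum (f : nat -> R) (n : nat) : R :=
  match n with O => 0 | S m => rsum f m + f m end.

Lemma csum_ext (f g : nat -> C) (n : nat) :
  (forall j, (j < n)%nat -> f j = g j) -> csum f n = csum g n.
Proof.
  induction n as [|n IH]; simpl; intros H; [reflexivity |].
  rewrite IH, H; auto.
Qed.

Lemma rsum_ext (f g : nat -> R) (n : nat) :
  (forall j, (j < n)%nat -> f j = g j) -> rsum f n = rsum g n.
Proof.
  induction n as [|n IH]; simpl; intros H; [reflexivity |].
  rewrite IH, H; auto.
Qed.

Lemma csum_plus (f g : nat -> C) (n : nat) :
  csum (fun j => f j + g j)%C n = (csum f n + csum g n)%C.
Proof. induction n as [|n IH]; simpl; [ring | rewrite IH; ring]. Qed.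

Lemma csum_scal (c : C) (f : nat -> C) (n : nat) :
  csum (fun j => c * f j)%C n = (c * csum f n)%C.
Proof. induction n as [|n IH]; simpl; [ring | rewrite IH; ring]. Qed.

Lemma csum_const (c : C) (n : nat) : csum (fun _ => c) n = (RtoC (INR n) * c)%C.
Proof.
  induction n as [|n IH]; [simpl; ring |].
  rewrite S_INR, RtoC_plus. simpl csum. rewrite IH. ring.
Qed.

Lemma csum_0 (f : nat -> C) (n : nat) :
  (forall j, (j < n)%nat -> f j = RtoC 0) -> csum f n = RtoC 0.
Proof. induction n as [|n IH]; simpl; intros H; [reflexivity | rewrite IH, H; auto; ring]. Qed.

Lemma csum_single (f : nat -> C) (n k : nat) :
  (k < n)%nat -> (forall j, (j < n)%nat -> j <> k -> f j = RtoC 0) -> csum f n = f k.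
Proof.
  induction n as [|n IH]; simpl; intros Hk H; [lia |].
  destruct (Nat.eq_dec k n) as [-> | Hn].
  - rewrite csum_0; [ring |]. intros j Hj. apply H; lia.
  - rewrite IH; auto; [| lia]. rewrite (H n); [ring | lia | lia].
Qed.

Lemma Cmod_csum (f : nat -> C) (n : nat) : Cmod (csum f n) <= rsum (fun j => Cmod (f j)) n.
Proof.
  induction n as [|n IH]; simpl; [rewrite Cmod_0; lra |].
  eapply Rle_trans; [apply Cmod_triangle | lra].
Qed.

Lemma rsum_le (f g : nat -> R) (n : nat) :
  (forall j, (j < n)%nat -> f j <= g j) -> rsum f n <= rsum g n.
Proof.
  induction n as [|n IH]; simpl; intros H; [lra |].
  assert (f n <= g n) by auto. assert (rsum f n <= rsum g n) by auto. lra.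
Qed.

Lemma rsum_const (c : R) (n : nat) : rsum (fun _ => c) n = INR n * c.
Proof. induction n as [|n IH]; [simpl; ring | rewrite S_INR; simpl rsum; rewrite IH; ring]. Qed.

Lemma rsum_scal (c : R) (f : nat -> R) (n : nat) :
  rsum (fun j => c * f j) n = c * rsum f n.
Proof. induction n as [|n IH]; simpl; [ring | rewrite IH; ring]. Qed.

Lemma rsum_plus (f g : nat -> R) (n : nat) :
  rsum (fun j => f j + g j) n = rsum f n + rsum g n.
Proof. induction n as [|n IH]; simpl; [ring | rewrite IH; ring]. Qed.

Lemma rsum_nonneg (f : nat -> R) (n : nat) : (forall j, 0 <= f j) -> 0 <= rsum f n.
Proof. intros H; induction n as [|n IH]; simpl; [lra | specialize (H n); lra]. Qed.

Lemma continuous_csum {T : UniformSpace} (f : nat -> T -> C) (n : nat) (x : T) :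
  (forall j, (j < n)%nat -> continuous (U := C_UniformSpace) (f j) x) ->
  continuous (U := C_UniformSpace) (fun t => csum (fun j => f j t) n) x.
Proof.
  induction n as [|n IH]; simpl; intros H; [apply continuous_Cconst |].
  apply continuous_Cplus; auto.
Qed.

Lemma Cint_csum (f : nat -> R -> C) (n : nat) (a b : R) :
  a <= b -> (forall j, (j < n)%nat -> cont_on a b (f j)) ->
  Cint (fun t => csum (fun j => f j t) n) a b = csum (fun j => Cint (f j) a b) n.
Proof.
  intros Hab. induction n as [|n IH]; simpl; intros H.
  - rewrite Cint_const. ring.
  - rewrite Cint_plus, IH; auto. intros x Hx. apply continuous_csum.
    intros j Hj. apply H; auto.
Qed.

(** * Continuous functions on the whole line *)

Definition contR (F : R -> C) : Prop :=
  forall t : R, continuous (T := R_UniformSpace) (U := C_UniformSpace) F t.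

Lemma contR_on (F : R -> C) (a b : R) : contR F -> cont_on a b F.
Proof. intros H x _. apply H. Qed.

Lemma contR_translate (F : R -> C) (h : R) : contR F -> contR (fun t => F (t + h)).
Proof.
  intros H t.
  apply (continuous_comp (U := R_UniformSpace) (V := R_UniformSpace) (fun t => t + h) F).
  - apply continuity_pt_filterlim. reg.
  - apply H.
Qed.

Lemma contR_mult (F G : R -> C) : contR F -> contR G -> contR (fun t => F t * G t)%C.
Proof. intros HF HG t. apply continuous_Cmult; auto. Qed.

Lemma contR_plus (F G : R -> C) : contR F -> contR G -> contR (fun t => F t + G t)%C.
Proof. intros HF HG t. apply continuous_Cplus; auto. Qed.

Lemma contR_scal (c : C) (G : R -> C) : contR G -> contR (fun t => c * G t)%C.
Proof. intros HG t. apply continuous_Cmult; auto. apply continuous_Cconst. Qed.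

Lemma contR_cis (a : R) : contR (fun t => cis (a * t)).
Proof. intros t. apply continuous_cis_lin. Qed.

Lemma contR_const (c : C) : contR (fun _ => c).
Proof. intros t. apply continuous_Cconst. Qed.

Lemma contR_csum (F : nat -> R -> C) (n : nat) :
  (forall j, (j < n)%nat -> contR (F j)) -> contR (fun t => csum (fun j => F j t) n).
Proof. intros H t. apply continuous_csum. intros j Hj. apply H, Hj. Qed.

(** * Means over long windows, uniformly in the position of the window *)

(** Uniformity in the left end [x] makes means invariant under translation and covers the symmetric
    windows of [is_fourier_coeff]. Continuity is included so that every integral in sight exists. *)
Definition umean (G : R -> C) (a : C) : Prop :=
  contR G /\
  forall eps : R, 0 < eps -> exists T0 : R, 0 < T0 /\
    forall T : R, T0 <= T -> forall x : R,
      Cmod (Cint G x (x + T) - RtoC T * a) <= eps * T.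

Lemma umean_ext (G H : R -> C) (a : C) :
  (forall t, G t = H t) -> umean G a -> umean H a.
Proof.
  intros E [Hc HG]. split.
  - intros t. apply continuous_ext with G; auto.
  - intros eps He. destruct (HG eps He) as [T0 [HT0 HT]]. exists T0. split; auto.
    intros T Hle x. rewrite <- (Cint_ext G H); auto. lra.
Qed.

Lemma umean_plus (G H : R -> C) (a b : C) :
  umean G a -> umean H b -> umean (fun t => G t + H t)%C (a + b)%C.
Proof.
  intros [Hc HG] [Hd HH]. split; [apply contR_plus; auto |].
  intros eps He. destruct (HG (eps / 2)) as [T0 [HT0 HT]]; [lra |].
  destruct (HH (eps / 2)) as [T1 [HT1 HT']]; [lra |].
  exists (Rmax T0 T1). split; [eapply Rlt_le_trans; [exact HT0 | apply Rmax_l] |].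
  intros T Hle x.
  assert (T0 <= T) by (eapply Rle_trans; [apply Rmax_l | exact Hle]).
  assert (T1 <= T) by (eapply Rle_trans; [apply Rmax_r | exact Hle]).
  rewrite Cint_plus; [| lra | apply contR_on; auto | apply contR_on; auto].
  replace (_ - _)%C with ((Cint G x (x + T) - RtoC T * a) + (Cint H x (x + T) - RtoC T * b))%C by ring.
  eapply Rle_trans; [apply Cmod_triangle |].
  specialize (HT T H0 x). specialize (HT' T H1 x). lra.
Qed.

Lemma umean_scal (c : C) (G : R -> C) (a : C) :
  umean G a -> umean (fun t => c * G t)%C (c * a)%C.
Proof.
  intros [Hc HG]. split; [apply contR_scal; auto |].
  intros eps He. assert (Hm := Cmod_ge_0 c).
  destruct (HG (eps / (Cmod c + 1))) as [T0 [HT0 HT]]; [apply Rdiv_lt_0_compat; lra |].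
  exists T0. split; auto. intros T Hle x.
  rewrite Cint_scal; [| lra | apply contR_on; auto].
  replace (_ - _)%C with (c * (Cint G x (x + T) - RtoC T * a))%C by ring.
  rewrite Cmod_mult. specialize (HT T Hle x).
  apply Rle_trans with (Cmod c * (eps / (Cmod c + 1) * T)).
  - apply Rmult_le_compat_l; auto.
  - apply Rle_trans with ((Cmod c + 1) * (eps / (Cmod c + 1) * T)).
    + apply Rmult_le_compat_r; [| lra].
      apply Rmult_le_pos; [| lra]. left; apply Rdiv_lt_0_compat; lra.
    + right. field. lra.
Qed.

Lemma umean_const (c : C) : umean (fun _ => c) c.
Proof.
  split; [apply contR_const |]. intros eps He. exists 1. split; [lra |].
  intros T HT x. rewrite Cint_const. replace (x + T - x) with T by ring.
  replace (_ - _)%C with (RtoC 0) by ring. rewrite Cmod_0. nra.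
Qed.

Lemma umean_csum (G : nat -> R -> C) (a : nat -> C) (n : nat) :
  (forall j, (j < n)%nat -> umean (G j) (a j)) ->
  umean (fun t => csum (fun j => G j t) n) (csum a n).
Proof.
  induction n as [|n IH]; simpl; intros H; [apply umean_const |].
  apply (umean_plus (fun t => csum (fun j => G j t) n)); auto.
Qed.

Lemma Cint_cis (a x y : R) :
  a <> 0 -> x <= y ->
  Cint (fun t => cis (a * t)) x y =
  (RtoC (/ a) * - Ci * (cis (a * y) - cis (a * x)))%C.
Proof.
  intros Ha Hxy.
  rewrite (Cint_derive (fun t => RtoC (/ a) * - Ci * cis (a * t))%C); auto.
  - ring.
  - intros t _. unfold cis, Ci, RtoC, Re, Cmult, Copp; simpl. auto_derive; auto. field. auto.
  - intros t _. unfold cis, Ci, RtoC, Im, Cmult, Copp; simpl. auto_derive; auto. field. auto.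
  - apply contR_on, contR_cis.
Qed.

Lemma umean_cis (a : R) : a <> 0 -> umean (fun t => cis (a * t)) 0.
Proof.
  intros Ha. split; [apply contR_cis |]. intros eps He.
  assert (Ha' : 0 < Rabs a) by (apply Rabs_pos_lt; auto).
  assert (Hp : 0 < 2 / Rabs a) by (apply Rdiv_lt_0_compat; lra).
  exists (2 / Rabs a / eps). split; [apply Rdiv_lt_0_compat; lra |].
  intros T HT x.
  assert (HT0 : 0 < T) by (eapply Rlt_le_trans; [| exact HT]; apply Rdiv_lt_0_compat; lra).
  rewrite Cint_cis by (auto; lra).
  rewrite Cmult_0_r. unfold Cminus at 1. rewrite Copp_0, Cplus_0_r.
  rewrite !Cmod_mult, Cmod_opp, Cmod_Ci, Cmod_R, Rabs_inv, Rmult_1_r.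
  apply Rle_trans with (/ Rabs a * 2).
  - apply Rmult_le_compat_l; [left; apply Rinv_0_lt_compat; auto |].
    eapply Rle_trans; [apply Cmod_triangle |]. rewrite Cmod_opp, !Cmod_cis. lra.
  - apply Rle_trans with (eps * (2 / Rabs a / eps)).
    + right. field. split; lra.
    + apply Rmult_le_compat_l; lra.
Qed.

(** The weight [K] will be a product of Fejer kernels and [G] its product with the function under
    study, bounded by [B]. *)
Lemma umean_bound_fun (G K : R -> C) (a k : C) (B : R) :
  0 <= B -> umean G a -> umean K k -> (forall t, Cmod (G t) <= B * Re (K t)) ->
  Cmod a <= B * Re k.
Proof.
  intros HB0 [Hc HG] [Hd HK] HB.
  apply le_epsilon. intros eps He.
  destruct (HG (eps / 2)) as [T0 [HT0 HT]]; [lra |].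
  (* Division by B + 1 covers the case B = 0. *)
  destruct (HK (eps / 2 / (B + 1))) as [T1 [HT1 HT']]; [repeat apply Rdiv_lt_0_compat; lra |].
  set (T := Rmax T0 T1).
  assert (L0 : T0 <= T) by apply Rmax_l. assert (L1 : T1 <= T) by apply Rmax_r.
  specialize (HT T L0 0). specialize (HT' T L1 0). rewrite Rplus_0_l in HT, HT'.
  assert (HTp : 0 < T) by lra.
  assert (M : Cmod (Cint G 0 T) <= B * Re (Cint K 0 T)).
  { assert (ER : ex_RInt (fun t => Re (K t)) 0 T) by (apply ex_RInt_Re; [lra | apply contR_on; auto]).
    replace (B * Re (Cint K 0 T)) with (RInt (fun t => B * Re (K t)) 0 T).
    - apply Cint_bound_fun; [lra | apply contR_on; auto | | auto].
      exact (ex_RInt_scal (V := R_NormedModule) _ _ _ _ ER).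
    - apply (RInt_scal (V := R_CompleteNormedModule)). exact ER. }
  assert (A1 : T * Cmod a <= Cmod (Cint G 0 T) + eps / 2 * T).
  { generalize (Cmod_triangle_rev (RtoC T * a) (Cint G 0 T)).
    rewrite (Cmod_minus_sym (RtoC T * a)), Cmod_mult, Cmod_R, Rabs_pos_eq; lra. }
  assert (A2 : Re (Cint K 0 T) <= T * Re k + eps / 2 / (B + 1) * T).
  { generalize (Rle_trans _ _ _ (re_le_Cmod _) HT').
    replace (Re (Cint K 0 T - RtoC T * k)) with (Re (Cint K 0 T) - T * Re k)
      by (unfold Re, Cminus, Cplus, Copp, Cmult, RtoC; simpl; ring).
    intros A. generalize (Rle_abs (Re (Cint K 0 T) - T * Re k)). lra. }
  assert (A3 : B * (eps / 2 / (B + 1) * T) <= eps / 2 * T).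
  { apply Rle_trans with ((B + 1) * (eps / 2 / (B + 1) * T)).
    - apply Rmult_le_compat_r; [| lra]. apply Rmult_le_pos; [| lra].
      left. repeat apply Rdiv_lt_0_compat; lra.
    - right. field. lra. }
  apply Rmult_le_reg_l with T; auto.
  assert (B * Re (Cint K 0 T) <= B * (T * Re k + eps / 2 / (B + 1) * T))
    by (apply Rmult_le_compat_l; auto).
  lra.
Qed.

Lemma umean_bound (G : R -> C) (a : C) (B : R) :
  umean G a -> (forall t, Cmod (G t) <= B) -> Cmod a <= B.
Proof.
  intros HG HB.
  assert (HB0 : 0 <= B) by (eapply Rle_trans; [apply Cmod_ge_0 | apply (HB 0)]).
  generalize (umean_bound_fun G (fun _ => RtoC 1) a 1 B HB0 HG (umean_const 1)).
  simpl. rewrite Rmult_1_r. intros H. apply H. exact HB.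
Qed.

Lemma umean_unique (G : R -> C) (a b : C) : umean G a -> umean G b -> a = b.
Proof.
  intros Ha Hb.
  assert (H : umean (fun _ => RtoC 0) (a + - (1) * b)%C).
  { apply umean_ext with (fun t => G t + - (1) * G t)%C; [intros; ring |].
    apply umean_plus; auto. apply umean_scal; auto. }
  assert (H0 : Cmod (a + - (1) * b) <= 0).
  { apply (umean_bound _ _ 0 H). intros. rewrite Cmod_0. lra. }
  assert (E : (a + - (1) * b)%C = 0).
  { apply Cmod_eq_0. generalize (Cmod_ge_0 (a + - (1) * b)). lra. }
  replace a with ((a + - (1) * b) + b)%C by ring. rewrite E. ring.
Qed.

Lemma umean_unif_limit (G : R -> C) (a : C) :
  contR G ->
  (forall eps, 0 < eps -> exists H b, umean H b /\ (forall t, Cmod (G t - H t) <= eps) /\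
     Cmod (a - b) <= eps) ->
  umean G a.
Proof.
  intros Hc HG. split; auto. intros eps He.
  destruct (HG (eps / 3)) as [H [b [[Hd HH] [HGH Hab]]]]; [lra |].
  destruct (HH (eps / 3)) as [T0 [HT0 HT]]; [lra |].
  exists T0. split; auto. intros T Hle x.
  specialize (HT T Hle x).
  replace (Cint G x (x + T) - RtoC T * a)%C with
    ((Cint G x (x + T) - Cint H x (x + T)) + (Cint H x (x + T) - RtoC T * b)
      + RtoC T * (b - a))%C by ring.
  eapply Rle_trans; [apply Cmod_triangle |].
  rewrite Cmod_mult, Cmod_R, (Rabs_pos_eq T), (Cmod_minus_sym b a) by lra.
  assert (A : Cmod (Cint G x (x + T) - Cint H x (x + T) + (Cint H x (x + T) - RtoC T * b))
           <= eps / 3 * T + eps / 3 * T).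
  { eapply Rle_trans; [apply Cmod_triangle |]. apply Rplus_le_compat; auto.
    rewrite <- Cint_minus; [| lra | apply contR_on; auto | apply contR_on; auto].
    replace T with (x + T - x) at 2 by ring.
    apply Cint_bound; [lra | | auto].
    intros y _. apply continuous_Cminus; auto. }
  assert (T * Cmod (a - b) <= T * (eps / 3)) by (apply Rmult_le_compat_l; lra).
  lra.
Qed.

(** * Bochner's criterion: total boundedness of the set of translates *)

(** The finite net consists of translates of [F] itself. Unlike Bohr's condition, this one passes to
    sums and products by intersecting two nets. *)
Definition TB (F : R -> C) : Prop :=
  forall eps : R, 0 < eps -> exists l : list R,
    forall tau : R, exists tau' : R, In tau' l /\
      forall t : R, Cmod (F (t + tau) - F (t + tau')) <= eps.

(** In [TB_joint] the sets are intersections of a ball of one net with a ball of the other. Such an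
    intersection need not contain either centre, so a new centre is chosen in each nonempty one. *)
Lemma list_representatives {A : Type} (P : A -> R -> Prop) (l : list A) :
  exists r : list R, forall i, In i l -> forall tau, P i tau ->
    exists tau', In tau' r /\ P i tau'.
Proof.
  induction l as [|i l [r Hr]].
  - exists nil. intros i [].
  - destruct (classic (exists tau, P i tau)) as [[tau Ht] | Hn].
    + exists (tau :: r). intros j [<- | Hj] s Hs.
      * exists tau. split; [left |]; auto.
      * destruct (Hr j Hj s Hs) as [s' [Hin Hp]]. exists s'. split; [right |]; auto.
    + exists r. intros j [<- | Hj] s Hs; [| eauto].
      exfalso. eauto.
Qed.

Lemma TB_joint (F G : R -> C) :
  TB F -> TB G -> forall eps : R, 0 < eps -> exists l : list R,
    forall tau : R, exists tau' : R, In tau' l /\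
      (forall t : R, Cmod (F (t + tau) - F (t + tau')) <= eps) /\
      (forall t : R, Cmod (G (t + tau) - G (t + tau')) <= eps).
Proof.
  intros HF HG eps He.
  destruct (HF (eps / 2)) as [l1 H1]; [lra |].
  destruct (HG (eps / 2)) as [l2 H2]; [lra |].
  set (P := fun (p : R * R) tau =>
    (forall t, Cmod (F (t + tau) - F (t + fst p)) <= eps / 2) /\
    (forall t, Cmod (G (t + tau) - G (t + snd p)) <= eps / 2)).
  destruct (list_representatives P (list_prod l1 l2)) as [r Hr].
  exists r. intros tau.
  destruct (H1 tau) as [t1 [I1 C1]]. destruct (H2 tau) as [t2 [I2 C2]].
  destruct (Hr (t1, t2)) with (tau := tau) as [tau' [Hin [D1 D2]]].
  - apply in_prod; auto.
  - split; auto.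
  - exists tau'. split; auto. simpl in D1, D2. split; intros t.
    + eapply Rle_trans; [apply (Cmod_triangle_minus _ (F (t + t1))) |].
      rewrite (Cmod_minus_sym (F (t + t1))). specialize (C1 t). specialize (D1 t). lra.
    + eapply Rle_trans; [apply (Cmod_triangle_minus _ (G (t + t2))) |].
      rewrite (Cmod_minus_sym (G (t + t2))). specialize (C2 t). specialize (D2 t). lra.
Qed.

Lemma list_abs_bound (l : list R) : exists M, 0 <= M /\ forall x, In x l -> Rabs x <= M.
Proof.
  induction l as [|a l [M [HM H]]].
  - exists 0. split; [lra | intros x []].
  - exists (M + Rabs a). generalize (Rabs_pos a). intros Ha. split; [lra |].
    intros x [<- | Hx]; [lra |]. specialize (H x Hx). lra.
Qed.

Lemma TB_bounded (F : R -> C) : TB F -> exists B, 0 < B /\ forall t, Cmod (F t) <= B.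
Proof.
  intros H. destruct (H 1) as [l Hl]; [lra |].
  destruct (list_abs_bound (map (fun x => Cmod (F x)) l)) as [M [HM Hb]].
  exists (M + 1). split; [lra |]. intros t.
  destruct (Hl t) as [t' [Hin Ht]]. specialize (Ht 0). rewrite !Rplus_0_l in Ht.
  generalize (Cmod_triangle_rev (F t) (F t')).
  assert (Hx := Hb _ (in_map (fun x => Cmod (F x)) l t' Hin)).
  rewrite Rabs_pos_eq in Hx by apply Cmod_ge_0. lra.
Qed.

Lemma TB_plus (F G : R -> C) : TB F -> TB G -> TB (fun t => F t + G t)%C.
Proof.
  intros HF HG eps He. destruct (TB_joint F G HF HG (eps / 2)) as [l Hl]; [lra |].
  exists l. intros tau. destruct (Hl tau) as [tau' [Hin [H1 H2]]]. exists tau'. split; auto.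
  intros t.
  replace (_ - _)%C with ((F (t + tau)%R - F (t + tau')%R) + (G (t + tau)%R - G (t + tau')%R))%C by ring.
  eapply Rle_trans; [apply Cmod_triangle |]. specialize (H1 t). specialize (H2 t). lra.
Qed.

Lemma TB_mult (F G : R -> C) : TB F -> TB G -> TB (fun t => F t * G t)%C.
Proof.
  intros HF HG eps He.
  destruct (TB_bounded F HF) as [A [HA FA]]. destruct (TB_bounded G HG) as [B [HB GB]].
  assert (Hp : 0 < eps / (A + B)) by (apply Rdiv_lt_0_compat; lra).
  destruct (TB_joint F G HF HG _ Hp) as [l Hl].
  exists l. intros tau. destruct (Hl tau) as [tau' [Hin [H1 H2]]]. exists tau'. split; auto.
  intros t.
  replace (_ - _)%C with ((F (t + tau)%R - F (t + tau')%R) * G (t + tau)%R +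
     F (t + tau')%R * (G (t + tau)%R - G (t + tau')%R))%C by ring.
  eapply Rle_trans; [apply Cmod_triangle |]. rewrite !Cmod_mult.
  apply Rle_trans with (eps / (A + B) * B + A * (eps / (A + B))).
  - apply Rplus_le_compat; apply Rmult_le_compat; auto; apply Cmod_ge_0.
  - right. field. lra.
Qed.

Lemma TB_const (c : C) : TB (fun _ => c).
Proof.
  intros eps He. exists (0 :: nil). intros tau. exists 0. split; [left; auto |].
  intros t. replace (c - c)%C with (RtoC 0) by ring. rewrite Cmod_0. lra.
Qed.

Lemma TB_scal (c : C) (G : R -> C) : TB G -> TB (fun t => c * G t)%C.
Proof. apply (TB_mult (fun _ => c)), TB_const. Qed.

Lemma TB_csum (F : nat -> R -> C) (n : nat) :
  (forall j, (j < n)%nat -> TB (F j)) -> TB (fun t => csum (fun j => F j t) n).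
Proof.
  induction n as [|n IH]; simpl; intros H; [apply TB_const |].
  apply (TB_plus (fun t => csum (fun j => F j t) n)); auto.
Qed.

Lemma TB_translate (F : R -> C) (h : R) : TB F -> TB (fun t => F (t + h)).
Proof.
  intros H eps He. destruct (H eps He) as [l Hl]. exists l. intros tau.
  destruct (Hl tau) as [tau' [Hin Ht]]. exists tau'. split; auto. intros t.
  replace (t + tau + h) with (t + h + tau) by ring.
  replace (t + tau' + h) with (t + h + tau') by ring. apply Ht.
Qed.

Lemma TB_unif_limit (F : R -> C) :
  (forall eps, 0 < eps -> exists G, TB G /\ forall t, Cmod (F t - G t) <= eps) -> TB F.
Proof.
  intros H eps He. destruct (H (eps / 3)) as [G [HG HFG]]; [lra |].
  destruct (HG (eps / 3)) as [l Hl]; [lra |]. exists l. intros tau.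
  destruct (Hl tau) as [tau' [Hin Ht]]. exists tau'. split; auto. intros t.
  replace (F (t + tau)%R - F (t + tau')%R)%C with
    ((F (t + tau)%R - G (t + tau)%R) + (G (t + tau)%R - G (t + tau')%R) + (G (t + tau')%R - F (t + tau')%R))%C by ring.
  eapply Rle_trans; [apply Cmod_triangle |].
  assert (A := HFG (t + tau')). rewrite Cmod_minus_sym in A.
  assert (B := Cmod_triangle (F (t + tau) - G (t + tau)) (G (t + tau) - G (t + tau'))).
  specialize (Ht t). specialize (HFG (t + tau)). lra.
Qed.

(** * Bohr's condition, uniform continuity and total boundedness *)

Definition unif_cont (F : R -> C) : Prop :=
  forall eps, 0 < eps -> exists d, 0 < d /\
    forall t t', Rabs (t - t') <= d -> Cmod (F t - F t') <= eps.

Definition bohr (F : R -> C) : Prop :=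
  forall eps, 0 < eps -> exists l, 0 < l /\
    forall x, exists tau, x <= tau <= x + l /\ forall t, Cmod (F (t + tau) - F t) <= eps.

Lemma floor_decomp (T x : R) :
  0 < T -> 0 <= x -> exists (n : nat) (r : R), x = INR n * T + r /\ 0 <= r < T.
Proof.
  intros HT Hx.
  destruct (nfloor_ex (x / T)) as [n [H1 H2]].
  { apply Rmult_le_pos; auto. left; apply Rinv_0_lt_compat; auto. }
  exists n, (x - INR n * T). split; [ring |].
  assert (E : x = x / T * T) by (field; lra).
  split.
  - rewrite E at 1. assert (INR n * T <= x / T * T) by (apply Rmult_le_compat_r; lra). lra.
  - assert (x / T * T < (INR n + 1) * T) by (apply Rmult_lt_compat_r; lra). lra.
Qed.

(** Every [tau] is an almost period plus a number in [0, l]; uniform continuity allows that number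
    to be rounded down to a multiple of [d], which leaves finitely many translates. *)
Lemma bohr_TB (F : R -> C) : bohr F -> unif_cont F -> TB F.
Proof.
  intros HB HU eps He.
  destruct (HB (eps / 2)) as [l [Hl Hb]]; [lra |].
  destruct (HU (eps / 2)) as [d [Hd Hu]]; [lra |].
  destruct (floor_decomp d l Hd) as [K [r [HK Hr]]]; [lra |].
  exists (map (fun k => INR k * d) (seq 0 (S K))). intros tau.
  destruct (Hb (tau - l)) as [rho [Hrho Hap]].
  destruct (floor_decomp d (tau - rho) Hd) as [k [s [Hk Hs]]]; [lra |].
  exists (INR k * d). split.
  - apply in_map_iff. exists k. split; auto. apply in_seq. split; [lia |].
    assert (INR k < INR K + 1).
    { apply Rmult_lt_reg_r with d; auto. lra. }
    rewrite <- S_INR in H. apply INR_lt in H. lia.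
  - intros t.
    eapply Rle_trans; [apply (Cmod_triangle_minus _ (F (t + (tau - rho)))) |].
    assert (A := Hap (t + (tau - rho))). replace (t + (tau - rho) + rho) with (t + tau) in A by ring.
    assert (B : Cmod (F (t + (tau - rho)) - F (t + INR k * d)) <= eps / 2).
    { apply Hu. replace (_ - _) with s by lra. rewrite Rabs_pos_eq; lra. }
    lra.
Qed.

(** An almost period moves [t] into [0, l] and a neighbour at distance at most 1 into [-1, l + 1],
    where continuity is uniform by compactness. *)
Lemma bohr_unif_cont (F : R -> C) : contR F -> bohr F -> unif_cont F.
Proof.
  intros Hc HB eps He.
  destruct (HB (eps / 3)) as [l [Hl Hb]]; [lra |].
  assert (Hs : 0 < sqrt 2) by (apply sqrt_lt_R0; lra).
  assert (He2 : 0 < eps / 3 / sqrt 2) by (repeat apply Rdiv_lt_0_compat; lra).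
  destruct (unifcont_1d (V := C_UniformSpace) F (-1) (l + 1)) with (eps := mkposreal _ He2) as [d Hd].
  { intros x _. apply Hc. }
  exists (Rmin (d / 2) 1). assert (Hdp := cond_pos d).
  split; [apply Rmin_glb_lt; lra |].
  intros t t' Ht.
  assert (Ht1 : Rabs (t - t') <= d / 2) by (eapply Rle_trans; [exact Ht | apply Rmin_l]).
  assert (Ht2 : Rabs (t - t') <= 1) by (eapply Rle_trans; [exact Ht | apply Rmin_r]).
  destruct (Hb (- t)) as [tau [Htau Hap]].
  assert (M : Cmod (F (t + tau)%R - F (t' + tau)) <= eps / 3).
  { assert (Hball : ball (F (t' + tau)) (mkposreal _ He2) (F (t + tau)%R)).
    { apply NNPP. apply Hd.
      - unfold Rabs in Ht2; destruct Rcase_abs; lra.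
      - lra.
      - change (Rabs ((t + tau) - (t' + tau)) < d).
        replace (_ - _) with (t - t') by ring. lra. }
    apply C_NormedModule_mixin_compat2 in Hball. simpl in Hball.
    replace (sqrt 2 * (eps / 3 / sqrt 2)) with (eps / 3) in Hball by (field; lra).
    left. exact Hball. }
  replace (F t - F t')%C with
    ((F t - F (t + tau)%R) + (F (t + tau)%R - F (t' + tau)%R) + (F (t' + tau)%R - F t'))%C by ring.
  eapply Rle_trans; [apply Cmod_triangle |].
  assert (B := Cmod_triangle (F t - F (t + tau)) (F (t + tau) - F (t' + tau))).
  assert (A1 := Hap t). assert (A2 := Hap t'). rewrite Cmod_minus_sym in A1. lra.
Qed.

(** Up to a factor of modulus 1, the difference is the integral of [cis] from [y] to [x]. *)
Lemma cis_lipschitz (x y : R) : Cmod (cis x - cis y) <= Rabs (x - y).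
Proof.
  assert (W : forall x y, y <= x -> Cmod (cis x - cis y) <= Rabs (x - y)).
  { clear x y. intros x y H.
    assert (E := Cint_cis 1 y x ltac:(lra) H).
    assert (B : Cmod (Cint (fun t => cis (1 * t)) y x) <= 1 * (x - y)).
    { apply Cint_bound; auto.
      - apply contR_on, contR_cis.
      - intros. rewrite Cmod_cis. lra. }
    rewrite E in B. rewrite !Cmod_mult, Cmod_R, Cmod_opp, Cmod_Ci, Rinv_1, Rabs_R1 in B.
    rewrite !Rmult_1_l in B. rewrite Rabs_pos_eq; lra. }
  destruct (Rle_dec y x) as [H | H]; [auto |].
  rewrite Cmod_minus_sym, Rabs_minus_sym. apply W. lra.
Qed.

Lemma cis_2PI (n : nat) : cis (2 * PI * INR n) = RtoC 1.
Proof.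
  unfold cis. replace (2 * PI * INR n) with (0 + 2 * INR n * PI) by ring.
  rewrite cos_period, sin_period, cos_0, sin_0. reflexivity.
Qed.

Lemma cis_2PI_Z (k : Z) : cis (2 * PI * IZR k) = RtoC 1.
Proof.
  destruct (Z_le_dec 0 k) as [Hm | Hm].
  - rewrite <- (Z2Nat.id k Hm), <- INR_IZR_INZ. apply cis_2PI.
  - assert (E : (cis (2 * PI * IZR k) * cis (2 * PI * INR (Z.to_nat (- k))))%C = 1).
    { rewrite <- cis_plus, INR_IZR_INZ, Z2Nat.id, opp_IZR by lia.
      replace (_ + _) with 0 by ring. apply cis_0. }
    rewrite cis_2PI, Cmult_1_r in E. exact E.
Qed.

Lemma TB_cis (a : R) : TB (fun t => cis (a * t)).
Proof.
  destruct (Req_dec a 0) as [-> | Ha].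
  { intros eps He. exists (0 :: nil). intros tau. exists 0. split; [left; auto |].
    intros t. rewrite !Rmult_0_l. replace (_ - _)%C with (RtoC 0) by ring. rewrite Cmod_0. lra. }
  assert (Ha' : 0 < Rabs a) by (apply Rabs_pos_lt; auto).
  assert (HP := PI_RGT_0).
  apply bohr_TB.
  - intros eps He. exists (2 * PI / Rabs a). split; [apply Rdiv_lt_0_compat; lra |].
    intros x.
    set (p := 2 * PI / Rabs a). assert (Hp : 0 < p) by (apply Rdiv_lt_0_compat; lra).
    set (k := up (x / p)). destruct (archimed (x / p)) as [K1 K2]. fold k in K1, K2.
    exists (IZR k * p). split.
    + assert (E : x = x / p * p) by (field; lra). split.
      * rewrite E at 1. apply Rmult_le_compat_r; lra.
      * rewrite E at 1. replace (x / p * p + p) with ((x / p + 1) * p) by ring.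
        apply Rmult_le_compat_r; lra.
    + intros t.
      assert (E : cis (a * (IZR k * p)) = RtoC 1).
      { unfold p, Rabs. destruct Rcase_abs.
        - replace (a * (IZR k * (2 * PI / - a))) with (2 * PI * IZR (- k))
            by (rewrite opp_IZR; field; lra). apply cis_2PI_Z.
        - replace (a * (IZR k * (2 * PI / a))) with (2 * PI * IZR k) by (field; lra). apply cis_2PI_Z. }
      replace (a * (t + IZR k * p)) with (a * t + a * (IZR k * p)) by ring.
      rewrite cis_plus, E. replace (_ - _)%C with (RtoC 0) by ring. rewrite Cmod_0. lra.
  - intros eps He. exists (eps / Rabs a). split; [apply Rdiv_lt_0_compat; lra |].
    intros t t' Ht. eapply Rle_trans; [apply cis_lipschitz |].
    replace (a * t - a * t') with (a * (t - t')) by ring.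
    rewrite Rabs_mult. apply Rle_trans with (Rabs a * (eps / Rabs a)).
    + apply Rmult_le_compat_l; lra.
    + right. field. lra.
Qed.

(** * Completeness, and existence of means *)

Lemma C_complete (u : nat -> C) :
  (forall eps, 0 < eps -> exists N, forall n m, (N <= n)%nat -> (N <= m)%nat -> Cmod (u n - u m) <= eps) ->
  exists l, forall eps, 0 < eps -> exists N, forall n, (N <= n)%nat -> Cmod (u n - l) <= eps.
Proof.
  intros H.
  assert (CR : forall p : C -> R, (forall z w, Rabs (p z - p w) <= Cmod (z - w)) ->
    exists l, Un_cv (fun n => p (u n)) l).
  { intros p Hp. destruct (Rcomplete.R_complete (fun n => p (u n))) as [l Hl]; [| exists l; exact Hl].
    intros eps He. destruct (H (eps / 2)) as [N HN]; [lra |].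
    exists N. intros n m Hn Hm. unfold Rdist.
    specialize (HN n m Hn Hm). specialize (Hp (u n) (u m)). lra. }
  destruct (CR Re) as [a Ha]. { intros z w. apply (re_le_Cmod (z - w)). }
  destruct (CR Im) as [b Hb]. { intros z w. apply (im_le_Cmod (z - w)). }
  exists (a, b). intros eps He.
  destruct (Ha (eps / 2)) as [N1 H1]; [lra |]. destruct (Hb (eps / 2)) as [N2 H2]; [lra |].
  exists (N1 + N2)%nat. intros n Hn.
  specialize (H1 n ltac:(lia)). specialize (H2 n ltac:(lia)). unfold Rdist in *.
  eapply Rle_trans; [apply Cmod_le_Re_Im |].
  change (Re (u n - (a, b))%C) with (Re (u n) - a).
  change (Im (u n - (a, b))%C) with (Im (u n) - b). lra.
Qed.

Lemma INR_large (z : R) : exists N : nat, forall n, (N <= n)%nat -> z <= INR n.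
Proof.
  destruct (nfloor_ex (Rmax z 0)) as [N [_ HN]]; [apply Rmax_r |].
  exists (S N). intros n Hn. apply le_INR in Hn. rewrite S_INR in Hn.
  generalize (Rmax_l z 0). lra.
Qed.

(** Total boundedness makes the average over a long window almost independent of its position.
    Averages over still longer windows are then close to it, so they form a Cauchy family. *)
Lemma TB_umean (G : R -> C) : contR G -> TB G -> exists a, umean G a.
Proof.
  intros Hc HT.
  destruct (TB_bounded G HT) as [B [HB GB]].
  set (I := fun x T => Cint G x (x + T)).
  assert (IB : forall x T, 0 <= T -> Cmod (I x T) <= B * T).
  { intros x T HTp. unfold I. replace T with (x + T - x) at 2 by ring.
    apply Cint_bound; [lra | apply contR_on; auto | auto]. }
  assert (IC : forall x S T, 0 <= S -> 0 <= T -> I x (S + T)%R = (I x S + I (x + S)%R T)%C).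
  { intros x S T HS HTp. unfold I.
    rewrite (Cint_Chasles G x (x + S)); [f_equal; ring | lra | lra | apply contR_on; auto]. }
  (* The shift y - x is replaced by one of the finitely many centres [s], all bounded by [M];
     shifting a window by [s] changes its integral by at most 2 * B * M, which is small against a
     long [T]. *)
  assert (W : forall eps, 0 < eps -> exists T0, 0 < T0 /\ forall T, T0 <= T ->
     forall x y, Cmod (I x T - I y T) <= eps * T).
  { intros eps He. destruct (HT (eps / 2)) as [l Hl]; [lra |].
    destruct (list_abs_bound l) as [M [HM Hlm]].
    exists (4 * B * (M + 1) / eps). split.
    { apply Rdiv_lt_0_compat; auto. nra. }
    intros T HTge x y.
    assert (HTp : 0 < T).
    { eapply Rlt_le_trans; [| exact HTge]. apply Rdiv_lt_0_compat; auto. nra. }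
    assert (HTe : 4 * B * (M + 1) <= eps * T).
    { replace (4 * B * (M + 1)) with (eps * (4 * B * (M + 1) / eps)) by (field; lra).
      apply Rmult_le_compat_l; lra. }
    destruct (Hl (y - x)) as [s [Hin Hs]].
    assert (Hsm := Hlm s Hin).
    assert (E1 : I y T = Cint (fun t => G (t + (y - x))) x (x + T)).
    { rewrite Cint_translate; [unfold I; f_equal; ring | lra | apply contR_on; auto]. }
    assert (E2 : I (x + s)%R T = Cint (fun t => G (t + s)) x (x + T)).
    { rewrite Cint_translate; [unfold I; f_equal; ring | lra | apply contR_on; auto]. }
    assert (D1 : Cmod (I y T - I (x + s)%R T) <= eps / 2 * T).
    { rewrite E1, E2, <- Cint_minus; [| lra | apply contR_on, contR_translate; auto
        | apply contR_on, contR_translate; auto].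
      replace T with (x + T - x) at 2 by ring.
      apply Cint_bound; [lra | | auto].
      intros u _. apply continuous_Cminus; apply contR_translate; auto. }
    assert (D2 : Cmod (I (x + s)%R T - I x T) <= 2 * B * M).
    { assert (W2 : forall u v, 0 <= v <= M -> Cmod (I (u + v)%R T - I u T) <= 2 * B * M).
      { intros u v Hv.
        assert (E : (I u v + I (u + v)%R T)%C = (I u T + I (u + T)%R v)%C).
        { rewrite <- !IC by lra. f_equal; ring. }
        replace (I (u + v)%R T - I u T)%C with (I (u + T)%R v - I u v)%C.
        2: { replace (I (u + T)%R v) with (I u v + I (u + v)%R T - I u T)%C by (rewrite E; ring). ring. }
        eapply Rle_trans; [apply Cmod_triangle |]. rewrite Cmod_opp.
        assert (IB1 := IB (u + T) v ltac:(lra)). assert (IB2 := IB u v ltac:(lra)).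
        assert (B * v <= B * M) by (apply Rmult_le_compat_l; lra). lra. }
      destruct (Rle_dec 0 s) as [Hp | Hp].
      - apply W2. rewrite Rabs_pos_eq in Hsm; lra.
      - rewrite Cmod_minus_sym. replace x with ((x + s) + - s) at 1 by ring. apply W2.
        rewrite Rabs_left in Hsm; lra. }
    rewrite Cmod_minus_sym.
    eapply Rle_trans; [apply (Cmod_triangle_minus _ (I (x + s)%R T)) |].
    assert (0 < B * (M + 1)) by nra. lra. }
  set (A := fun T => (RtoC (/ T) * I 0 T)%C).
  (* The window of length [T'] is cut into blocks of length [T], each close to the reference block
     at 0, and a remainder shorter than [T], which costs at most 2 * B * T. *)
  assert (K : forall eps, 0 < eps -> exists T0, 0 < T0 /\ forall T, T0 <= T ->
     exists T1, 0 < T1 /\ forall T', T1 <= T' -> forall x,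
     Cmod (I x T' - RtoC T' * A T) <= eps * T').
  { intros eps He. destruct (W (eps / 2)) as [T0 [HT0 HW]]; [lra |].
    exists T0. split; auto. intros T HTge.
    assert (HTp : 0 < T) by lra.
    exists (4 * B * T / eps). split; [apply Rdiv_lt_0_compat; nra |].
    intros T' HT' x.
    assert (HTp' : 0 < T') by (eapply Rlt_le_trans; [| exact HT']; apply Rdiv_lt_0_compat; nra).
    assert (HTe : 4 * B * T <= eps * T').
    { replace (4 * B * T) with (eps * (4 * B * T / eps)) by (field; lra).
      apply Rmult_le_compat_l; lra. }
    destruct (floor_decomp T T' HTp) as [n [r [En Hr]]]; [lra |].
    assert (N : forall m, Cmod (I x (INR m * T)%R - RtoC (INR m) * I 0 T) <= INR m * (eps / 2 * T)).
    { induction m as [|m IH].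
      - simpl INR. rewrite Rmult_0_l. unfold I. rewrite Rplus_0_r.
        replace (Cint G x x) with (RtoC 0).
        + replace (_ - _)%C with (RtoC 0) by ring. rewrite Cmod_0. lra.
        + unfold Cint. rewrite !RInt_point. reflexivity.
      - rewrite S_INR, RtoC_plus. replace ((INR m + 1) * T) with (INR m * T + T) by ring.
        assert (Hm := pos_INR m).
        rewrite IC; [| apply Rmult_le_pos; lra | lra].
        replace (_ - _)%C with ((I x (INR m * T)%R - RtoC (INR m) * I 0 T) +
          (I (x + INR m * T)%R T - I 0 T))%C by ring.
        eapply Rle_trans; [apply Cmod_triangle |].
        specialize (HW T HTge (x + INR m * T) 0). lra. }
    assert (Hn := pos_INR n).
    assert (Hnt : 0 <= INR n * T) by (apply Rmult_le_pos; lra).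
    assert (EA : (RtoC T' * A T)%C = (RtoC (INR n) * I 0 T + RtoC r * A T)%C).
    { unfold A. rewrite En, RtoC_plus, RtoC_mult, RtoC_inv by lra.
      field. intros E. apply RtoC_inj in E. lra. }
    rewrite EA. rewrite En at 1. rewrite IC by lra.
    replace (_ - _)%C with ((I x (INR n * T)%R - RtoC (INR n) * I 0 T) +
      (I (x + INR n * T)%R r - RtoC r * A T))%C by ring.
    eapply Rle_trans; [apply Cmod_triangle |].
    assert (L1 : Cmod (I (x + INR n * T)%R r - RtoC r * A T) <= 2 * B * T).
    { eapply Rle_trans; [apply Cmod_triangle |]. rewrite Cmod_opp.
      assert (IB1 := IB (x + INR n * T) r ltac:(lra)).
      assert (IB2 := IB 0 T ltac:(lra)).
      unfold A. rewrite !Cmod_mult, !Cmod_R, (Rabs_pos_eq r), Rabs_pos_eq;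
        [| left; apply Rinv_0_lt_compat; auto | lra].
      assert (/ T * Cmod (I 0 T) <= B).
      { apply Rmult_le_reg_l with T; auto. rewrite <- Rmult_assoc, Rinv_r, Rmult_1_l by lra. lra. }
      assert (r * (/ T * Cmod (I 0 T)) <= T * B).
      { apply Rmult_le_compat; try lra. apply Rmult_le_pos; [| apply Cmod_ge_0].
        left; apply Rinv_0_lt_compat; auto. }
      assert (B * r <= B * T) by (apply Rmult_le_compat_l; lra). lra. }
    specialize (N n).
    assert (INR n * (eps / 2 * T) <= eps / 2 * T').
    { rewrite En. assert (0 <= eps / 2 * r) by (apply Rmult_le_pos; lra). lra. }
    lra. }
  destruct (C_complete (fun n => A (INR n))) as [a Ha].
  { intros eps He. destruct (K (eps / 2)) as [T0 [HT0 HK]]; [lra |].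
    destruct (HK T0 ltac:(lra)) as [T1 [HT1 HK1]].
    destruct (INR_large T1) as [N HN]. exists N. intros n m Hn Hm.
    assert (Q : forall j, (N <= j)%nat -> Cmod (A (INR j) - A T0) <= eps / 2).
    { intros j Hj. specialize (HN j Hj). specialize (HK1 (INR j) HN 0).
      assert (Hjp : 0 < INR j) by lra.
      apply Rmult_le_reg_l with (INR j); auto.
      rewrite <- (Rabs_pos_eq (INR j)) at 1 by lra. rewrite <- Cmod_R, <- Cmod_mult.
      replace (RtoC (INR j) * (A (INR j) - A T0))%C with (I 0 (INR j) - RtoC (INR j) * A T0)%C.
      - lra.
      - unfold A at 2. rewrite RtoC_inv by lra. field. intros E. apply RtoC_inj in E. lra. }
    eapply Rle_trans; [apply (Cmod_triangle_minus _ (A T0)) |].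
    rewrite (Cmod_minus_sym (A T0)). assert (Q1 := Q n Hn). assert (Q2 := Q m Hm). lra. }
  exists a. split; auto. intros eps He.
  destruct (K (eps / 2)) as [T0 [HT0 HK]]; [lra |].
  destruct (Ha (eps / 2)) as [N HN]; [lra |].
  destruct (INR_large T0) as [N' HN'].
  set (n := (N + N')%nat). specialize (HN n ltac:(lia)). specialize (HN' n ltac:(lia)).
  destruct (HK (INR n) HN') as [T1 [HT1 HK1]].
  exists T1. split; auto. intros T HTge x. specialize (HK1 T HTge x). fold (I x T).
  replace (I x T - RtoC T * a)%C with
    ((I x T - RtoC T * A (INR n)) + RtoC T * (A (INR n) - a))%C by ring.
  eapply Rle_trans; [apply Cmod_triangle |].
  rewrite Cmod_mult, Cmod_R, (Rabs_pos_eq T) by lra.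
  assert (T * Cmod (A (INR n) - a) <= T * (eps / 2)) by (apply Rmult_le_compat_l; lra).
  lra.
Qed.

Lemma TB_ext (F G : R -> C) : (forall t, F t = G t) -> TB F -> TB G.
Proof.
  intros E H eps He. destruct (H eps He) as [l Hl]. exists l. intros tau.
  destruct (Hl tau) as [tau' [Hin Ht]]. exists tau'. split; auto. intros t. rewrite <- !E. auto.
Qed.

Lemma TB_bohr (F : R -> C) : TB F -> bohr F.
Proof.
  intros H eps He. destruct (H eps He) as [l Hl].
  destruct (list_abs_bound l) as [M [HM Hb]].
  exists (2 * M + 1). split; [lra |]. intros x.
  destruct (Hl (x + M)) as [s [Hin Hs]]. specialize (Hb s Hin). apply Rabs_le_between in Hb.
  exists (x + M - s). split; [lra |]. intros t. specialize (Hs (t - s)).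
  replace (t - s + (x + M)) with (t + (x + M - s)) in Hs by ring.
  replace (t - s + s) with t in Hs by ring. exact Hs.
Qed.

(** * Uniform smallness of Fourier means *)

(** One window length [T0] that works for the frequency [lam0] works nearby, because on such a
    window the two characters differ by an almost constant factor of modulus 1. Longer windows are
    cut into pieces of length [T0], and [-L, L] is compact. *)
Lemma umean_zero_uniform (h : R -> C) (B L eps : R) :
  contR h -> 0 < B -> (forall t, Cmod (h t) <= B) ->
  (forall lam, umean (fun t => h t * cis (- lam * t))%C 0) ->
  0 < eps -> exists T1, 0 < T1 /\ forall T, T1 <= T -> forall lam, Rabs lam <= L ->
    forall x, Cmod (Cint (fun t => h t * cis (- lam * t))%C x (x + T)) <= eps * T.
Proof.
  intros Hc HB0 HB Hm He.
  assert (CC : forall lam, contR (fun t => h t * cis (- lam * t))%C)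
    by (intros lam; apply contR_mult; [auto | apply contR_cis]).
  (* A single positive [d] encodes both the size of the neighbourhood and, through its inverse, the
     threshold for [T]: the compactness lemma bounds just one such function from below. *)
  assert (loc : forall lam0, exists d : posreal, forall T, / d <= T -> forall lam,
     Rabs (lam - lam0) < d -> forall x,
     Cmod (Cint (fun t => h t * cis (- lam * t))%C x (x + T)) <= eps * T).
  { intros lam0. destruct (Hm lam0) as [_ Hm0].
    destruct (Hm0 (eps / 4)) as [T0 [HT0 H0]]; [lra |].
    assert (Hd1 : 0 < eps / (4 * B * T0)) by (apply Rdiv_lt_0_compat; [lra |]; apply Rmult_lt_0_compat; lra).
    assert (Hd2 : 0 < eps / (2 * B * T0)) by (apply Rdiv_lt_0_compat; [lra |]; apply Rmult_lt_0_compat; lra).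
    exists (mkposreal _ (Rmin_stable_in_posreal (mkposreal _ Hd1) (mkposreal _ Hd2))). simpl.
    intros T HT lam Hlam x.
    assert (Hlam' : Rabs (lam - lam0) <= eps / (4 * B * T0))
      by (left; eapply Rlt_le_trans; [exact Hlam | apply Rmin_l]).
    assert (HT' : 2 * B * T0 / eps <= T).
    { eapply Rle_trans; [| exact HT]. replace (2 * B * T0 / eps) with (/ (eps / (2 * B * T0))) by (field; nra).
      apply Rinv_le_contravar; [| apply Rmin_r]. apply Rmin_glb_lt; auto. }
    clear Hlam HT.
    assert (Win : forall y, Cmod (Cint (fun t => h t * cis (- lam * t))%C y (y + T0)) <= eps / 2 * T0).
    { intros y.
      (* The quotient of the two characters is frozen at the left end [y] of the window. *)
      assert (D : Cmod (Cint (fun t => h t * cis (- lam * t))%C y (y + T0)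
         - cis (- (lam - lam0) * y) * Cint (fun t => h t * cis (- lam0 * t))%C y (y + T0)) <= eps / 4 * T0).
      { rewrite <- Cint_scal, <- Cint_minus; [| lra | apply contR_on, CC | apply contR_on, contR_scal, CC | lra | apply contR_on, CC].
        replace T0 with (y + T0 - y) at 2 by ring.
        apply Cint_bound; [lra | |].
        - intros t _. apply continuous_Cminus; [apply CC | apply contR_scal, CC].
        - intros t Ht.
          replace (- lam * t) with (- (lam - lam0) * t + - lam0 * t) by ring.
          rewrite cis_plus.
          replace (_ - _)%C with (h t * cis (- lam0 * t) * (cis (- (lam - lam0) * t)%R - cis (- (lam - lam0) * y)%R))%C by ring.
          rewrite !Cmod_mult, Cmod_cis, Rmult_1_r.
          apply Rle_trans with (B * (Rabs (lam - lam0) * T0)).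
          + apply Rmult_le_compat; [apply Cmod_ge_0 | apply Cmod_ge_0 | auto |].
            eapply Rle_trans; [apply cis_lipschitz |].
            replace (- (lam - lam0) * t - - (lam - lam0) * y) with (- ((lam - lam0) * (t - y))) by ring.
            rewrite Rabs_Ropp, Rabs_mult. apply Rmult_le_compat_l; [apply Rabs_pos |].
            rewrite Rabs_pos_eq; lra.
          + replace (eps / 4) with (B * (eps / (4 * B * T0) * T0)) by (field; lra).
            apply Rmult_le_compat_l; [lra |]. apply Rmult_le_compat_r; lra. }
      assert (E := H0 T0 ltac:(lra) y). rewrite Cmult_0_r in E.
      unfold Cminus in E. rewrite Copp_0, Cplus_0_r in E.
      generalize (Cmod_triangle_rev (Cint (fun t => h t * cis (- lam * t))%C y (y + T0))
        (cis (- (lam - lam0) * y) * Cint (fun t => h t * cis (- lam0 * t))%C y (y + T0))).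
      rewrite Cmod_mult, Cmod_cis. lra. }
    assert (HTp : 0 < T).
    { eapply Rlt_le_trans; [| exact HT']. apply Rdiv_lt_0_compat; auto. apply Rmult_lt_0_compat; lra. }
    destruct (floor_decomp T0 T HT0) as [n [r [En Hr]]]; [lra |].
    assert (N : forall m, Cmod (Cint (fun t => h t * cis (- lam * t))%C x (x + INR m * T0)) <= INR m * (eps / 2 * T0)).
    { induction m as [|m IH].
      - simpl INR. rewrite !Rmult_0_l, Rplus_0_r. unfold Cint. rewrite !RInt_point.
        change (Cmod 0 <= 0). rewrite Cmod_0. lra.
      - rewrite S_INR. assert (Hp := pos_INR m).
        assert (0 <= INR m * T0) by (apply Rmult_le_pos; lra).
        replace (x + (INR m + 1) * T0) with (x + INR m * T0 + T0) by ring.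
        rewrite <- (Cint_Chasles _ x (x + INR m * T0)); [| lra | lra | apply contR_on, CC].
        eapply Rle_trans; [apply Cmod_triangle |]. specialize (Win (x + INR m * T0)). lra. }
    assert (Hp := pos_INR n).
    assert (Hnn : 0 <= INR n * T0) by (apply Rmult_le_pos; lra).
    rewrite <- (Cint_Chasles _ x (x + INR n * T0)); [| lra | lra | apply contR_on, CC].
    eapply Rle_trans; [apply Cmod_triangle |]. specialize (N n).
    assert (R1 : Cmod (Cint (fun t => h t * cis (- lam * t))%C (x + INR n * T0) (x + T)) <= B * (x + T - (x + INR n * T0))).
    { apply Cint_bound; [lra | apply contR_on, CC |]. intros t _. rewrite Cmod_mult, Cmod_cis, Rmult_1_r. auto. }
    assert (B * (x + T - (x + INR n * T0)) <= B * T0) by (apply Rmult_le_compat_l; lra).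
    assert (INR n * (eps / 2 * T0) <= eps / 2 * T).
    { rewrite En. assert (0 <= eps / 2 * r) by (apply Rmult_le_pos; lra). lra. }
    assert (2 * B * T0 <= eps * T).
    { replace (2 * B * T0) with (eps * (2 * B * T0 / eps)) by (field; lra). apply Rmult_le_compat_l; lra. }
    lra. }
  set (delta := fun lam0 => proj1_sig (constructive_indefinite_description _ (loc lam0))).
  assert (Hdelta : forall lam0 T, / delta lam0 <= T -> forall lam,
     Rabs (lam - lam0) < delta lam0 -> forall x,
     Cmod (Cint (fun t => h t * cis (- lam * t))%C x (x + T)) <= eps * T).
  { intros lam0. unfold delta. destruct (constructive_indefinite_description _ (loc lam0)) as [d Hd]. exact Hd. }
  destruct (compactness_value_1d (- L) L delta) as [d Hd].
  exists (/ d). assert (Hdp := cond_pos d). split; [apply Rinv_0_lt_compat; auto |].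
  intros T HT lam Hlam x.
  apply Rabs_le_between in Hlam.
  apply NNPP. intros Hn. apply (Hd lam Hlam). intros [t [Ht [Hc1 Hc2]]]. apply Hn.
  apply (Hdelta t); auto. eapply Rle_trans; [| exact HT]. apply Rinv_le_contravar; auto.
Qed.

(** * A large-sieve type inequality for trigonometric sums *)

Fixpoint lsum (f : nat -> C) (l : list nat) : C :=
  match l with nil => RtoC 0 | u :: r => (f u + lsum f r)%C end.

Lemma lsum_ext (f g : nat -> C) (l : list nat) :
  (forall u, In u l -> f u = g u) -> lsum f l = lsum g l.
Proof. induction l as [|u l IH]; simpl; intros H; [auto |]. rewrite H, IH; auto. Qed.

Lemma lsum_scal (c : C) (f : nat -> C) (l : list nat) :
  lsum (fun u => c * f u)%C l = (c * lsum f l)%C.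
Proof. induction l as [|u l IH]; simpl; [ring | rewrite IH; ring]. Qed.

Lemma lsum_conj (f : nat -> C) (l : list nat) :
  Cconj (lsum f l) = lsum (fun u => Cconj (f u)) l.
Proof.
  induction l as [|u l IH]; simpl; [unfold Cconj; simpl; now rewrite Ropp_0 |].
  rewrite <- IH. unfold Cconj, Cplus; simpl. f_equal. ring.
Qed.

Lemma contR_lsum (F : nat -> R -> C) (l : list nat) :
  (forall u, In u l -> contR (F u)) -> contR (fun t => lsum (fun u => F u t) l).
Proof.
  induction l as [|u l IH]; simpl; intros H; [apply contR_const |].
  apply (contR_plus (F u) (fun t => lsum (fun u => F u t) l)); auto.
Qed.

Lemma Cint_lsum (F : nat -> R -> C) (l : list nat) (a b : R) :
  a <= b -> (forall u, In u l -> contR (F u)) ->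
  Cint (fun t => lsum (fun u => F u t) l) a b = lsum (fun u => Cint (F u) a b) l.
Proof.
  intros Hab. induction l as [|u l IH]; simpl; intros H; [rewrite Cint_const; ring |].
  rewrite (Cint_plus (F u) (fun t => lsum (fun u => F u t) l)), IH; auto.
  - apply contR_on; auto.
  - apply contR_on, contR_lsum; auto.
Qed.

Lemma lsum_dev (f : nat -> C) (c : C) (e : R) (l : list nat) :
  (forall u, In u l -> Cmod (f u - c) <= e) ->
  Cmod (lsum f l - RtoC (INR (length l)) * c) <= INR (length l) * e.
Proof.
  induction l as [|u l IH]; intros H.
  - simpl. replace (_ - _)%C with (RtoC 0) by ring. rewrite Cmod_0. lra.
  - change (length (u :: l)) with (S (length l)). rewrite S_INR, RtoC_plus. simpl lsum.
    replace (_ - _)%C with ((f u - c) + (lsum f l - RtoC (INR (length l)) * c))%C by ring.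
    eapply Rle_trans; [apply Cmod_triangle |].
    assert (A := H u (or_introl eq_refl)).
    assert (B := IH (fun v Hv => H v (or_intror Hv))). lra.
Qed.

Lemma Cint_cis_period (k : Z) :
  k <> 0%Z -> Cint (fun th => cis (IZR k * th)) (- PI) PI = 0.
Proof.
  intros Hk. assert (HP := PI_RGT_0).
  rewrite Cint_cis; [| apply not_0_IZR; auto | lra].
  replace (IZR k * PI) with (IZR k * - PI + 2 * PI * IZR k) at 1 by ring.
  rewrite cis_plus, cis_2PI_Z. ring.
Qed.

(** For m below 2 * N, [lag m N] runs through the integers from -N to N - 1, which contain all
    differences of indices below N. *)
Definition lag (u v : nat) : Z := (Z.of_nat u - Z.of_nat v)%Z.

Lemma Cconj_cis (x : R) : Cconj (cis x) = cis (- x).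
Proof. unfold Cconj, cis; simpl. now rewrite cos_neg, sin_neg. Qed.

(* Parseval: the double sum over [l] is the integral of the exponential sum of [x]
   against the squared modulus of the exponential sum of the indicator of [l]. *)
Lemma lag_sum_bound (x : Z -> C) (N : nat) (l : list nat) (M : R) :
  NoDup l -> (forall u, In u l -> (u < N)%nat) ->
  (forall th, - PI <= th <= PI ->
     Cmod (csum (fun m => x (lag m N) * cis (- IZR (lag m N) * th))%C (2 * N)) <= M) ->
  Cmod (lsum (fun u => lsum (fun v => x (lag u v)) l) l) <= M * INR (length l).
Proof.
  intros Hnd Hlt HM. assert (HP := PI_RGT_0).
  assert (HM0 : 0 <= M) by (eapply Rle_trans; [apply Cmod_ge_0 | apply (HM 0); lra]).
  set (S := fun th => csum (fun m => x (lag m N) * cis (- IZR (lag m N) * th))%C (2 * N)).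
  set (W := fun th => lsum (fun u => lsum (fun v => cis (IZR (lag u v) * th)) l) l).
  assert (CW : contR W).
  { apply (contR_lsum (fun u th => lsum (fun v => cis (IZR (lag u v) * th)) l)). intros u _.
    apply (contR_lsum (fun v th => cis (IZR (lag u v) * th))). intros v _. apply contR_cis. }
  assert (CS : contR S).
  { apply (contR_csum (fun m th => x (lag m N) * cis (- IZR (lag m N) * th))%C).
    intros j _. apply contR_scal, contR_cis. }
  assert (WE : forall th, W th = RtoC (Cmod (lsum (fun u => cis (INR u * th)) l) ^ 2)).
  { intros th. rewrite Cmod2_conj, lsum_conj. unfold W.
    rewrite (lsum_ext _ (fun u => lsum (fun v => Cconj (cis (INR v * th))) l * cis (INR u * th))%C).
    - rewrite lsum_scal. ring.
    - intros u _. rewrite Cmult_comm, <- lsum_scal. apply lsum_ext. intros v _.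
      rewrite Cconj_cis, <- cis_plus. f_equal. unfold lag.
      rewrite minus_IZR, <- !INR_IZR_INZ. ring. }
  (* Only the diagonal pairs u = v survive integration over a period. *)
  assert (IW : Cint W (- PI) PI = RtoC (2 * PI * INR (length l))).
  { unfold W. rewrite (Cint_lsum (fun u th => lsum (fun v => cis (IZR (lag u v) * th)) l)); [| lra |].
    2: { intros u _. apply (contR_lsum (fun v th => cis (IZR (lag u v) * th))). intros v _. apply contR_cis. }
    assert (G : forall l', NoDup l' -> incl l' l ->
      lsum (fun u => Cint (fun th => lsum (fun v => cis (IZR (lag u v) * th)) l) (- PI) PI) l' =
      RtoC (2 * PI * INR (length l'))).
    2: { apply G; auto. apply incl_refl. }
    assert (D : forall u l', NoDup l' ->
      lsum (fun v => Cint (fun th => cis (IZR (lag u v) * th)) (- PI) PI) l' =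
      if in_dec Nat.eq_dec u l' then RtoC (2 * PI) else 0).
    { intros u. induction l' as [|v l' IH]; intros Hn; [reflexivity |].
      inversion Hn as [| ? ? Hv Hn']; subst. simpl lsum. rewrite IH by auto.
      destruct (Nat.eq_dec v u) as [-> | Hne].
      - destruct (in_dec Nat.eq_dec u (u :: l')) as [_ | H]; [| exfalso; apply H; left; auto].
        destruct (in_dec Nat.eq_dec u l') as [H | _]; [contradiction |].
        rewrite (Cint_ext _ (fun _ => RtoC 1)).
        + rewrite Cint_const, <- RtoC_mult, <- RtoC_plus. f_equal. ring.
        + lra.
        + intros t _. unfold lag. rewrite Z.sub_diag, Rmult_0_l. apply cis_0.
      - rewrite Cint_cis_period by (unfold lag; lia). rewrite Cplus_0_l.
        destruct (in_dec Nat.eq_dec u l') as [H | H];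
        destruct (in_dec Nat.eq_dec u (v :: l')) as [H' | H']; auto.
        + exfalso. apply H'. right; auto.
        + exfalso. destruct H' as [H' | H']; auto. }
    induction l' as [|u l' IH]; intros Hn Hin.
    - simpl. now rewrite Rmult_0_r.
    - inversion Hn as [| ? ? Hv Hn']; subst.
      change (length (u :: l')) with (1 + length l')%nat. rewrite plus_INR. simpl lsum.
      rewrite IH; auto. 2: { intros v Hv'. apply Hin. right; auto. }
      rewrite (Cint_lsum (fun v th => cis (IZR (lag u v) * th))); [| lra | intros; apply contR_cis].
      rewrite D by auto. destruct (in_dec Nat.eq_dec u l) as [_ | H].
      + rewrite <- RtoC_plus. f_equal. simpl. ring.
      + exfalso. apply H, Hin. left; auto. }
  assert (ISW : Cint (fun th => S th * W th)%C (- PI) PI =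
     (RtoC (2 * PI) * lsum (fun u => lsum (fun v => x (lag u v)) l) l)%C).
  { rewrite (Cint_ext _ (fun th => lsum (fun u => lsum (fun v =>
       csum (fun m => x (lag m N) * cis (IZR (lag u v - lag m N) * th))%C (2 * N)) l) l)); [| lra |].
    2: { intros th _. unfold W. rewrite <- lsum_scal. apply lsum_ext. intros u _.
         rewrite <- lsum_scal. apply lsum_ext. intros v _. unfold S.
         rewrite Cmult_comm, <- csum_scal. apply csum_ext. intros m _.
         rewrite (Cmult_comm (cis _)), <- Cmult_assoc, <- cis_plus. do 2 f_equal.
         rewrite minus_IZR. ring. }
    assert (C1 : forall u v, contR (fun th =>
       csum (fun m => x (lag m N) * cis (IZR (lag u v - lag m N) * th))%C (2 * N))).
    { intros u v. apply (contR_csum (fun m th => x (lag m N) * cis (IZR (lag u v - lag m N) * th))%C).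
      intros. apply contR_scal, contR_cis. }
    rewrite (Cint_lsum (fun u th => lsum (fun v =>
       csum (fun m => x (lag m N) * cis (IZR (lag u v - lag m N) * th))%C (2 * N)) l)); [| lra |].
    2: { intros u _. apply (contR_lsum (fun v th => csum (fun m => x (lag m N) * cis (IZR (lag u v - lag m N) * th))%C (2 * N))). auto. }
    rewrite <- lsum_scal. apply lsum_ext. intros u Hu.
    rewrite (Cint_lsum (fun v th =>
       csum (fun m => x (lag m N) * cis (IZR (lag u v - lag m N) * th))%C (2 * N))); [| lra | auto].
    rewrite <- lsum_scal. apply lsum_ext. intros v Hv.
    rewrite (Cint_csum (fun m th => x (lag m N) * cis (IZR (lag u v - lag m N) * th))%C); [| lra |].
    2: { intros. apply contR_on, contR_scal, contR_cis. }
    assert (Hu' := Hlt u Hu). assert (Hv' := Hlt v Hv).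
    (* This is the only m below 2 * N with [lag m N] = [lag u v]. *)
    rewrite (csum_single _ _ (N + u - v)%nat); [| lia |].
    - rewrite Cint_scal; [| lra | apply contR_on, contR_cis].
      replace (lag (N + u - v) N) with (lag u v) by (unfold lag; lia).
      rewrite (Cint_ext _ (fun _ => RtoC 1)).
      + rewrite Cint_const. replace (PI - - PI) with (2 * PI) by ring. ring.
      + lra.
      + intros t _. rewrite Z.sub_diag, Rmult_0_l. apply cis_0.
    - intros m Hm Hne. rewrite Cint_scal; [| lra | apply contR_on, contR_cis].
      rewrite Cint_cis_period by (unfold lag; lia). ring. }
  assert (Bd : Cmod (Cint (fun th => S th * W th)%C (- PI) PI) <= RInt (fun th => M * Re (W th)) (- PI) PI).
  { assert (ER : ex_RInt (fun t => Re (W t)) (- PI) PI) by (apply ex_RInt_Re; [lra | apply contR_on; auto]).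
    apply Cint_bound_fun.
    - lra.
    - apply contR_on, contR_mult; auto.
    - exact (ex_RInt_scal (V := R_NormedModule) _ _ _ _ ER).
    - intros th Hth. rewrite Cmod_mult. apply Rmult_le_compat; [apply Cmod_ge_0 | apply Cmod_ge_0 | apply HM; auto |].
      rewrite WE, Cmod_R, Rabs_pos_eq by apply pow2_ge_0. simpl. lra. }
  assert (E : RInt (fun th => M * Re (W th)) (- PI) PI = M * (2 * PI * INR (length l))).
  { assert (ER : ex_RInt (fun t => Re (W t)) (- PI) PI) by (apply ex_RInt_Re; [lra | apply contR_on; auto]).
    replace (2 * PI * INR (length l)) with (Re (Cint W (- PI) PI)) by (rewrite IW; reflexivity).
    apply (RInt_scal (V := R_CompleteNormedModule)). exact ER. }
  rewrite E, ISW, Cmod_mult, Cmod_R, Rabs_pos_eq in Bd by lra.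
  apply Rmult_le_reg_l with (2 * PI); lra.
Qed.

(** The induction splits off the class of one element of [l] and keeps the larger of this class and
    the one found among the remaining indices. *)
Lemma pigeonhole_class {A : Type} (P : A -> nat -> Prop) (l : list A) (us : list nat) :
  NoDup us -> (forall u, In u us -> exists a, In a l /\ P a u) ->
  exists B : list nat, NoDup B /\ incl B us /\
    (forall u v, In u B -> In v B -> exists a, P a u /\ P a v) /\
    (length us <= length l * length B)%nat.
Proof.
  revert us. induction l as [|a l IH]; intros us Hnd H.
  - destruct us as [|u us].
    + exists nil. split; [constructor |]. split; [intros ? [] |]. split; [intros ? ? [] | simpl; lia].
    + destruct (H u) as [a [[] _]]. left; auto.
  - set (b := fun u => if excluded_middle_informative (P a u) then true else false).
    destruct (IH (filter (fun u => negb (b u)) us)) as [B [HB1 [HB2 [HB3 HB4]]]].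
    + apply NoDup_filter; auto.
    + intros u Hu. apply filter_In in Hu. destruct Hu as [Hu Hb].
      destruct (H u Hu) as [c [[<- | Hc] Hp]].
      * unfold b in Hb. destruct excluded_middle_informative; [discriminate | contradiction].
      * eauto.
    + assert (Hlen : (length (filter b us) + length (filter (fun u => negb (b u)) us) = length us)%nat)
        by apply filter_length.
      destruct (Nat.le_gt_cases (length (filter b us)) (length B)) as [Hle | Hgt].
      * exists B. split; auto. split; [intros u Hu; apply HB2, filter_In in Hu; tauto |].
        split; auto. simpl. lia.
      * exists (filter b us). split; [apply NoDup_filter; auto |].
        split; [intros u Hu; apply filter_In in Hu; tauto |]. split; [| simpl; nia].
        intros u v Hu Hv. exists a. apply filter_In in Hu, Hv. unfold b in Hu, Hv.
        destruct Hu as [_ Hu]. destruct Hv as [_ Hv].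
        destruct (excluded_middle_informative (P a u)); [| discriminate].
        destruct (excluded_middle_informative (P a v)); [auto | discriminate].
Qed.

Lemma csum_split (z : nat -> C) (n k : nat) :
  csum z (n + k) = (csum z n + csum (fun j => z (n + j)%nat) k)%C.
Proof.
  induction k as [|k IH]; simpl.
  - rewrite Nat.add_0_r. ring.
  - rewrite Nat.add_succ_r. simpl. rewrite IH. ring.
Qed.

Lemma csum_minus (f g : nat -> C) (n : nat) :
  csum (fun j => f j - g j)%C n = (csum f n - csum g n)%C.
Proof. induction n as [|n IH]; simpl; [ring | rewrite IH; ring]. Qed.

Lemma riemann_sum_bound (G : R -> C) (a eta rho : R) (n : nat) :
  contR G -> 0 < eta ->
  (forall t t', Rabs (t - t') <= eta -> Cmod (G t - G t') <= rho) ->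
  Cmod (Cint G a (a + INR n * eta) - RtoC eta * csum (fun m => G (a + INR m * eta)%R) n)
    <= INR n * eta * rho.
Proof.
  intros Hc He Hr. induction n as [|n IH].
  - simpl. rewrite Rmult_0_l, Rplus_0_r. unfold Cint. rewrite !RInt_point.
    change (Cmod (0 - RtoC eta * 0) <= 0 * rho). replace (0 - RtoC eta * 0)%C with (RtoC 0) by ring. rewrite Cmod_0. lra.
  - rewrite S_INR. simpl csum. assert (Hp := pos_INR n).
    assert (0 <= INR n * eta) by (apply Rmult_le_pos; lra).
    replace (a + (INR n + 1) * eta) with (a + INR n * eta + eta) by ring.
    rewrite <- (Cint_Chasles _ a (a + INR n * eta)); [| lra | lra | apply contR_on; auto].
    set (b := a + INR n * eta) in *.
    assert (D : Cmod (Cint G b (b + eta) - RtoC eta * G b) <= rho * eta).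
    { replace (RtoC eta * G b)%C with (Cint (fun _ => G b) b (b + eta))
        by (rewrite Cint_const; f_equal; f_equal; ring).
      rewrite <- Cint_minus; [| lra | apply contR_on; auto | apply contR_on, contR_const].
      replace eta with (b + eta - b) at 2 by ring.
      apply Cint_bound; [lra | |].
      - intros t _. apply continuous_Cminus; [apply Hc | apply continuous_Cconst].
      - intros t Ht. apply Hr. rewrite Rabs_pos_eq; lra. }
    replace (_ - _)%C with ((Cint G a b - RtoC eta * csum (fun m => G (a + INR m * eta)%R) n)
      + (Cint G b (b + eta)%R - RtoC eta * G b))%C by ring.
    eapply Rle_trans; [apply Cmod_triangle |]. lra.
Qed.

Lemma cis_far_from_1 (th : R) :
  PI / 2 <= Rabs th <= PI -> 1 <= Cmod (1 - cis th).
Proof.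
  intros H. eapply Rle_trans; [| apply re_le_Cmod].
  change (Re (1 - cis th)%C) with (1 - cos th).
  assert (cos th <= 0).
  { replace (cos th) with (cos (Rabs th)).
    - apply cos_le_0; lra.
    - unfold Rabs; destruct Rcase_abs; auto. apply cos_neg. }
  eapply Rle_trans; [| apply Rle_abs]. lra.
Qed.

(** This is the exponential sum of [lag_sum_bound] for the samples of [h] at the multiples of
    [eta]. *)
Definition sample_sum (h : R -> C) (eta : R) (N : nat) (th : R) : C :=
  csum (fun m => h (IZR (lag m N) * eta)%R * cis (- IZR (lag m N) * th))%C (2 * N).

Lemma sample_sum_high (h : R -> C) (B eta w th : R) (k N : nat) :
  (forall t, Cmod (h t) <= B) ->
  (forall t, Cmod (h t - h (t + INR k * eta)%R) <= w) ->
  PI / 2 <= Rabs (INR k * th) <= PI ->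
  Cmod (sample_sum h eta N th) <= INR (2 * N) * w + 2 * INR k * B.
Proof.
  intros HB Hw Hk.
  set (z := fun m => (h (IZR (lag m N) * eta)%R * cis (- IZR (lag m N) * th))%C).
  set (S := sample_sum h eta N th).
  assert (E0 : S = csum z (2 * N)) by reflexivity.
  assert (E1 : csum (fun m => h (IZR (lag (k + m) N) * eta)%R * cis (- IZR (lag m N) * th))%C (2 * N)
     = (cis (INR k * th) * csum (fun m => z (k + m)%nat) (2 * N))%C).
  { rewrite <- csum_scal. apply csum_ext. intros m _. unfold z.
    replace (- IZR (lag m N) * th) with (INR k * th + - IZR (lag (k + m) N) * th).
    - rewrite cis_plus. ring.
    - unfold lag. rewrite Nat2Z.inj_add, !minus_IZR, plus_IZR, <- !INR_IZR_INZ. ring. }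
  assert (E2 : (csum z k + csum (fun m => z (k + m)%nat) (2 * N))%C =
     (csum z (2 * N) + csum (fun j => z (2 * N + j)%nat) k)%C).
  { rewrite <- !csum_split. f_equal. lia. }
  assert (Bz : forall g : nat -> nat, Cmod (csum (fun m => z (g m)) k) <= INR k * B).
  { intros g. eapply Rle_trans; [apply Cmod_csum |]. rewrite <- rsum_const. apply rsum_le.
    intros j _. unfold z. rewrite Cmod_mult, Cmod_cis, Rmult_1_r. auto. }
  assert (D : Cmod (S - csum (fun m => h (IZR (lag (k + m) N) * eta)%R * cis (- IZR (lag m N) * th))%C (2 * N))
     <= INR (2 * N) * w).
  { replace (S - _)%C with (csum (fun m => (h (IZR (lag m N) * eta)%R - h (IZR (lag (k + m) N) * eta)%R) *
       cis (- IZR (lag m N) * th))%C (2 * N)).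
    - eapply Rle_trans; [apply Cmod_csum |]. rewrite <- rsum_const. apply rsum_le.
      intros j _. rewrite Cmod_mult, Cmod_cis, Rmult_1_r.
      replace (IZR (lag (k + j) N) * eta) with (IZR (lag j N) * eta + INR k * eta); [auto |].
      unfold lag. rewrite Nat2Z.inj_add, !minus_IZR, plus_IZR, <- !INR_IZR_INZ. ring.
    - rewrite E0, <- csum_minus. apply csum_ext. intros; unfold z; ring. }
  rewrite E1 in D.
  replace (csum (fun m => z (k + m)%nat) (2 * N)) with
     (S + csum (fun j => z (2 * N + j)%nat) k - csum z k)%C in D by (rewrite E0, <- E2; ring).
  replace (S - _)%C with ((1 - cis (INR k * th)) * S -
     cis (INR k * th) * (csum (fun j => z (2 * N + j)%nat) k - csum z k))%C in D by ring.
  assert (B1 := Bz (fun j => (2 * N + j)%nat)). assert (B2 := Bz (fun j => j)).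
  set (b1 := csum (fun j => z (2 * N + j)%nat) k) in *.
  change (csum (fun m => z m) k) with (csum z k) in B2. set (b2 := csum z k) in *.
  assert (T1 := Cmod_triangle_rev ((1 - cis (INR k * th)) * S) (cis (INR k * th) * (b1 - b2))).
  rewrite !Cmod_mult, Cmod_cis, Rmult_1_l in T1.
  assert (T2 := Cmod_triangle b1 (- b2)). rewrite Cmod_opp in T2.
  change (b1 + - b2)%C with (b1 - b2)%C in T2.
  assert (T3 := cis_far_from_1 _ Hk).
  assert (1 * Cmod S <= Cmod (1 - cis (INR k * th)) * Cmod S)
    by (apply Rmult_le_compat_r; [apply Cmod_ge_0 | exact T3]).
  lra.
Qed.

(** At frequency lam * eta the sample sum, multiplied by [eta], is a Riemann sum of the integral
    that defines the Fourier mean at [lam]. *)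
Lemma sample_sum_low (h : R -> C) (eta lam rho e : R) (N : nat) :
  contR h -> 0 < eta ->
  (forall t t', Rabs (t - t') <= eta ->
     Cmod (h t * cis (- lam * t) - h t' * cis (- lam * t')) <= rho) ->
  Cmod (Cint (fun t => h t * cis (- lam * t))%C (- INR N * eta) (- INR N * eta + INR (2 * N) * eta))
     <= e * (INR (2 * N) * eta) ->
  Cmod (sample_sum h eta N (lam * eta)) <= INR (2 * N) * (rho + e).
Proof.
  intros Hc He Hr Hi.
  set (G := fun t => (h t * cis (- lam * t))%C).
  assert (CG : contR G) by (apply contR_mult; [auto | apply contR_cis]).
  assert (Rb := riemann_sum_bound G (- INR N * eta) eta rho (2 * N) CG He Hr).
  replace (csum (fun m => G (- INR N * eta + INR m * eta)%R) (2 * N)) with (sample_sum h eta N (lam * eta)) in Rb.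
  2: { unfold sample_sum. apply csum_ext. intros m _. unfold G.
       replace (- INR N * eta + INR m * eta) with (IZR (lag m N) * eta).
       - f_equal. f_equal. ring.
       - unfold lag. rewrite minus_IZR, <- !INR_IZR_INZ. ring. }
  assert (T := Cmod_triangle_rev (RtoC eta * sample_sum h eta N (lam * eta))
     (Cint G (- INR N * eta) (- INR N * eta + INR (2 * N) * eta))).
  rewrite (Cmod_minus_sym (RtoC eta * _)), Cmod_mult, Cmod_R, Rabs_pos_eq in T by lra.
  fold G in Hi. apply Rmult_le_reg_l with eta; auto. lra.
Qed.

(** * Uniqueness of Fourier expansions *)

(* If [h 0 <> 0], the pigeonhole principle gives a positive proportion of indices [u]
   such that the translates by [u * eta] are pairwise close, hence [h ((u - v) * eta)] is close
   to [h 0] on a set of pairs of positive density. By [lag_sum_bound] some exponential sum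
   of the samples of [h] is then large, with a density that does not depend on [eta];
   but all of them are small for small [eta]: by uniform continuity for high frequencies, and
   by comparison with the vanishing Fourier means for bounded ones. *)
Lemma umean_zero_at_0 (h : R -> C) :
  contR h -> TB h ->
  (forall lam, umean (fun t => h t * cis (- lam * t))%C 0) -> h 0 = 0.
Proof.
  intros Hc HT Hm. assert (HP := PI_RGT_0).
  apply NNPP. intros Hne. set (kap := Cmod (h 0)).
  assert (Hkap : 0 < kap) by (apply Cmod_gt_0; exact Hne).
  destruct (TB_bounded h HT) as [B [HB0 HB]].
  assert (HU := bohr_unif_cont h Hc (TB_bohr h HT)).
  destruct (HT (kap / 4)) as [l Hl]; [lra |].
  set (q := INR (length l)). assert (Hq : 0 <= q) by apply pos_INR.
  (* With b indices in the class, the double sum is at least b^2 * kap / 2 and at most M * b, while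
     b >= N / q. The resulting lower bound for [M] does not involve [eta]. *)
  assert (Low : forall (eta M : R) (N : nat), (0 < N)%nat ->
    (forall th, - PI <= th <= PI -> Cmod (sample_sum h eta N th) <= M) ->
    INR N * kap <= 2 * q * M).
  { intros eta M N HN HM.
    destruct (pigeonhole_class (fun a u => forall t, Cmod (h (t + INR u * eta) - h (t + a)) <= kap / 4)
       l (seq 0 N)) as [D [D1 [D2 [D3 D4]]]].
    { apply seq_NoDup. }
    { intros u _. destruct (Hl (INR u * eta)) as [a [Ha Hp]]. eauto. }
    rewrite length_seq in D4.
    assert (Hlt : forall u, In u D -> (u < N)%nat) by (intros u Hu; apply D2, in_seq in Hu; lia).
    assert (LB := lag_sum_bound (fun k => h (IZR k * eta)%R) N D M D1 Hlt HM).
    assert (Dev : forall u v, In u D -> In v D -> Cmod (h (IZR (lag u v) * eta)%R - h 0) <= kap / 2).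
    { intros u v Hu Hv. destruct (D3 u v Hu Hv) as [a [A1 A2]].
      specialize (A1 (- (INR v * eta))). specialize (A2 (- (INR v * eta))).
      replace (IZR (lag u v) * eta) with (- (INR v * eta) + INR u * eta)
        by (unfold lag; rewrite minus_IZR, <- !INR_IZR_INZ; ring).
      replace (- (INR v * eta) + INR v * eta) with 0 in A2 by ring.
      eapply Rle_trans; [apply (Cmod_triangle_minus _ (h (- (INR v * eta) + a)%R)) |].
      rewrite Cmod_minus_sym in A2. lra. }
    set (b := INR (length D)) in *.
    assert (DD : Cmod (lsum (fun u => lsum (fun v => h (IZR (lag u v) * eta)%R) D) D - RtoC b * (RtoC b * h 0))
       <= b * (b * (kap / 2))).
    { apply lsum_dev. intros u Hu. apply lsum_dev. auto. }
    assert (T := Cmod_triangle_rev (RtoC b * (RtoC b * h 0))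
      (lsum (fun u => lsum (fun v => h (IZR (lag u v) * eta)%R) D) D)).
    rewrite (Cmod_minus_sym (RtoC b * _)), !Cmod_mult, !Cmod_R, Rabs_pos_eq in T by apply pos_INR.
    fold kap in T.
    assert (Hb : INR N <= q * b) by (unfold q, b; rewrite <- mult_INR; apply le_INR; exact D4).
    assert (HNp : 0 < INR N) by (apply lt_0_INR; exact HN).
    assert (Hb0 : 0 <= b) by apply pos_INR.
    assert (Hbp : 0 < b) by nra.
    assert (b * (kap / 2) <= M) by (apply Rmult_le_reg_l with b; auto; lra).
    apply Rle_trans with (q * b * kap); [apply Rmult_le_compat_r; lra |].
    replace (q * b * kap) with (2 * q * (b * (kap / 2))) by field.
    apply Rmult_le_compat_l; lra. }
  (* Chosen so that the upper bound M = N * c turns [Low] into N * kap <= N * kap / 2. *)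
  set (c := kap / (4 * (q + 1))).
  assert (Hcp : 0 < c) by (apply Rdiv_lt_0_compat; lra).
  destruct (HU (c / 8)) as [dl [Hdl Hud]]; [lra |].
  (* The frequency cutoff: if |th| > L * eta, any k with k |th| <= PI has k * eta <= dl, so shifting
     by k samples changes [h] by at most c / 8. *)
  set (L := PI / dl). assert (HL : 0 < L) by (apply Rdiv_lt_0_compat; lra).
  destruct (umean_zero_uniform h B L (c / 8) Hc HB0 HB Hm) as [T1 [HT1 HTu]]; [lra |].
  assert (HBL : 0 < B * L) by (apply Rmult_lt_0_compat; lra).
  assert (He1 : 0 < c / (8 * (B * L))) by (apply Rdiv_lt_0_compat; lra).
  (* The second term keeps the variation of a character of frequency at most [L], multiplied by [B],
     below c / 8 on a step of length [eta]. *)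
  set (eta := Rmin dl (c / (8 * (B * L)))).
  assert (Heta : 0 < eta) by (apply Rmin_glb_lt; auto).
  assert (Heta1 : eta <= dl) by apply Rmin_l.
  assert (Heta2 : eta <= c / (8 * (B * L))) by apply Rmin_r.
  (* [N1] makes the sampled window 2 * N * eta at least [T1]; [N2] makes the boundary terms 2 * k *
     B negligible, since k <= dl / eta. *)
  destruct (INR_large (T1 / (2 * eta))) as [N1 HN1].
  destruct (INR_large (8 * dl * B / (eta * c))) as [N2 HN2].
  set (N := (S (N1 + N2))%nat).
  specialize (HN1 N ltac:(lia)). specialize (HN2 N ltac:(lia)).
  assert (HN : (0 < N)%nat) by (unfold N; lia).
  assert (HNp : 0 < INR N) by (apply lt_0_INR; exact HN).
  assert (H2N : INR (2 * N) = 2 * INR N) by (rewrite mult_INR; reflexivity).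
  assert (Up : forall th, - PI <= th <= PI -> Cmod (sample_sum h eta N th) <= INR N * c).
  { intros th Hth.
    destruct (Rle_dec (Rabs th) (L * eta)) as [Hlow | Hhigh].
    - set (lam := th / eta).
      assert (Hlam : Rabs lam <= L).
      { unfold lam, Rdiv. rewrite Rabs_mult, Rabs_inv, (Rabs_pos_eq eta) by lra.
        apply Rmult_le_reg_r with eta; auto. rewrite Rmult_assoc, Rinv_l by lra. lra. }
      replace th with (lam * eta) by (unfold lam; field; lra).
      apply Rle_trans with (INR (2 * N) * (c / 4 + c / 8)).
      2: { rewrite H2N. nra. }
      apply sample_sum_low; auto.
      + intros t t' Htt.
        replace (_ - _)%C with ((h t - h t') * cis (- lam * t) + h t' * (cis (- lam * t) - cis (- lam * t')))%C by ring.
        eapply Rle_trans; [apply Cmod_triangle |]. rewrite !Cmod_mult, Cmod_cis, Rmult_1_r.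
        assert (A1 : Cmod (h t - h t') <= c / 8) by (apply Hud; lra).
        assert (A2 : Cmod (h t') * Cmod (cis (- lam * t) - cis (- lam * t')) <= B * (L * (c / (8 * (B * L))))).
        { apply Rmult_le_compat; [apply Cmod_ge_0 | apply Cmod_ge_0 | auto |].
          eapply Rle_trans; [apply cis_lipschitz |].
          replace (- lam * t - - lam * t') with (- (lam * (t - t'))) by ring.
          rewrite Rabs_Ropp, Rabs_mult. apply Rmult_le_compat; try apply Rabs_pos; lra. }
        replace (B * (L * (c / (8 * (B * L))))) with (c / 8) in A2 by (field; split; lra). lra.
      + apply HTu; auto. rewrite H2N.
        replace T1 with (T1 / (2 * eta) * (2 * eta)) by (field; lra).
        replace (2 * INR N * eta) with (INR N * (2 * eta)) by ring.
        apply Rmult_le_compat_r; lra.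
    - assert (Hth0 : L * eta < Rabs th) by lra.
      assert (HLe : 0 < L * eta) by (apply Rmult_lt_0_compat; lra).
      (* With k the integer part of PI / |th|, the remainder is below |th| <= k |th|, hence PI / 2
         <= k |th| <= PI. *)
      destruct (floor_decomp (Rabs th) PI) as [k [r [Ek Hr]]]; [lra | lra |].
      assert (Hthp : Rabs th <= PI) by (apply Rabs_le_between; lra).
      assert (Hk1 : 1 <= INR k).
      { destruct k as [|k]; [simpl in Ek; lra |]. rewrite S_INR. generalize (pos_INR k). lra. }
      assert (Hkeq : Rabs (INR k * th) = INR k * Rabs th) by (rewrite Rabs_mult, (Rabs_pos_eq (INR k)); lra).
      assert (Hke : INR k * eta <= dl).
      { apply Rmult_le_reg_l with L; auto. replace (L * dl) with PI by (unfold L; field; lra).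
        assert (INR k * (L * eta) <= INR k * Rabs th) by (apply Rmult_le_compat_l; lra). lra. }
      apply Rle_trans with (INR (2 * N) * (c / 8) + 2 * INR k * B).
      + apply sample_sum_high; auto.
        * intros t. apply Hud. replace (t - (t + INR k * eta)) with (- (INR k * eta)) by ring.
          rewrite Rabs_Ropp, Rabs_pos_eq; auto. apply Rmult_le_pos; lra.
        * rewrite Hkeq. assert (Rabs th <= INR k * Rabs th).
          { rewrite <- (Rmult_1_l (Rabs th)) at 1. apply Rmult_le_compat_r; lra. }
          lra.
      + rewrite H2N.
        assert (2 * INR k * B <= INR N * c / 4).
        { apply Rmult_le_reg_r with eta; auto.
          apply Rle_trans with (2 * dl * B).
          - replace (2 * INR k * B * eta) with (2 * B * (INR k * eta)) by ring.
            replace (2 * dl * B) with (2 * B * dl) by ring. apply Rmult_le_compat_l; lra.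
          - replace (2 * dl * B) with (8 * dl * B / (eta * c) * (eta * c / 4)) by (field; lra).
            replace (INR N * c / 4 * eta) with (INR N * (eta * c / 4)) by field.
            apply Rmult_le_compat_r; auto. assert (0 < eta * c) by (apply Rmult_lt_0_compat; lra). lra. }
        assert (0 < INR N * c) by (apply Rmult_lt_0_compat; lra). lra. }
  assert (F := Low eta (INR N * c) N HN Up).
  assert (E : 2 * q * (INR N * c) <= INR N * (kap / 2)).
  { replace (2 * q * (INR N * c)) with (INR N * (2 * q * c)) by ring.
    apply Rmult_le_compat_l; [lra |].
    replace (kap / 2) with (2 * (q + 1) * c) by (unfold c; field; lra). nra. }
  nra.
Qed.

Lemma umean_zero_unique (h : R -> C) :
  contR h -> TB h ->
  (forall lam, umean (fun t => h t * cis (- lam * t))%C 0) -> forall t, h t = 0.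
Proof.
  intros Hc HT Hm t.
  rewrite <- (Rplus_0_l t).
  apply (umean_zero_at_0 (fun s => h (s + t))).
  - apply contR_translate, Hc.
  - apply TB_translate, HT.
  - intros lam.
    assert (H : umean (fun s => h (s + t)%R * cis (- lam * (s + t)))%C 0).
    { destruct (Hm lam) as [A1 A2]. split.
      - apply (contR_translate (fun s => h s * cis (- lam * s))%C t A1).
      - intros eps He. destruct (A2 eps He) as [T0 [HT0 H0]]. exists T0. split; auto.
        intros T HTT x. rewrite (Cint_translate (fun s => h s * cis (- lam * s))%C t x (x + T)); [| lra | apply contR_on, A1].
        replace (x + T + t) with (x + t + T) by ring. auto. }
    apply umean_ext with (fun s => cis (lam * t) * (h (s + t)%R * cis (- lam * (s + t))))%C.
    + intros s. replace (- lam * s) with (lam * t + - lam * (s + t)) by ring. rewrite cis_plus. ring.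
    + replace (RtoC 0) with (cis (lam * t) * 0)%C by ring. apply umean_scal. exact H.
Qed.

(** * Taylor expansion of the exponential *)

Definition exp_poly (u : C) (K : nat) : C := csum (fun k => RtoC (/ INR (fact k)) * u ^ k)%C K.

Lemma exp_monotone (x y : R) : x <= y -> exp x <= exp y.
Proof. intros [H | ->]; [left; apply exp_increasing, H | right; reflexivity]. Qed.

Lemma Cexp_scaled_integral (u : C) (t : R) :
  0 <= t -> Cint (fun s => u * Cexp (RtoC s * u))%C 0 t = (Cexp (RtoC t * u) - 1)%C.
Proof.
  intros Ht. rewrite (Cint_derive (fun s => Cexp (RtoC s * u))); auto.
  - rewrite Cmult_0_l, Cexp_0. reflexivity.
  - intros x _. unfold Cexp, Re, Im, Cmult, RtoC; simpl. auto_derive; auto. unfold Rminus. ring.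
  - intros x _. unfold Cexp, Re, Im, Cmult, RtoC; simpl. auto_derive; auto. unfold Rminus. ring.
  - intros x _. apply continuous_Cmult; [apply continuous_Cconst |].
    apply continuous_C_pair; unfold Cexp, Re, Im, Cmult, RtoC; simpl;
      apply continuity_pt_filterlim; reg.
Qed.

Lemma Re_RtoC_mult (p : R) (c : C) : Re (RtoC p * c) = Re c * p.
Proof. unfold Re, Cmult, RtoC; simpl. ring. Qed.

Lemma Im_RtoC_mult (p : R) (c : C) : Im (RtoC p * c) = Im c * p.
Proof. unfold Im, Cmult, RtoC; simpl. ring. Qed.

Lemma is_derive_monomial (k : nat) (x : R) :
  is_derive (fun s => s ^ S k / INR (fact (S k))) x (x ^ k / INR (fact k)).
Proof.
  assert (Hf : INR (fact k) <> 0) by apply INR_fact_neq_0.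
  assert (Hk : INR (S k) <> 0) by (apply not_0_INR; lia).
  replace (INR (fact (S k))) with (INR (S k) * INR (fact k)) by (rewrite <- mult_INR; f_equal).
  evar_last.
  - apply (is_derive_ext (fun s => / (INR (S k) * INR (fact k)) * s ^ S k)).
    + intros s. unfold Rdiv. apply Rmult_comm.
    + apply (is_derive_scal (fun s => s ^ S k) x). apply is_derive_pow, is_derive_id.
  - rewrite Nat.pred_succ. unfold one, scal, mult; simpl scal. change (mult ?a ?b) with (a * b).
    simpl. field. auto.
Qed.

Lemma continuous_monomial (k : nat) (x : R) :
  continuous (T := R_UniformSpace) (U := C_UniformSpace) (fun s => RtoC (s ^ k / INR (fact k))) x.
Proof.
  apply continuous_C_pair; simpl; [| apply continuous_const].
  apply continuity_pt_filterlim. reg.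
Qed.

Lemma monomial_integral (c : C) (k : nat) (t : R) :
  0 <= t -> Cint (fun s => RtoC (s ^ k / INR (fact k)) * c)%C 0 t =
    (RtoC (t ^ S k / INR (fact (S k))) * c)%C.
Proof.
  intros Ht.
  rewrite (Cint_derive (fun s => RtoC (s ^ S k / INR (fact (S k))) * c)%C); auto.
  - rewrite pow_i by lia. unfold Rdiv. rewrite Rmult_0_l. ring.
  - intros x _. apply (is_derive_ext (fun s => Re c * (s ^ S k / INR (fact (S k))))).
    + intros s. symmetry. apply Re_RtoC_mult.
    + evar_last; [apply (is_derive_scal (fun s => s ^ S k / INR (fact (S k)))), is_derive_monomial |].
      symmetry. apply Re_RtoC_mult.
  - intros x _. apply (is_derive_ext (fun s => Im c * (s ^ S k / INR (fact (S k))))).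
    + intros s. symmetry. apply Im_RtoC_mult.
    + evar_last; [apply (is_derive_scal (fun s => s ^ S k / INR (fact (S k)))), is_derive_monomial |].
      symmetry. apply Im_RtoC_mult.
  - intros x _. apply continuous_Cmult; [apply continuous_monomial | apply continuous_Cconst].
Qed.

(** The scaling variable [t] is there for the induction: the remainder of order K + 1 is the
    integral over [0, t] of [u] times the remainder of order K. *)
Lemma Cexp_taylor_scaled (u : C) (K : nat) (t : R) :
  0 <= t ->
  Cmod (Cexp (RtoC t * u) - csum (fun k => RtoC (t ^ k / INR (fact k)) * u ^ k)%C K)
   <= t ^ K / INR (fact K) * Cmod u ^ K * exp (t * Cmod u).
Proof.
  revert t. induction K as [|K IH]; intros t Ht.
  - simpl csum. unfold Cminus. rewrite Copp_0, Cplus_0_r, Cmod_Cexp. simpl.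
    replace (1 / 1 * 1 * exp (t * Cmod u)) with (exp (t * Cmod u)) by field.
    assert (L : Re (RtoC t * u) <= t * Cmod u).
    { eapply Rle_trans; [apply Rle_abs |]. eapply Rle_trans; [apply re_le_Cmod |].
      rewrite Cmod_mult, Cmod_R, Rabs_pos_eq; lra. }
    apply exp_monotone, L.
  - set (D := fun s => (Cexp (RtoC s * u) - csum (fun k => RtoC (s ^ k / INR (fact k)) * u ^ k)%C K)%C).
    assert (CE : contR (fun s => Cexp (RtoC s * u))).
    { intros x. apply continuous_C_pair; unfold Cexp, Re, Im, Cmult, RtoC; simpl;
      apply continuity_pt_filterlim; reg. }
    assert (CM : forall k, contR (fun s => RtoC (s ^ k / INR (fact k)) * u ^ k)%C).
    { intros k x. apply continuous_Cmult; [apply continuous_monomial | apply continuous_Cconst]. }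
    assert (CS : contR (fun s => csum (fun k => RtoC (s ^ k / INR (fact k)) * u ^ k)%C K)).
    { apply (contR_csum (fun k s => RtoC (s ^ k / INR (fact k)) * u ^ k)%C). auto. }
    assert (CD : contR D) by (intros x; apply continuous_Cminus; [apply CE | apply CS]).
    assert (E : (Cexp (RtoC t * u) - csum (fun k => RtoC (t ^ k / INR (fact k)) * u ^ k)%C (S K))%C
      = Cint (fun s => u * D s)%C 0 t).
    { rewrite (Cint_ext _ (fun s => u * Cexp (RtoC s * u) -
         csum (fun k => RtoC (s ^ k / INR (fact k)) * u ^ S k)%C K)%C); auto.
      2: { intros s _. unfold D. unfold Cminus. rewrite Cmult_plus_distr_l. f_equal.
           replace (u * - csum _ K)%C with (- (u * csum (fun k => RtoC (s ^ k / INR (fact k)) * u ^ k)%C K))%C by ring.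
           f_equal. rewrite <- csum_scal. apply csum_ext. intros k _. simpl. ring. }
      rewrite Cint_minus; auto.
      2: { intros x _. apply continuous_Cmult; [apply continuous_Cconst | apply CE]. }
      2: { apply contR_on, (contR_csum (fun k s => RtoC (s ^ k / INR (fact k)) * u ^ S k)%C).
           intros k _ x. apply continuous_Cmult; [apply continuous_monomial | apply continuous_Cconst]. }
      rewrite Cexp_scaled_integral by auto.
      rewrite (Cint_csum (fun k s => RtoC (s ^ k / INR (fact k)) * u ^ S k)%C); auto.
      2: { intros k _ x _. apply continuous_Cmult; [apply continuous_monomial | apply continuous_Cconst]. }
      rewrite (csum_ext (fun k => Cint _ 0 t) (fun k => RtoC (t ^ S k / INR (fact (S k))) * u ^ S k)%C).
      2: { intros k _. apply monomial_integral, Ht. }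
      change (S K) with (1 + K)%nat. rewrite csum_split.
      replace (csum (fun k => RtoC (t ^ k / INR (fact k)) * u ^ k)%C 1) with (RtoC 1).
      2: { simpl. replace (1 / 1) with 1 by field. ring. }
      change (csum (fun j => RtoC (t ^ (1 + j) / INR (fact (1 + j))) * u ^ (1 + j))%C K) with
        (csum (fun k => RtoC (t ^ S k / INR (fact (S k))) * u ^ S k)%C K).
      ring. }
    rewrite E.
    set (g := fun s => Cmod u ^ S K * exp (t * Cmod u) * (s ^ K / INR (fact K))).
    assert (IG : is_RInt g 0 t (Cmod u ^ S K * exp (t * Cmod u) * (t ^ S K / INR (fact (S K))))).
    { replace (_ * _) with (minus (Cmod u ^ S K * exp (t * Cmod u) * (t ^ S K / INR (fact (S K))))
        (Cmod u ^ S K * exp (t * Cmod u) * (0 ^ S K / INR (fact (S K))))).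
      2: { unfold minus, plus, opp; simpl minus. rewrite (pow_i (S K)) by lia.
           unfold Rdiv; simpl. ring. }
      apply (is_RInt_derive (V := R_CompleteNormedModule)
        (fun s => Cmod u ^ S K * exp (t * Cmod u) * (s ^ S K / INR (fact (S K)))) g).
      - intros x _. apply (is_derive_scal (fun s => s ^ S K / INR (fact (S K)))), is_derive_monomial.
      - intros x _. apply continuity_pt_filterlim. unfold g. reg. }
    rewrite (Rmult_comm (t ^ S K / _)), Rmult_assoc, (Rmult_comm (t ^ S K / _)), <- Rmult_assoc.
    rewrite <- (is_RInt_unique (V := R_CompleteNormedModule) _ _ _ _ IG).
    apply Cint_bound_fun; auto.
    + apply contR_on, contR_scal, CD.
    + eexists; exact IG.
    + intros s Hs. rewrite Cmod_mult. unfold g. specialize (IH s ltac:(lra)). fold (D s) in IH.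
      assert (M := Cmod_ge_0 u).
      assert (exp (s * Cmod u) <= exp (t * Cmod u)).
      { apply exp_monotone, Rmult_le_compat_r; lra. }
      assert (F : 0 <= s ^ K / INR (fact K) * Cmod u ^ K).
      { apply Rmult_le_pos; [apply Rmult_le_pos |]; try apply pow_le; try lra.
        left; apply Rinv_0_lt_compat, INR_fact_lt_0. }
      apply Rle_trans with (Cmod u * (s ^ K / INR (fact K) * Cmod u ^ K * exp (t * Cmod u))).
      * apply Rmult_le_compat_l; auto. eapply Rle_trans; [exact IH |]. apply Rmult_le_compat_l; auto.
      * right. simpl. ring.
Qed.

Lemma Cexp_taylor (u : C) (K : nat) :
  Cmod (Cexp u - exp_poly u K) <= Cmod u ^ K / INR (fact K) * exp (Cmod u).
Proof.
  generalize (Cexp_taylor_scaled u K 1 ltac:(lra)).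
  rewrite Cmult_1_l, pow1, Rmult_1_l. unfold exp_poly.
  rewrite (csum_ext (fun k => RtoC (1 ^ k / _) * _)%C (fun k => RtoC (/ INR (fact k)) * u ^ k)%C).
  - intros H. eapply Rle_trans; [exact H |]. right. unfold Rdiv. ring.
  - intros k _. rewrite pow1. unfold Rdiv. now rewrite Rmult_1_l.
Qed.

(** * Complex differentiability in Caratheodory's form *)

(** [phi] is the difference quotient with its limit filled in at [s]. Products and compositions then
    become algebra and continuity, without division. *)
Definition cdiff (f : C -> C) (s : C) : Prop :=
  exists phi : C -> C, (forall z, f z = f s + phi z * (z - s))%C /\
    continuous (T := C_UniformSpace) (U := C_UniformSpace) phi s.

Lemma ex_derive_cdiff (f : C -> C) (s : C) :
  ex_derive (K := C_AbsRing) (V := C_NormedModule) f s -> cdiff f s.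
Proof.
  intros [l [_ H]]. specialize (H s (fun P HP => HP)).
  exists (fun z => if excluded_middle_informative (z = s) then l else ((f z - f s) / (z - s))%C).
  split.
  - intros z. destruct excluded_middle_informative as [-> | Hn]; [ring |].
    field. intros E. apply Hn. replace z with (z - s + s)%C by ring. rewrite E. ring.
  - apply continuous_C_eps_C. intros eps He.
    assert (He2 : 0 < eps / 2) by lra.
    destruct (H (mkposreal _ He2)) as [d Hd]. exists d. split; [apply cond_pos |].
    intros z Hz. specialize (Hd z Hz).
    destruct (excluded_middle_informative (s = s)) as [_ | Hn]; [| congruence].
    destruct excluded_middle_informative as [-> | Hn].
    { replace (l - l)%C with (RtoC 0) by ring. rewrite Cmod_0. exact He. }
    assert (Hzs : (z - s)%C <> 0).
    { intros E. apply Hn. replace z with (z - s + s)%C by ring. rewrite E. ring. }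
    change (Cmod ((f z - f s) - (z - s) * l) <= eps / 2 * Cmod (z - s)) in Hd.
    assert (Hp : 0 < Cmod (z - s)) by (apply Cmod_gt_0; exact Hzs).
    replace ((f z - f s) / (z - s) - l)%C with (((f z - f s) - (z - s) * l) / (z - s))%C by (field; exact Hzs).
    rewrite Cmod_div by exact Hzs.
    apply Rle_lt_trans with (eps / 2); [| lra].
    apply Rmult_le_reg_r with (Cmod (z - s)); auto. unfold Rdiv at 1.
    rewrite Rmult_assoc, Rinv_l by lra. lra.
Qed.

Lemma continuous_C_id (s : C) : continuous (T := C_UniformSpace) (U := C_UniformSpace) (fun z => z) s.
Proof. apply continuous_id. Qed.

Lemma cdiff_continuous (f : C -> C) (s : C) :
  cdiff f s -> continuous (T := C_UniformSpace) (U := C_UniformSpace) f s.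
Proof.
  intros [phi [E H]].
  apply continuous_ext with (fun z => f s + phi z * (z - s))%C; [auto |].
  apply continuous_Cplus; [apply continuous_Cconst |].
  apply continuous_Cmult; auto. apply continuous_Cminus; [apply continuous_C_id | apply continuous_Cconst].
Qed.

Lemma cdiff_mult (f g : C -> C) (s : C) :
  cdiff f s -> cdiff g s -> cdiff (fun z => f z * g z)%C s.
Proof.
  intros Hf Hg. assert (Cf := cdiff_continuous f s Hf).
  destruct Hf as [p [Ep Hp]]. destruct Hg as [q [Eq Hq]].
  exists (fun z => p z * g s + f z * q z)%C. split.
  - intros z. rewrite (Eq z). rewrite (Ep z). ring.
  - apply continuous_Cplus; apply continuous_Cmult; auto. apply continuous_Cconst.
Qed.

Lemma cdiff_comp (f g : C -> C) (s : C) :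
  cdiff g s -> cdiff f (g s) -> cdiff (fun z => f (g z)) s.
Proof.
  intros Hg Hf. assert (Cg := cdiff_continuous g s Hg).
  destruct Hf as [p [Ep Hp]]. destruct Hg as [q [Eq Hq]].
  exists (fun z => p (g z) * q z)%C. split.
  - intros z. rewrite (Ep (g z)). replace (g z - g s)%C with (q z * (z - s))%C by (rewrite (Eq z); ring). ring.
  - apply continuous_Cmult; auto. apply (continuous_comp g p); auto.
Qed.

Lemma cdiff_affine (c d s : C) : cdiff (fun z => c + d * z)%C s.
Proof.
  exists (fun _ => d). split; [intros; ring | apply continuous_Cconst].
Qed.

Lemma cdiff_inv (s : C) : s <> 0 -> cdiff (fun z => / z)%C s.
Proof.
  intros Hs.
  assert (Hp : 0 < Cmod s) by (apply Cmod_gt_0; exact Hs).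
  (* The identity is required at z = 0 as well, where [/ z] evaluates to 0; this value gives 0 = / s
     + phi 0 * (0 - s). *)
  exists (fun z : C => if excluded_middle_informative (z = RtoC 0) then (/ (s * s))%C else (- / (z * s))%C). split.
  - intros z. destruct excluded_middle_informative as [-> | Hn].
    + replace (/ 0)%C with (RtoC 0).
      * field. exact Hs.
      * unfold Cinv, RtoC; simpl. unfold Rdiv. rewrite Ropp_0, !Rmult_0_l. reflexivity.
    + field. auto.
  - apply continuous_C_eps_C. intros eps He.
    exists (Rmin (Cmod s / 2) (eps * (Cmod s * Cmod s * Cmod s) / 4)).
    assert (H3 : 0 < Cmod s * Cmod s * Cmod s) by (repeat apply Rmult_lt_0_compat; auto).
    split. { apply Rmin_glb_lt; [lra |]. apply Rdiv_lt_0_compat; [apply Rmult_lt_0_compat; auto | lra]. }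
    intros z Hz.
    assert (Hz1 : Cmod (z - s) < Cmod s / 2) by (eapply Rlt_le_trans; [exact Hz | apply Rmin_l]).
    assert (Hz2 : Cmod (z - s) < eps * (Cmod s * Cmod s * Cmod s) / 4) by (eapply Rlt_le_trans; [exact Hz | apply Rmin_r]).
    assert (Hzm : Cmod s / 2 < Cmod z).
    { generalize (Cmod_triangle_rev s z). rewrite Cmod_minus_sym. lra. }
    assert (Hz0 : z <> 0) by (apply Cmod_gt_0; lra).
    destruct excluded_middle_informative as [E | _]; [contradiction |].
    destruct excluded_middle_informative as [E | _]; [contradiction |].
    replace (- / (z * s) - - / (s * s))%C with ((z - s) / (z * s * s))%C by (field; auto).
    rewrite Cmod_div by (repeat apply Cmult_neq_0; auto). rewrite !Cmod_mult.
    apply Rmult_lt_reg_r with (Cmod z * Cmod s * Cmod s); [repeat apply Rmult_lt_0_compat; lra |].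
    unfold Rdiv. rewrite Rmult_assoc, Rinv_l, Rmult_1_r.
    2: { apply Rgt_not_eq. repeat apply Rmult_lt_0_compat; lra. }
    apply Rlt_le_trans with (eps * (Cmod s * Cmod s * Cmod s) / 4); auto.
    assert (Cmod s / 2 * (Cmod s * Cmod s) <= Cmod z * (Cmod s * Cmod s)) by (apply Rmult_le_compat_r; nra).
    assert (eps * (Cmod s / 2 * (Cmod s * Cmod s)) <= eps * (Cmod z * (Cmod s * Cmod s))) by (apply Rmult_le_compat_l; lra).
    assert (0 < eps * (Cmod s * Cmod s * Cmod s)) by (apply Rmult_lt_0_compat; auto). lra.
Qed.

Lemma cdiff_Cexp_0 : cdiff Cexp 0.
Proof.
  exists (fun z : C => if excluded_middle_informative (z = RtoC 0) then RtoC 1 else ((Cexp z - 1) / z)%C). split.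
  - intros z. rewrite Cexp_0. destruct excluded_middle_informative as [-> | Hn].
    + rewrite Cexp_0. ring.
    + field. exact Hn.
  - apply continuous_C_eps_C. intros eps He.
    assert (E1 := exp_pos 1).
    exists (Rmin 1 (eps / (exp 1))). split; [apply Rmin_glb_lt; [lra | apply Rdiv_lt_0_compat; auto] |].
    intros z Hz. replace (z - 0)%C with z in Hz by ring.
    assert (Hz1 : Cmod z < 1) by (eapply Rlt_le_trans; [exact Hz | apply Rmin_l]).
    assert (Hz2 : Cmod z < eps / (exp 1)) by (eapply Rlt_le_trans; [exact Hz | apply Rmin_r]).
    destruct (excluded_middle_informative (RtoC 0 = RtoC 0)) as [_ | Hn]; [| congruence].
    destruct excluded_middle_informative as [-> | Hn].
    { replace (1 - 1)%C with (RtoC 0) by ring. rewrite Cmod_0. exact He. }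
    assert (Hp : 0 < Cmod z) by (apply Cmod_gt_0; exact Hn).
    assert (T := Cexp_taylor z 2). unfold exp_poly in T. simpl in T.
    replace ((Cexp z - 1) / z - 1)%C with ((Cexp z - (0 + / 1 * 1 + / 1 * (z * 1))) / z)%C
      by (rewrite Cmult_1_r; field; exact Hn).
    rewrite !RtoC_inv in T by lra.
    rewrite Cmod_div by exact Hn.
    apply Rmult_lt_reg_r with (Cmod z); auto. unfold Rdiv at 1. rewrite Rmult_assoc, Rinv_l, Rmult_1_r by lra.
    eapply Rle_lt_trans; [exact T |].
    assert (L : exp (Cmod z) <= exp 1) by (left; apply exp_increasing, Hz1).
    assert (Cmod z * exp 1 < eps).
    { apply Rmult_lt_reg_r with (/ exp 1); [apply Rinv_0_lt_compat; auto |].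
      rewrite Rmult_assoc, Rinv_r, Rmult_1_r by lra. exact Hz2. }
    assert (Cmod z * exp (Cmod z) <= Cmod z * exp 1) by (apply Rmult_le_compat_l; lra).
    rewrite Rmult_1_r.
    assert (0 < exp (Cmod z)) by apply exp_pos.
    assert (Cmod z * (Cmod z * exp (Cmod z)) < Cmod z * eps) by (apply Rmult_lt_compat_l; lra).
    assert (0 < Cmod z * (Cmod z * exp (Cmod z))) by (repeat apply Rmult_lt_0_compat; lra).
    replace (Cmod z * Cmod z / (1 + 1) * exp (Cmod z)) with (Cmod z * (Cmod z * exp (Cmod z)) / 2) by field.
    lra.
Qed.

Lemma cdiff_Cexp (s : C) : cdiff Cexp s.
Proof.
  (* The functional equation carries differentiability from 0 to [s]; the terms [0 +] and [1 *]
     match [cdiff_affine]. *)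
  assert (E : forall z, Cexp z = (0 + Cexp s * Cexp (- s + 1 * z))%C).
  { intros z. rewrite <- Cexp_plus, Cplus_0_l. f_equal. ring. }
  assert (H : cdiff (fun z => 0 + Cexp s * Cexp (- s + 1 * z))%C s).
  { apply (cdiff_comp (fun w => 0 + Cexp s * w)%C); [| apply cdiff_affine].
    apply (cdiff_comp Cexp); [apply cdiff_affine |].
    replace (- s + 1 * s)%C with (RtoC 0) by ring. apply cdiff_Cexp_0. }
  destruct H as [p [Ep Hp]]. exists p. split; auto.
  intros z. specialize (Ep z). rewrite <- !E in Ep. exact Ep.
Qed.

(** * The Cauchy-Goursat theorem for rectangles *)

(** The contour integral of [f] dz, counterclockwise along the boundary of [a, b] x [c, d]. *)
Definition rect_int (f : C -> C) (a b c d : R) : C :=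
  (Cint (fun x => f (x, c)) a b - Cint (fun x => f (x, d)) a b
   + Ci * Cint (fun y => f (b, y)) c d - Ci * Cint (fun y => f (a, y)) c d)%C.

Definition cont_rect (f : C -> C) (a b c d : R) : Prop :=
  forall x y, a <= x <= b -> c <= y <= d ->
    continuous (T := C_UniformSpace) (U := C_UniformSpace) f (x, y).

Lemma continuous_horizontal (f : C -> C) (x y : R) :
  continuous (T := C_UniformSpace) (U := C_UniformSpace) f (x, y) ->
  continuous (T := R_UniformSpace) (U := C_UniformSpace) (fun t => f (t, y)) x.
Proof.
  intros H. apply (continuous_comp (U := R_UniformSpace) (V := C_UniformSpace) (fun t => (t, y)) f); auto.
  apply continuous_C_pair; simpl; [apply continuous_id | apply continuous_const].
Qed.

Lemma continuous_vertical (f : C -> C) (x y : R) :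
  continuous (T := C_UniformSpace) (U := C_UniformSpace) f (x, y) ->
  continuous (T := R_UniformSpace) (U := C_UniformSpace) (fun t => f (x, t)) y.
Proof.
  intros H. apply (continuous_comp (U := R_UniformSpace) (V := C_UniformSpace) (fun t => (x, t)) f); auto.
  apply continuous_C_pair; simpl; [apply continuous_const | apply continuous_id].
Qed.

Lemma cont_rect_h (f : C -> C) (a b c d y : R) :
  cont_rect f a b c d -> c <= y <= d -> cont_on a b (fun x => f (x, y)).
Proof. intros H Hy x Hx. apply continuous_horizontal, H; auto. Qed.

Lemma cont_rect_v (f : C -> C) (a b c d x : R) :
  cont_rect f a b c d -> a <= x <= b -> cont_on c d (fun y => f (x, y)).
Proof. intros H Hx y Hy. apply continuous_vertical, H; auto. Qed.

Lemma rect_int_split (f : C -> C) (a m b c n d : R) :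
  a <= m <= b -> c <= n <= d -> cont_rect f a b c d ->
  rect_int f a b c d =
  (rect_int f a m c n + rect_int f m b c n + rect_int f a m n d + rect_int f m b n d)%C.
Proof.
  intros Hm Hn H. unfold rect_int.
  rewrite <- (Cint_Chasles (fun x => f (x, c)) a m b); [| lra | lra | apply (cont_rect_h f a b c d); auto; lra].
  rewrite <- (Cint_Chasles (fun x => f (x, d)) a m b); [| lra | lra | apply (cont_rect_h f a b c d); auto; lra].
  rewrite <- (Cint_Chasles (fun y => f (a, y)) c n d); [| lra | lra | apply (cont_rect_v f a b c d); auto; lra].
  rewrite <- (Cint_Chasles (fun y => f (b, y)) c n d); [| lra | lra | apply (cont_rect_v f a b c d); auto; lra].
  ring.
Qed.

Lemma rect_int_bound (f : C -> C) (a b c d M : R) :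
  a <= b -> c <= d -> cont_rect f a b c d ->
  (forall x y, a <= x <= b -> c <= y <= d -> Cmod (f (x, y)) <= M) ->
  Cmod (rect_int f a b c d) <= 2 * M * ((b - a) + (d - c)).
Proof.
  intros Hab Hcd H HM. unfold rect_int.
  assert (B1 : Cmod (Cint (fun x => f (x, c)) a b) <= M * (b - a)).
  { apply Cint_bound; auto. - apply (cont_rect_h f a b c d); auto; lra. - intros; apply HM; lra. }
  assert (B2 : Cmod (Cint (fun x => f (x, d)) a b) <= M * (b - a)).
  { apply Cint_bound; auto. - apply (cont_rect_h f a b c d); auto; lra. - intros; apply HM; lra. }
  assert (B3 : Cmod (Cint (fun y => f (b, y)) c d) <= M * (d - c)).
  { apply Cint_bound; auto. - apply (cont_rect_v f a b c d); auto; lra. - intros; apply HM; lra. }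
  assert (B4 : Cmod (Cint (fun y => f (a, y)) c d) <= M * (d - c)).
  { apply Cint_bound; auto. - apply (cont_rect_v f a b c d); auto; lra. - intros; apply HM; lra. }
  set (i1 := Cint (fun x => f (x, c)) a b) in *. set (i2 := Cint (fun x => f (x, d)) a b) in *.
  set (i3 := Cint (fun y => f (b, y)) c d) in *. set (i4 := Cint (fun y => f (a, y)) c d) in *.
  assert (T1 := Cmod_triangle (i1 - i2 + Ci * i3) (- (Ci * i4))).
  assert (T2 := Cmod_triangle (i1 - i2) (Ci * i3)).
  assert (T3 := Cmod_triangle i1 (- i2)).
  rewrite Cmod_opp in T1, T3. rewrite !Cmod_mult, Cmod_Ci in *.
  unfold Cminus in *. lra.
Qed.

Lemma rect_int_ext (f g : C -> C) (a b c d : R) :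
  a <= b -> c <= d -> (forall z, f z = g z) -> rect_int f a b c d = rect_int g a b c d.
Proof.
  intros Hab Hcd E. unfold rect_int.
  rewrite !(Cint_ext (fun x => f (x, _)) (fun x => g (x, _))) by auto.
  rewrite !(Cint_ext (fun y => f (_, y)) (fun y => g (_, y))) by auto.
  reflexivity.
Qed.

Lemma rect_int_plus (f g : C -> C) (a b c d : R) :
  a <= b -> c <= d -> cont_rect f a b c d -> cont_rect g a b c d ->
  rect_int (fun z => f z + g z)%C a b c d = (rect_int f a b c d + rect_int g a b c d)%C.
Proof.
  intros Hab Hcd Hf Hg. unfold rect_int.
  rewrite !(Cint_plus (fun x => f (x, _)) (fun x => g (x, _))); auto;
    try (apply (cont_rect_h _ a b c d); auto; lra).
  rewrite !(Cint_plus (fun y => f (_, y)) (fun y => g (_, y))); auto;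
    try (apply (cont_rect_v _ a b c d); auto; lra).
  ring.
Qed.

Lemma Ci_sqr : (Ci * Ci)%C = (- (1))%C.
Proof. unfold Ci, Cmult, Copp, RtoC; simpl. f_equal; ring. Qed.

Lemma rect_int_affine (p q : C) (a b c d : R) :
  a <= b -> c <= d -> rect_int (fun z => p + q * z)%C a b c d = 0.
Proof.
  intros Hab Hcd.
  set (P := fun z : C => (p * z + q * z * z / 2)%C).
  assert (Hx : forall y, Cint (fun x => p + q * (x, y))%C a b = (P (b, y) - P (a, y))%C).
  { intros y. rewrite (Cint_derive (fun x => P (x, y))); auto.
    - intros x _. unfold P, Re, Cplus, Cmult, Cdiv, Cinv, RtoC; simpl.
      auto_derive; auto. field.
    - intros x _. unfold P, Im, Cplus, Cmult, Cdiv, Cinv, RtoC; simpl.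
      auto_derive; auto. field.
    - intros x _. apply continuous_horizontal with (f := fun z : C => (p + q * z)%C).
      apply continuous_Cplus; [apply continuous_Cconst |].
      apply continuous_Cmult; [apply continuous_Cconst | apply continuous_C_id]. }
  assert (Hy : forall x, Cint (fun y => p + q * (x, y))%C c d = (- Ci * (P (x, d) - P (x, c)))%C).
  { intros x. rewrite (Cint_derive (fun y => - Ci * P (x, y))%C); auto.
    - ring.
    - intros y _. unfold P, Ci, Re, Copp, Cplus, Cmult, Cdiv, Cinv, RtoC; simpl.
      auto_derive; auto. field.
    - intros y _. unfold P, Ci, Im, Copp, Cplus, Cmult, Cdiv, Cinv, RtoC; simpl.
      auto_derive; auto. field.
    - intros y _. apply continuous_vertical with (f := fun z : C => (p + q * z)%C).
      apply continuous_Cplus; [apply continuous_Cconst |].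
      apply continuous_Cmult; [apply continuous_Cconst | apply continuous_C_id]. }
  unfold rect_int. rewrite !Hx, !Hy.
  replace (Ci * (- Ci * (P (b, d) - P (b, c))))%C with (P (b, d) - P (b, c))%C.
  2: { replace (Ci * (- Ci * (P (b, d) - P (b, c))))%C with (- (Ci * Ci) * (P (b, d) - P (b, c)))%C by ring.
       rewrite Ci_sqr. ring. }
  replace (Ci * (- Ci * (P (a, d) - P (a, c))))%C with (P (a, d) - P (a, c))%C.
  2: { replace (Ci * (- Ci * (P (a, d) - P (a, c))))%C with (- (Ci * Ci) * (P (a, d) - P (a, c)))%C by ring.
       rewrite Ci_sqr. ring. }
  ring.
Qed.

(** * Bisection of rectangles and Goursat's theorem *)

Record rect := Rect { rl : R; rr : R; rb : R; rt : R }.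

Definition rect_ok (r : rect) : Prop := rl r <= rr r /\ rb r <= rt r.
Definition rect_sub (r s : rect) : Prop :=
  rl s <= rl r /\ rr r <= rr s /\ rb s <= rb r /\ rt r <= rt s.
Definition rect_size (r : rect) : R := (rr r - rl r) + (rt r - rb r).
Definition rect_in (x y : R) (r : rect) : Prop := rl r <= x <= rr r /\ rb r <= y <= rt r.

Definition rect_quarter (r s : rect) : Prop :=
  rect_sub r s /\ rect_size r = rect_size s / 2.

(** If [P r0] failed, it would fail on a nested sequence of rectangles, each of half the size; they
    shrink to a point, where the local hypothesis contradicts the failure. *)
Lemma rect_bisection (P : rect -> Prop) (r0 : rect) :
  rect_ok r0 ->
  (forall r, rect_ok r -> rect_sub r r0 ->
     (forall r', rect_ok r' -> rect_quarter r' r -> P r') -> P r) ->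
  (forall x y, rect_in x y r0 -> exists d, 0 < d /\
     forall r, rect_ok r -> rect_sub r r0 -> rect_in x y r -> rect_size r < d -> P r) ->
  P r0.
Proof.
  intros H0 Hq Hloc. apply NNPP. intros Hn.
  set (bad := fun r => rect_ok r /\ rect_sub r r0 /\ ~ P r).
  assert (step : forall r, exists r', bad r -> bad r' /\ rect_quarter r' r).
  { intros r. destruct (classic (bad r)) as [Hb | Hb]; [| exists r; contradiction].
    destruct Hb as [B1 [B2 B3]].
    destruct (classic (forall r', rect_ok r' -> rect_quarter r' r -> P r')) as [A | A].
    { exfalso. apply B3, Hq; auto. }
    apply not_all_ex_not in A. destruct A as [r' A]. exists r'. intros _.
    apply imply_to_and in A. destruct A as [A1 A2]. apply imply_to_and in A2.
    destruct A2 as [A2 A3]. split; auto. split; auto. split; auto.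
    destruct A2 as [A2 _]. unfold rect_sub in *. lra. }
  set (next := fun r => proj1_sig (constructive_indefinite_description _ (step r))).
  assert (Hnext : forall r, bad r -> bad (next r) /\ rect_quarter (next r) r).
  { intros r. unfold next. destruct constructive_indefinite_description; auto. }
  set (Q := fun n => Nat.iter n next r0).
  assert (RB : forall n, bad (Q n)).
  { induction n as [|n IH]; simpl.
    - split; auto. split; auto. unfold rect_sub. lra.
    - apply Hnext, IH. }
  assert (RS : forall n, rect_quarter (Q (S n)) (Q n)) by (intros n; apply Hnext, RB).
  assert (RM : forall n k, rect_sub (Q (n + k)%nat) (Q n)).
  { intros n. induction k as [|k IH].
    - rewrite Nat.add_0_r. unfold rect_sub. lra.
    - rewrite Nat.add_succ_r. destruct (RS (n + k)%nat) as [A _]. unfold rect_sub in *. lra. }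
  assert (RZ : forall n, rect_size (Q n) = rect_size r0 * (1 / 2) ^ n).
  { induction n as [|n IH]; [simpl; unfold Q; simpl; ring |].
    destruct (RS n) as [_ A]. rewrite A, IH. simpl. field. }
  assert (lim : forall lo hi : rect -> R,
    (forall r s, rect_sub r s -> lo s <= lo r /\ hi r <= hi s) ->
    (forall r, rect_ok r -> lo r <= hi r) ->
    exists x, forall n, lo (Q n) <= x <= hi (Q n)).
  { intros lo hi Hmon Hle.
    assert (Hc : forall n m, lo (Q n) <= hi (Q m)).
    { intros n m. destruct (Hmon _ _ (RM n m)) as [A1 _].
      assert (B := RM m n). rewrite Nat.add_comm in B. destruct (Hmon _ _ B) as [_ A2].
      destruct (RB (n + m)%nat) as [Ok _]. specialize (Hle _ Ok). lra. }
    destruct (completeness (fun x => exists n, x = lo (Q n))) as [x [U L]].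
    - exists (hi r0). intros z [n ->]. apply (Hc n 0%nat).
    - exists (lo (Q 0%nat)), 0%nat. reflexivity.
    - exists x. intros n. split; [apply U; eauto |]. apply L. intros z [m ->]. apply Hc. }
  destruct (lim rl rr) as [x Hx].
  { intros r s Hs. unfold rect_sub in Hs. lra. } { intros r Hr. apply Hr. }
  destruct (lim rb rt) as [y Hy].
  { intros r s Hs. unfold rect_sub in Hs. lra. } { intros r Hr. apply Hr. }
  destruct (Hloc x y) as [d [Hd HP]]; [split; [apply (Hx 0%nat) | apply (Hy 0%nat)] |].
  assert (Hs0 : 0 <= rect_size r0) by (destruct H0; unfold rect_size; lra).
  destruct (pow_lt_1_zero (1 / 2)) with (y := d / (rect_size r0 + 1)) as [n Hnn].
  { rewrite Rabs_pos_eq; lra. } { apply Rdiv_lt_0_compat; lra. }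
  specialize (Hnn n (Nat.le_refl n)).
  destruct (RB n) as [B1 [B2 B3]]. apply B3, HP; auto.
  - split; auto.
  - rewrite RZ. rewrite Rabs_pos_eq in Hnn by (apply pow_le; lra).
    assert (Hpp : 0 < (1 / 2) ^ n) by (apply pow_lt; lra).
    apply Rle_lt_trans with ((rect_size r0 + 1) * (1 / 2) ^ n); [apply Rmult_le_compat_r; lra |].
    apply Rmult_lt_reg_r with (/ (rect_size r0 + 1)); [apply Rinv_0_lt_compat; lra |].
    replace ((rect_size r0 + 1) * (1 / 2) ^ n * / (rect_size r0 + 1)) with ((1 / 2) ^ n) by (field; lra).
    exact Hnn.
Qed.

Lemma Cmod_pair_le (x y : R) : Cmod (x, y) <= Rabs x + Rabs y.
Proof. apply (Cmod_le_Re_Im (x, y)). Qed.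

(** The bound eps * size^2 is compatible with quartering, as 4 * (size / 2)^2 = size^2. Near a point
    the affine part of [f] integrates to 0, the rest is at most eps / 2 * size, and the perimeter is
    2 * size. *)
Lemma goursat (f : C -> C) (a b c d : R) :
  a <= b -> c <= d ->
  (forall x y, a <= x <= b -> c <= y <= d -> cdiff f (x, y)) ->
  rect_int f a b c d = 0.
Proof.
  intros Hab Hcd Hf.
  assert (Hc : cont_rect f a b c d) by (intros x y Hx Hy; apply cdiff_continuous; auto).
  set (r0 := Rect a b c d).
  assert (Main : forall eps, 0 < eps -> Cmod (rect_int f a b c d) <= eps * rect_size r0 ^ 2).
  { intros eps He.
    apply (rect_bisection (fun r => Cmod (rect_int f (rl r) (rr r) (rb r) (rt r)) <= eps * rect_size r ^ 2) r0).
    - split; auto.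
    - intros [l r bo t] [O1 O2] [S1 [S2 [S3 S4]]] HQ. unfold r0 in *. simpl in *.
      set (m := (l + r) / 2). set (n := (bo + t) / 2).
      rewrite (rect_int_split f l m r bo n t); [| unfold m; lra | unfold n; lra
        | intros x y Hx Hy; apply Hc; lra].
      assert (Q : forall l' r' b' t', l <= l' -> r' <= r -> bo <= b' -> t' <= t ->
         r' - l' = (r - l) / 2 -> t' - b' = (t - bo) / 2 ->
         Cmod (rect_int f l' r' b' t') <= eps * (((r - l) + (t - bo)) / 2) ^ 2).
      { intros l' r' b' t' L1 L2 L3 L4 E1 E2.
        replace ((r - l + (t - bo)) / 2) with (rect_size (Rect l' r' b' t')).
        - apply (HQ (Rect l' r' b' t')).
          + split; simpl; lra.
          + split; [unfold rect_sub; simpl; lra | unfold rect_size; simpl; lra].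
        - unfold rect_size; simpl; lra. }
      assert (Q1 := Q l m bo n ltac:(lra) ltac:(unfold m; lra) ltac:(lra) ltac:(unfold n; lra)
        ltac:(unfold m; lra) ltac:(unfold n; lra)).
      assert (Q2 := Q m r bo n ltac:(unfold m; lra) ltac:(lra) ltac:(lra) ltac:(unfold n; lra)
        ltac:(unfold m; lra) ltac:(unfold n; lra)).
      assert (Q3 := Q l m n t ltac:(lra) ltac:(unfold m; lra) ltac:(unfold n; lra) ltac:(lra)
        ltac:(unfold m; lra) ltac:(unfold n; lra)).
      assert (Q4 := Q m r n t ltac:(unfold m; lra) ltac:(lra) ltac:(unfold n; lra) ltac:(lra)
        ltac:(unfold m; lra) ltac:(unfold n; lra)).
      unfold rect_size; simpl.
      set (q1 := rect_int f l m bo n) in *. set (q2 := rect_int f m r bo n) in *.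
      set (q3 := rect_int f l m n t) in *. set (q4 := rect_int f m r n t) in *.
      assert (T1 := Cmod_triangle (q1 + q2 + q3) q4).
      assert (T2 := Cmod_triangle (q1 + q2) q3). assert (T3 := Cmod_triangle q1 q2).
      assert (E : eps * (((r - l) + (t - bo)) * (((r - l) + (t - bo)) * 1)) =
        4 * (eps * (((r - l) + (t - bo)) / 2) ^ 2)) by (simpl; field).
      lra.
    - intros x y [Hx Hy]. simpl in Hx, Hy.
      destruct (Hf x y Hx Hy) as [phi [Ephi Cphi]].
      destruct (proj1 (continuous_C_eps_C phi (x, y)) Cphi (eps / 2)) as [dl [Hdl Hphi]]; [lra |].
      exists dl. split; auto.
      intros [l r bo t] [O1 O2] [S1 [S2 [S3 S4]]] [I1 I2] Hsz. unfold rect_size in *. simpl in *.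
      set (s := (x, y) : C).
      assert (Hlin : cont_rect (fun z => (f s - phi s * s) + phi s * z)%C l r bo t).
      { intros u v _ _. apply continuous_Cplus; [apply continuous_Cconst |].
        apply continuous_Cmult; [apply continuous_Cconst | apply continuous_C_id]. }
      set (g := fun z => (f z - ((f s - phi s * s) + phi s * z))%C).
      assert (Hg : cont_rect g l r bo t).
      { intros u v Hu Hv. apply continuous_Cminus; [apply Hc; lra | apply Hlin; auto]. }
      assert (E : rect_int f l r bo t = rect_int g l r bo t).
      { transitivity (rect_int (fun z => g z + ((f s - phi s * s) + phi s * z))%C l r bo t).
        - apply rect_int_ext; auto. intros z. unfold g. ring.
        - rewrite rect_int_plus; auto. rewrite rect_int_affine by auto. ring. }
      rewrite E.
      apply Rle_trans with (2 * (eps / 2 * ((r - l) + (t - bo))) * ((r - l) + (t - bo))).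
      + apply rect_int_bound; auto. intros u v Hu Hv.
        assert (EG : g (u, v) = ((phi (u, v) - phi s) * ((u, v) - s))%C).
        { unfold g. rewrite (Ephi (u, v)). fold s. ring. }
        assert (DS : Cmod ((u, v) - s)%C <= (r - l) + (t - bo)).
        { unfold s. change ((u, v) - (x, y))%C with ((u - x, v - y) : C).
          eapply Rle_trans; [apply Cmod_pair_le |]. apply Rplus_le_compat; apply Rabs_le; lra. }
        rewrite EG, Cmod_mult. apply Rmult_le_compat; try apply Cmod_ge_0; auto.
        left. apply Hphi. fold s. lra.
      + right. simpl. field. }
  assert (Hs0 : 0 <= rect_size r0) by (unfold rect_size; simpl; lra).
  apply Cmod_eq_0. apply Rle_antisym; [| apply Cmod_ge_0].
  apply le_epsilon. intros eps He. rewrite Rplus_0_l.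
  assert (Hs2 := pow2_ge_0 (rect_size r0)).
  eapply Rle_trans; [apply (Main (eps / (rect_size r0 ^ 2 + 1))); apply Rdiv_lt_0_compat; lra |].
  apply Rle_trans with (eps / (rect_size r0 ^ 2 + 1) * (rect_size r0 ^ 2 + 1)).
  - apply Rmult_le_compat_l; [left; apply Rdiv_lt_0_compat; lra | lra].
  - right. field. lra.
Qed.

(** * Consequences of Goursat: shifting vertical means, and a mean value bound *)

(** The horizontal sides of a rectangle of height [T] contribute at most 2 * B * (s2 - s1), which is
    negligible against [T]. *)
Lemma vertical_means_agree (g : C -> C) (s1 s2 B : R) (a : C) :
  s1 <= s2 -> (forall x y, s1 <= x <= s2 -> cdiff g (x, y)) ->
  (forall x y, s1 <= x <= s2 -> Cmod (g (x, y)) <= B) ->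
  (umean (fun t => g (s1, t)) a <-> umean (fun t => g (s2, t)) a).
Proof.
  intros Hs Hg HB.
  assert (HB0 : 0 <= B) by (eapply Rle_trans; [apply Cmod_ge_0 | apply (HB s1 0); lra]).
  assert (CV : forall s, s1 <= s <= s2 -> contR (fun t => g (s, t))).
  { intros s Hss t. apply continuous_vertical, cdiff_continuous, Hg, Hss. }
  assert (CH : forall y, cont_on s1 s2 (fun x => g (x, y))).
  { intros y x Hx. apply continuous_horizontal, cdiff_continuous, Hg, Hx. }
  assert (D : forall x T, 0 <= T ->
    Cmod (Cint (fun t => g (s2, t)) x (x + T) - Cint (fun t => g (s1, t)) x (x + T)) <= 2 * B * (s2 - s1)).
  { intros x T HT.
    assert (G := goursat g s1 s2 x (x + T) Hs ltac:(lra) ltac:(intros; apply Hg; auto)).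
    unfold rect_int in G.
    set (i2 := Cint (fun t => g (s2, t)) x (x + T)) in *. set (i1 := Cint (fun t => g (s1, t)) x (x + T)) in *.
    set (j1 := Cint (fun t => g (t, x)) s1 s2) in *. set (j2 := Cint (fun t => g (t, (x + T)%R)) s1 s2) in *.
    assert (E : (Ci * (i2 - i1))%C = (j2 - j1)%C).
    { replace (j2 - j1)%C with ((j1 - j2 + Ci * i2 - Ci * i1) + (j2 - j1))%C by (rewrite G; ring). ring. }
    rewrite <- (Rmult_1_l (Cmod (i2 - i1))), <- Cmod_Ci, <- Cmod_mult, E.
    eapply Rle_trans; [apply Cmod_triangle |]. rewrite Cmod_opp.
    assert (Cmod j1 <= B * (s2 - s1)) by (apply Cint_bound; auto).
    assert (Cmod j2 <= B * (s2 - s1)) by (apply Cint_bound; auto). lra. }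
  assert (W : forall u v, (forall x T, 0 <= T ->
    Cmod (Cint (fun t => g (v, t)) x (x + T) - Cint (fun t => g (u, t)) x (x + T)) <= 2 * B * (s2 - s1)) ->
    contR (fun t => g (v, t)) -> umean (fun t => g (u, t)) a -> umean (fun t => g (v, t)) a).
  { intros u v Huv Hv [_ Hm]. split; auto. intros eps He.
    destruct (Hm (eps / 2)) as [T0 [HT0 H0]]; [lra |].
    assert (Hnn : 0 <= 2 * B * (s2 - s1)) by (repeat apply Rmult_le_pos; lra).
    exists (Rmax T0 (2 * B * (s2 - s1) / (eps / 2))).
    split; [eapply Rlt_le_trans; [exact HT0 | apply Rmax_l] |].
    intros T HT x.
    assert (T0 <= T) by (eapply Rle_trans; [apply Rmax_l | exact HT]).
    assert (L : 2 * B * (s2 - s1) / (eps / 2) <= T) by (eapply Rle_trans; [apply Rmax_r | exact HT]).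
    assert (L2 : 2 * B * (s2 - s1) <= eps / 2 * T).
    { replace (2 * B * (s2 - s1)) with (eps / 2 * (2 * B * (s2 - s1) / (eps / 2))) by (field; lra).
      apply Rmult_le_compat_l; lra. }
    eapply Rle_trans; [apply (Cmod_triangle_minus _ (Cint (fun t => g (u, t)) x (x + T))) |].
    specialize (H0 T H x). specialize (Huv x T ltac:(lra)). lra. }
  split; apply W; auto.
  - apply CV; lra.
  - intros x T HT. rewrite Cmod_minus_sym. auto.
  - apply CV; lra.
Qed.

(* Apply Goursat to [h (s0 + e^z)], which is periodic in the imaginary direction, and let
   [Re z] tend to [-oo]. *)
Lemma circle_mean_bound (h : C -> C) (s0 : C) (r M : R) :
  0 < r -> (forall z, Cmod (z - s0) <= r -> cdiff h z) ->
  (forall z, Cmod (z - s0) = r -> Cmod (h z) <= M) ->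
  Cmod (h s0) <= M.
Proof.
  intros Hr Hh HM. assert (HP := PI_RGT_0).
  (* The factor 1 gives the outer map the shape of [cdiff_affine]. *)
  set (H := fun z => h (s0 + 1 * Cexp z)%C).
  assert (MH : forall x y, Cmod (s0 + 1 * Cexp (x, y) - s0) = exp x).
  { intros x y. replace (s0 + 1 * Cexp (x, y) - s0)%C with (Cexp (x, y)) by ring. apply Cmod_Cexp. }
  assert (DH : forall x y, x <= ln r -> cdiff H (x, y)).
  { intros x y Hx. unfold H. apply (cdiff_comp (fun w => h (s0 + 1 * w)%C)); [apply cdiff_Cexp |].
    apply (cdiff_comp h); [apply cdiff_affine |]. apply Hh. rewrite MH.
    rewrite <- (exp_ln r Hr). apply exp_monotone, Hx. }
  assert (CV : forall x, x <= ln r -> contR (fun y => H (x, y))).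
  { intros x Hx y. apply continuous_vertical, cdiff_continuous, DH, Hx. }
  assert (Inv : forall rho, rho <= ln r ->
    Cint (fun y => H (rho, y)) 0 (2 * PI) = Cint (fun y => H (ln r, y)) 0 (2 * PI)).
  { intros rho Hrho.
    assert (G := goursat H rho (ln r) 0 (2 * PI) Hrho ltac:(lra) ltac:(intros; apply DH; lra)).
    unfold rect_int in G.
    rewrite (Cint_ext (fun x => H (x, 2 * PI)) (fun x => H (x, 0))) in G; auto.
    2: { intros x _. unfold H, Cexp; simpl. rewrite cos_2PI, sin_2PI, cos_0, sin_0. reflexivity. }
    set (i2 := Cint (fun y => H (ln r, y)) 0 (2 * PI)) in *.
    set (i1 := Cint (fun y => H (rho, y)) 0 (2 * PI)) in *.
    assert (E : (Ci * (i2 - i1))%C = 0).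
    { rewrite <- G. ring. }
    assert (E2 : Cmod (i2 - i1) = 0).
    { rewrite <- (Rmult_1_l (Cmod _)), <- Cmod_Ci, <- Cmod_mult, E. apply Cmod_0. }
    apply Cmod_eq_0 in E2. replace i2 with (i2 - i1 + i1)%C by ring. rewrite E2. ring. }
  apply le_epsilon. intros eps He.
  assert (C0 : continuous (T := C_UniformSpace) (U := C_UniformSpace) h s0).
  { apply cdiff_continuous, Hh. replace (s0 - s0)%C with (RtoC 0) by ring. rewrite Cmod_0. lra. }
  destruct (proj1 (continuous_C_eps_C h s0) C0 eps He) as [d [Hd Hcd]].
  (* The circle of radius exp rho is contained in the closed disc of radius r and in the disc where
     [h] differs from [h s0] by less than eps. *)
  set (rho := Rmin (ln r) (ln (d / 2))).
  assert (Hrho : rho <= ln r) by apply Rmin_l.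
  assert (Hrho2 : exp rho < d).
  { apply Rle_lt_trans with (exp (ln (d / 2))); [apply exp_monotone, Rmin_r |].
    rewrite exp_ln; lra. }
  assert (B1 : Cmod (Cint (fun y => H (ln r, y)) 0 (2 * PI)) <= M * (2 * PI - 0)).
  { apply Cint_bound; [lra | apply contR_on, CV; lra |]. intros y _. apply HM.
    rewrite MH. apply exp_ln, Hr. }
  assert (B2 : Cmod (Cint (fun y => H (rho, y) - h s0)%C 0 (2 * PI)) <= eps * (2 * PI - 0)).
  { apply Cint_bound; [lra | |].
    - intros y _. apply continuous_Cminus; [apply CV, Hrho | apply continuous_Cconst].
    - intros y _. left. apply Hcd. rewrite MH. exact Hrho2. }
  rewrite Cint_minus in B2; [| lra | apply contR_on, CV, Hrho | apply contR_on, contR_const].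
  rewrite (Inv rho Hrho), Cint_const in B2.
  assert (T := Cmod_triangle_rev (RtoC (2 * PI - 0) * h s0) (Cint (fun y => H (ln r, y)) 0 (2 * PI))).
  rewrite Cmod_minus_sym, Cmod_mult, Cmod_R, Rabs_pos_eq in T by lra.
  rewrite Rminus_0_r in *. apply Rmult_le_reg_l with (2 * PI); lra.
Qed.

(** * Almost periodic functions on a strip and their Fourier coefficients *)

Lemma in_interval_nbhd (a b : Rbar) (x : R) :
  in_interval a b x -> exists d, 0 < d /\ forall y, Rabs (y - x) <= d -> in_interval a b y.
Proof.
  intros [Ha Hb].
  assert (A : exists d, 0 < d /\ forall y, Rabs (y - x) <= d -> Rbar_lt a y).
  { destruct a as [a | |]; simpl in *.
    - exists ((x - a) / 2). split; [lra |]. intros y Hy. apply Rabs_le_between in Hy. lra.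
    - contradiction.
    - exists 1. split; [lra | auto]. }
  assert (B : exists d, 0 < d /\ forall y, Rabs (y - x) <= d -> Rbar_lt y b).
  { destruct b as [b | |]; simpl in *.
    - exists ((b - x) / 2). split; [lra |]. intros y Hy. apply Rabs_le_between in Hy. lra.
    - exists 1. split; [lra | auto].
    - contradiction. }
  destruct A as [d1 [Hd1 A]]. destruct B as [d2 [Hd2 B]].
  exists (Rmin d1 d2). split; [apply Rmin_glb_lt; auto |].
  intros y Hy. split; [apply A | apply B]; (eapply Rle_trans; [exact Hy |]);
    [apply Rmin_l | apply Rmin_r].
Qed.

Lemma in_interval_between (a b : Rbar) (x y z : R) :
  in_interval a b x -> in_interval a b z -> x <= y <= z -> in_interval a b y.
Proof.
  intros [H1 H2] [H3 H4] [H5 H6]. split.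
  - apply (Rbar_lt_le_trans a x y); [exact H1 | exact H5].
  - apply (Rbar_le_lt_trans y z b); [exact H6 | exact H4].
Qed.

Lemma in_interval_ex (a b : Rbar) : Rbar_lt a b -> exists x : R, in_interval a b x.
Proof.
  unfold in_interval. destruct a as [a | |]; destruct b as [b | |]; simpl; intros H; try contradiction.
  - exists ((a + b) / 2). lra.
  - exists (a + 1). split; [lra | auto].
  - exists (b - 1). split; [auto | lra].
  - exists 0. auto.
Qed.

Lemma AP_cdiff (al be : Rbar) (f : C -> C) (x y : R) :
  AP al be f -> in_interval al be x -> cdiff f (x, y).
Proof. intros [Ha _] Hx. apply ex_derive_cdiff, Ha. exact Hx. Qed.

Lemma shift_pair (x t tau : R) : ((x, t) + Ci * tau)%C = (x, t + tau).
Proof. unfold Ci, Cplus, Cmult, RtoC; simpl. f_equal; ring. Qed.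

Lemma AP_line (al be : Rbar) (f : C -> C) (x : R) :
  AP al be f -> in_interval al be x ->
  contR (fun t => f (x, t)) /\ TB (fun t => f (x, t)).
Proof.
  intros H Hx.
  assert (HC : contR (fun t => f (x, t))).
  { intros t. apply continuous_vertical, cdiff_continuous, (AP_cdiff al be); auto. }
  assert (HB : bohr (fun t => f (x, t))).
  { intros eps He. destruct H as [_ H].
    destruct (H eps x x He (proj1 Hx) (Rle_refl x) (proj2 Hx)) as [l [Hl Hb]].
    exists l. split; auto. intros y. destruct (Hb y) as [tau [Ht Hap]]. exists tau. split; auto.
    intros t. specialize (Hap (x, t)). rewrite shift_pair in Hap. apply Hap. simpl; lra. }
  split; auto. apply bohr_TB; auto. apply bohr_unif_cont; auto.
Qed.

(** An almost period common to the reduced strip moves any point into the rectangle [s1, s2] x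
    [0, l], which is compact. *)
Lemma AP_bounded (al be : Rbar) (f : C -> C) (s1 s2 : R) :
  AP al be f -> in_interval al be s1 -> in_interval al be s2 -> s1 <= s2 ->
  exists B, 0 < B /\ forall x y, s1 <= x <= s2 -> Cmod (f (x, y)) <= B.
Proof.
  intros H I1 I2 H12.
  assert (HI : forall x, s1 <= x <= s2 -> in_interval al be x)
    by (intros x Hx; apply (in_interval_between al be s1 x s2); auto).
  (* The inverse of [d] serves as local bound, so a lower bound for [d] from compactness is at once
     a global bound for [f]. *)
  assert (loc : forall u v, exists d : posreal, s1 <= u <= s2 -> forall x y,
     Rabs (x - u) < d -> Rabs (y - v) < d -> Cmod (f (x, y)) <= / d).
  { intros u v. destruct (classic (s1 <= u <= s2)) as [Hu | Hn].
    2: { exists (mkposreal 1 Rlt_0_1). intros; contradiction. }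
    assert (Cf := cdiff_continuous _ _ (AP_cdiff al be f u v H (HI u Hu))).
    destruct (proj1 (continuous_C_eps_C f (u, v)) Cf 1 Rlt_0_1) as [d [Hd Hf]].
    assert (Hm := Cmod_ge_0 (f (u, v))).
    assert (Hp : 0 < Rmin (d / 2) (/ (Cmod (f (u, v)) + 1))).
    { apply Rmin_glb_lt; [lra | apply Rinv_0_lt_compat; lra]. }
    exists (mkposreal _ Hp). intros _ x y Hx Hy. simpl in *.
    assert (L : Cmod (f (x, y)) <= Cmod (f (u, v)) + 1).
    { assert (D : Cmod ((x, y) - (u, v))%C < d).
      { change ((x, y) - (u, v))%C with ((x - u, y - v) : C).
        eapply Rle_lt_trans; [apply Cmod_pair_le |].
        generalize (Rmin_l (d / 2) (/ (Cmod (f (u, v)) + 1))). lra. }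
      specialize (Hf (x, y) D). generalize (Cmod_triangle_rev (f (x, y)) (f (u, v))). lra. }
    eapply Rle_trans; [exact L |].
    apply Rle_trans with (/ / (Cmod (f (u, v)) + 1)); [rewrite Rinv_inv; lra |].
    apply Rinv_le_contravar; auto. apply Rmin_r. }
  set (delta := fun u v => proj1_sig (constructive_indefinite_description _ (loc u v))).
  assert (Hdelta : forall u v, s1 <= u <= s2 -> forall x y,
     Rabs (x - u) < delta u v -> Rabs (y - v) < delta u v -> Cmod (f (x, y)) <= / delta u v).
  { intros u v. unfold delta. destruct constructive_indefinite_description; auto. }
  destruct H as [_ H].
  destruct (H 1 s1 s2 Rlt_0_1 (proj1 I1) H12 (proj2 I2)) as [l [Hl Hb]].
  destruct (compactness_value_2d s1 s2 0 l delta) as [d Hd].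
  assert (Hdp : 0 < / d) by (apply Rinv_0_lt_compat, cond_pos).
  exists (/ d + 1). split; [lra |]. intros x y Hx.
  destruct (Hb (- y)) as [tau [Ht Hap]].
  specialize (Hap (x, y) Hx). rewrite shift_pair in Hap.
  assert (L : Cmod (f (x, y + tau)) <= / d).
  { apply NNPP. intros Hn. apply (Hd x (y + tau) Hx); [lra |].
    intros [u [v [Hu [Hv [D1 [D2 D3]]]]]]. apply Hn.
    eapply Rle_trans; [apply (Hdelta u v Hu); auto |].
    apply Rinv_le_contravar; [apply cond_pos | exact D3]. }
  generalize (Cmod_triangle_rev (f (x, y)) (f (x, y + tau))).
  rewrite Cmod_minus_sym in Hap. lra.
Qed.

(** The factor of the Fourier integrand, kept analytic so that Goursat applies to its product with
    [f]; on a line it is a constant times [cis]. *)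
Definition char_factor (lam : R) (z : C) : C := Cexp (- (lam * z))%C.

Lemma char_factor_pair (lam x t : R) :
  char_factor lam (x, t) = (RtoC (exp (- lam * x)) * cis (- lam * t))%C.
Proof.
  unfold char_factor. rewrite Cexp_cis. do 2 f_equal.
  - f_equal. unfold Re, Copp, Cmult, RtoC; simpl. ring.
  - unfold Im, Copp, Cmult, RtoC; simpl. ring.
Qed.

Lemma cdiff_char_factor (lam : R) (z : C) : cdiff (char_factor lam) z.
Proof.
  assert (H : cdiff (fun w => Cexp (0 + - lam * w)%C) z)
    by (apply (cdiff_comp Cexp); [apply cdiff_affine | apply cdiff_Cexp]).
  destruct H as [p [E Hp]]. exists p. split; auto. intros w. unfold char_factor.
  replace (- (lam * w))%C with (0 + - lam * w)%C by ring.
  replace (- (lam * z))%C with (0 + - lam * z)%C by ring. apply E.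
Qed.

(** The window from -T to T is the one of length 2 * T with left end -T. *)
Lemma umean_filterlim (G : R -> C) (a : C) :
  umean G a ->
  filterlim (fun T : R => scal (V := C_R_NormedModule) (/ (2 * T))
      (RInt (V := C_R_CompleteNormedModule) G (- T) T))
    (Rbar_locally p_infty) (locally (T := C_UniformSpace) a).
Proof.
  intros [Hc HG]. intros P [eps HP].
  assert (He := cond_pos eps).
  destruct (HG (eps / 2)) as [T0 [HT0 H0]]; [lra |].
  exists T0. intros T HT. apply HP. apply C_NormedModule_mixin_compat1.
  rewrite RInt_C_Cint; [| lra | apply contR_on; auto].
  specialize (H0 (2 * T) ltac:(lra) (- T)). replace (- T + 2 * T) with T in H0 by ring.
  change (Cmod (scal (V := C_R_NormedModule) (/ (2 * T)) (Cint G (- T) T) - a) < eps).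
  replace (scal (V := C_R_NormedModule) (/ (2 * T)) (Cint G (- T) T))
    with (RtoC (/ (2 * T)) * Cint G (- T) T)%C.
  2: { unfold scal; simpl. unfold prod_scal, scal; simpl. unfold mult; simpl.
       unfold Cmult, RtoC; simpl. f_equal; ring. }
  assert (HTp : 0 < 2 * T) by lra.
  replace (RtoC (/ (2 * T)) * Cint G (- T) T - a)%C with
    (RtoC (/ (2 * T)) * (Cint G (- T) T - RtoC (2 * T) * a))%C.
  2: { rewrite RtoC_inv by lra. field. intros E. apply RtoC_inj in E. lra. }
  rewrite Cmod_mult, Cmod_R, Rabs_pos_eq by (left; apply Rinv_0_lt_compat; auto).
  apply Rle_lt_trans with (/ (2 * T) * (eps / 2 * (2 * T))).
  - apply Rmult_le_compat_l; auto. left; apply Rinv_0_lt_compat; auto.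
  - replace (/ (2 * T) * (eps / 2 * (2 * T))) with (eps / 2) by (field; lra). lra.
Qed.

(** The mean exists on one line by total boundedness, and [vertical_means_agree] carries it to all
    the others. The last clause takes the real factor of e^(-lam s) out of the mean. *)
Lemma AP_coefficients (al be : Rbar) (f : C -> C) :
  Rbar_lt al be -> AP al be f ->
  exists A : R -> C, forall lam : R,
    is_fourier_coeff al be f lam (A lam) /\
    (forall a, is_fourier_coeff al be f lam a -> a = A lam) /\
    forall x, in_interval al be x ->
      umean (fun t => f (x, t) * cis (- lam * t))%C (A lam * RtoC (exp (lam * x)))%C.
Proof.
  intros Hab H. destruct (in_interval_ex al be Hab) as [x0 Hx0].
  assert (E0 : forall lam, exists a, umean (fun t => f (x0, t) * char_factor lam (x0, t))%C a).
  { intros lam. destruct (AP_line al be f x0 H Hx0) as [HC HT].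
    destruct (TB_umean (fun t => f (x0, t) * cis (- lam * t))%C) as [a Ha].
    - apply contR_mult; [auto | apply contR_cis].
    - apply TB_mult; [auto | apply TB_cis].
    - exists (RtoC (exp (- lam * x0)) * a)%C.
      apply umean_ext with (fun t => RtoC (exp (- lam * x0)) * (f (x0, t) * cis (- lam * t)))%C.
      + intros t. rewrite char_factor_pair. ring.
      + apply umean_scal, Ha. }
  exists (fun lam => proj1_sig (constructive_indefinite_description _ (E0 lam))).
  intros lam. destruct constructive_indefinite_description as [a Ha]; simpl.
  assert (Main : forall x, in_interval al be x -> umean (fun t => f (x, t) * char_factor lam (x, t))%C a).
  { intros x Hx.
    assert (W : forall u v, in_interval al be u -> in_interval al be v -> u <= v ->
      (umean (fun t => f (u, t) * char_factor lam (u, t))%C a <->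
       umean (fun t => f (v, t) * char_factor lam (v, t))%C a)).
    { intros u v Hu Hv Huv.
      destruct (AP_bounded al be f u v H Hu Hv Huv) as [B [HB0 HB]].
      apply (vertical_means_agree (fun z => f z * char_factor lam z)%C u v
        (B * exp (Rabs lam * (Rabs u + Rabs v)))); auto.
      - intros p q Hp. apply cdiff_mult; [| apply cdiff_char_factor].
        apply (AP_cdiff al be); auto. apply (in_interval_between al be u p v); auto.
      - intros p q Hp. rewrite Cmod_mult, char_factor_pair, Cmod_mult, Cmod_cis, Rmult_1_r, Cmod_R.
        rewrite Rabs_pos_eq by (left; apply exp_pos).
        apply Rmult_le_compat; [apply Cmod_ge_0 | left; apply exp_pos | auto |].
        apply exp_monotone. eapply Rle_trans; [apply Rle_abs |].
        rewrite Rabs_mult, Rabs_Ropp. apply Rmult_le_compat_l; [apply Rabs_pos |].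
        unfold Rabs; repeat destruct Rcase_abs; lra. }
    destruct (Rle_dec x0 x) as [Hle | Hle].
    - apply (W x0 x); auto.
    - apply (W x x0); auto. lra. }
  assert (FC : is_fourier_coeff al be f lam a).
  { intros x Hx. apply (umean_filterlim (fun t => f (x, t) * char_factor lam (x, t))%C). auto. }
  split; [exact FC |]. split.
  - intros b Hb. specialize (Hb x0 Hx0). specialize (FC x0 Hx0).
    exact (filterlim_locally_unique (V := C_R_NormedModule) _ _ _ Hb FC).
  - intros x Hx. specialize (Main x Hx).
    apply umean_ext with (fun t => RtoC (exp (lam * x)) * (f (x, t) * char_factor lam (x, t)))%C.
    + intros t. rewrite char_factor_pair.
      replace (RtoC (exp (lam * x)) * (f (x, t) * (RtoC (exp (- lam * x)) * cis (- lam * t))))%C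
        with (RtoC (exp (lam * x) * exp (- lam * x)) * (f (x, t) * cis (- lam * t)))%C
        by (rewrite RtoC_mult; ring).
      rewrite <- exp_plus. replace (lam * x + - lam * x) with 0 by ring. rewrite exp_0. ring.
    + rewrite Cmult_comm. apply umean_scal, Main.
Qed.

Lemma rsum_update (g : nat -> R) (n : nat) (v : R) (N : nat) :
  (n < N)%nat -> rsum (fun j => if Nat.eqb j n then v else g j) N = rsum g N - g n + v.
Proof.
  induction N as [|N IH]; intros Hn; [lia |]. simpl.
  destruct (Nat.eq_dec n N) as [-> | Hne].
  - rewrite Nat.eqb_refl. rewrite (rsum_ext _ g); [ring |].
    intros j Hj. destruct (Nat.eqb_spec j N); [lia | auto].
  - rewrite IH by lia. destruct (Nat.eqb_spec N n); [lia | ring].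
Qed.

Lemma csum_update (g : nat -> C) (n : nat) (v : C) (N : nat) :
  (n < N)%nat -> csum (fun j => if Nat.eqb j n then v else g j) N = (csum g N - g n + v)%C.
Proof.
  induction N as [|N IH]; intros Hn; [lia |]. simpl.
  destruct (Nat.eq_dec n N) as [-> | Hne].
  - rewrite Nat.eqb_refl. rewrite (csum_ext _ g); [ring |].
    intros j Hj. destruct (Nat.eqb_spec j N); [lia | auto].
  - rewrite IH by lia. destruct (Nat.eqb_spec N n); [lia | ring].
Qed.

(** * Independence over the integers along an enumeration *)

Definition Zcomb (lam : nat -> R) (k : nat -> Z) (N : nat) : R :=
  rsum (fun j => IZR (k j) * lam j) N.

(** Expanding products of kernels produces integer combinations of exponents only, so this is the
    form in which independence enters. *)
Definition Z_independent (card : option nat) (lam : nat -> R) : Prop :=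
  forall (N : nat) (k : nat -> Z), le_card N card -> Zcomb lam k N = 0 ->
    forall j, (j < N)%nat -> k j = 0%Z.

Lemma lt_le_card (j N : nat) (card : option nat) :
  (j < N)%nat -> le_card N card -> lt_card j card.
Proof. destruct card; simpl; intros; auto; lia. Qed.

Lemma lt_card_le_S (j : nat) (card : option nat) : lt_card j card -> le_card (S j) card.
Proof. destruct card; simpl; intros; auto; lia. Qed.

Lemma fold_right_Rplus_seq (g : nat -> R) (N : nat) :
  fold_right Rplus 0 (map g (seq 0 N)) = rsum g N.
Proof.
  assert (H : forall l z, fold_right Rplus z l = fold_right Rplus 0 l + z).
  { induction l as [|a l IH]; intros z; simpl; [ring | rewrite IH; ring]. }
  induction N as [|N IH]; [reflexivity |].
  rewrite seq_S, map_app, fold_right_app, H, IH. simpl. ring.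
Qed.

(** [Q_independent] attaches rational coefficients to real numbers; this inverse of the enumeration
    translates them to positions. *)
Definition index_of (lam : nat -> R) (N : nat) (x : R) : nat :=
  epsilon (inhabits 0%nat) (fun j => (j < N)%nat /\ lam j = x).

Lemma index_of_spec (card : option nat) (lam : nat -> R) (L : R -> Prop) (N j : nat) :
  enumerates card lam L -> le_card N card -> (j < N)%nat -> index_of lam N (lam j) = j.
Proof.
  intros [Hinj _] HN Hj. unfold index_of.
  destruct (epsilon_spec (inhabits 0%nat) (fun i => (i < N)%nat /\ lam i = lam j)) as [H1 H2].
  { exists j. auto. }
  apply Hinj; auto; eapply lt_le_card; eauto.
Qed.

Lemma enumerates_NoDup (card : option nat) (lam : nat -> R) (L : R -> Prop) (N : nat) :
  enumerates card lam L -> le_card N card -> NoDup (map lam (seq 0 N)).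
Proof.
  intros [Hinj _] HN.
  assert (H : forall l, NoDup l -> (forall j, In j l -> (j < N)%nat) -> NoDup (map lam l)).
  { induction l as [|a l IH]; intros Hnd Hl; simpl; [constructor |].
    inversion Hnd as [| ? ? Ha Hnd']; subst. constructor.
    - intros Hin. apply in_map_iff in Hin. destruct Hin as [b [Eb Hb]]. apply Ha.
      replace a with b; auto. apply Hinj; auto; (eapply lt_le_card; [| exact HN]); apply Hl; simpl; auto.
    - apply IH; auto. intros j Hj. apply Hl. right; auto. }
  apply H; [apply seq_NoDup |]. intros j Hj. apply in_seq in Hj. lia.
Qed.

Lemma Q_independent_enum (card : option nat) (lam : nat -> R) (L : R -> Prop) (N : nat) (q : nat -> Q) :
  enumerates card lam L -> Q_independent L -> le_card N card ->
  rsum (fun j => Q2R (q j) * lam j) N = 0 -> forall j, (j < N)%nat -> (q j == 0)%Q.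
Proof.
  intros He Hi HN H0 j Hj.
  rewrite <- (index_of_spec card lam L N j He HN Hj).
  apply (Hi (map lam (seq 0 N)) (fun x => q (index_of lam N x))).
  - apply (enumerates_NoDup card lam L); auto.
  - intros x Hx. apply in_map_iff in Hx. destruct Hx as [i [<- Hin]]. apply in_seq in Hin.
    apply He. exists i. split; auto. eapply lt_le_card; [| exact HN]. lia.
  - unfold Qcomb. rewrite map_map, fold_right_Rplus_seq. rewrite <- H0.
    apply rsum_ext. intros i Hin. rewrite (index_of_spec card lam L N i); auto.
  - apply in_map, in_seq. lia.
Qed.

Lemma Q_independent_Z (card : option nat) (lam : nat -> R) (L : R -> Prop) :
  enumerates card lam L -> Q_independent L -> Z_independent card lam.
Proof.
  intros He Hi N k HN H0 j Hj.
  assert (E := Q_independent_enum card lam L N (fun j => inject_Z (k j)) He Hi HN).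
  simpl in E. assert (Z0 : (inject_Z (k j) == 0)%Q).
  { apply E; auto. rewrite <- H0. apply rsum_ext. intros i _. f_equal.
    unfold Q2R, inject_Z. simpl. field. }
  apply (proj1 (inject_Z_injective (k j) 0)). exact Z0.
Qed.

Lemma Zcomb_ext (lam : nat -> R) (k k' : nat -> Z) (N : nat) :
  (forall j, (j < N)%nat -> k j = k' j) -> Zcomb lam k N = Zcomb lam k' N.
Proof. intros H. apply rsum_ext. intros j Hj. now rewrite H. Qed.

Lemma Zcomb_0 (lam : nat -> R) (k : nat -> Z) (N : nat) :
  (forall j, (j < N)%nat -> k j = 0%Z) -> Zcomb lam k N = 0.
Proof.
  intros H. rewrite (Zcomb_ext lam k (fun _ => 0%Z)) by auto.
  unfold Zcomb. rewrite (rsum_ext _ (fun _ => 0)); [rewrite rsum_const; ring | intros; ring].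
Qed.

Lemma Zcomb_update (lam : nat -> R) (k : nat -> Z) (n : nat) (z : Z) (N : nat) :
  (n < N)%nat ->
  Zcomb lam (fun j => if Nat.eqb j n then z else k j) N = Zcomb lam k N + (IZR z - IZR (k n)) * lam n.
Proof.
  intros Hn. unfold Zcomb.
  rewrite (rsum_ext _ (fun j => if Nat.eqb j n then IZR z * lam n else IZR (k j) * lam j)).
  - rewrite (rsum_update (fun j => IZR (k j) * lam j)) by auto. ring.
  - intros j _. destruct (Nat.eqb_spec j n) as [-> | _]; auto.
Qed.

Lemma Zcomb_extend (lam : nat -> R) (k : nat -> Z) (N M : nat) :
  (N <= M)%nat -> Zcomb lam (fun j => if Nat.ltb j N then k j else 0%Z) M = Zcomb lam k N.
Proof.
  intros H. induction H as [|M H IH].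
  - apply Zcomb_ext. intros j Hj. apply Nat.ltb_lt in Hj. now rewrite Hj.
  - unfold Zcomb in *. simpl. rewrite IH. destruct (Nat.ltb_spec M N); [lia |]. ring.
Qed.

Lemma Zcomb_eq_single (card : option nat) (lam : nat -> R) (k : nat -> Z) (N i : nat) :
  Z_independent card lam -> le_card N card -> lt_card i card ->
  Zcomb lam k N = lam i -> forall j, (j < N)%nat -> k j = if Nat.eqb j i then 1%Z else 0%Z.
Proof.
  intros Hi HN Hic E j Hj.
  (* A length that covers both the combination and the index [i], so that their difference is a
     single relation. *)
  set (M := Nat.max N (S i)).
  assert (HM : le_card M card).
  { destruct card as [c|]; simpl in *; auto. unfold M. lia. }
  set (k0 := fun j => if Nat.ltb j N then k j else 0%Z).
  assert (Z0 : Zcomb lam (fun j => if Nat.eqb j i then (k0 i - 1)%Z else k0 j) M = 0).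
  { rewrite Zcomb_update by (unfold M; lia). unfold k0 at 1.
    rewrite Zcomb_extend by (unfold M; lia). rewrite E, minus_IZR. ring. }
  assert (R0 := Hi M _ HM Z0 j ltac:(unfold M; lia)). simpl in R0.
  destruct (Nat.eqb_spec j i) as [-> | Hne].
  - unfold k0 in R0. apply Nat.ltb_lt in Hj. rewrite Hj in R0. lia.
  - unfold k0 in R0. apply Nat.ltb_lt in Hj. rewrite Hj in R0. exact R0.
Qed.

Lemma Z_independent_neq_0 (card : option nat) (lam : nat -> R) (i : nat) :
  Z_independent card lam -> lt_card i card -> lam i <> 0.
Proof.
  intros Hi Hc E.
  assert (H := Hi (S i) (fun j => if Nat.eqb j i then 1%Z else 0%Z) (lt_card_le_S _ _ Hc)).
  specialize (H ltac:(rewrite (Zcomb_update lam (fun _ => 0%Z)), Zcomb_0, E by (auto; lia); ring) i ltac:(lia)).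
  simpl in H. rewrite Nat.eqb_refl in H. discriminate.
Qed.

(** * Products of Fejer kernels *)

(** The Fejer kernel of order m, with coefficient 1 - |k| / (m + 1) at e^(ikx), left as a double
    sum: this is visibly a squared modulus, and it expands directly into characters. *)
Definition fejer (m : nat) (x : R) : C :=
  (RtoC (/ INR (S m)) * csum (fun a => csum (fun b => cis ((INR a - INR b) * x)) (S m)) (S m))%C.

Lemma csum_conj (f : nat -> C) (n : nat) : Cconj (csum f n) = csum (fun j => Cconj (f j)) n.
Proof.
  induction n as [|n IH]; simpl; [unfold Cconj; simpl; now rewrite Ropp_0 |].
  rewrite <- IH. unfold Cconj, Cplus; simpl. f_equal. ring.
Qed.

Lemma fejer_nonneg (m : nat) (x : R) : exists r, 0 <= r /\ fejer m x = RtoC r.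
Proof.
  assert (Hp : 0 < INR (S m)) by (apply lt_0_INR; lia).
  exists (/ INR (S m) * Cmod (csum (fun a => cis (INR a * x)) (S m)) ^ 2). split.
  - apply Rmult_le_pos; [left; apply Rinv_0_lt_compat; auto | apply pow2_ge_0].
  - unfold fejer. rewrite RtoC_mult, Cmod2_conj, csum_conj. f_equal.
    rewrite (csum_ext _ (fun a => csum (fun b => Cconj (cis (INR b * x))) (S m) * cis (INR a * x))%C).
    + rewrite csum_scal. ring.
    + intros a _. rewrite Cmult_comm, <- csum_scal. apply csum_ext. intros b _.
      rewrite Cconj_cis, <- cis_plus. f_equal. ring.
Qed.

(** The phases [th] will be the arguments of the coefficients, so that the contributions of the
    exponents add up without cancellation. *)
Fixpoint fejer_prod (m : nat) (lam th : nat -> R) (n : nat) (t : R) : C :=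
  match n with
  | O => RtoC 1
  | S j => (fejer_prod m lam th j t * fejer m (lam j * t + th j))%C
  end.

Lemma fejer_prod_nonneg (m : nat) (lam th : nat -> R) (n : nat) (t : R) :
  exists r, 0 <= r /\ fejer_prod m lam th n t = RtoC r.
Proof.
  induction n as [|n [r [Hr IH]]]; simpl.
  - exists 1. split; [lra | auto].
  - destruct (fejer_nonneg m (lam n * t + th n)) as [s [Hs E]].
    exists (r * s). split; [apply Rmult_le_pos; auto |]. now rewrite IH, E, RtoC_mult.
Qed.

(** The diagonal has m + 1 entries and the next one m: their ratio is the weight m / (m + 1) of the
    Fejer kernel at its first frequency. *)
Lemma double_sum_near_diagonal (X Y : C) (m : nat) :
  csum (fun a => csum (fun b => if Nat.eqb a b then X else if Nat.eqb b (S a) then Y else RtoC 0) (S m)) (S m)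
  = (RtoC (INR (S m)) * X + RtoC (INR m) * Y)%C.
Proof.
  rewrite (csum_ext _ (fun a => X + if Nat.ltb a m then Y else 0)%C).
  - rewrite csum_plus, csum_const. f_equal. simpl csum. rewrite Nat.ltb_irrefl.
    rewrite (csum_ext _ (fun _ => Y)).
    + rewrite csum_const. ring.
    + intros j Hj. apply Nat.ltb_lt in Hj. now rewrite Hj.
  - intros a Ha.
    rewrite (csum_ext _ (fun b => (if Nat.eqb b a then X else 0) + (if Nat.eqb b (S a) then Y else 0))%C).
    + rewrite csum_plus. f_equal.
      * rewrite (csum_single _ _ a); [now rewrite Nat.eqb_refl | auto |].
        intros j _ Hne. destruct (Nat.eqb_spec j a); [contradiction | auto].
      * destruct (Nat.ltb_spec a m) as [Hlt | Hge].
        -- rewrite (csum_single _ _ (S a)); [now rewrite Nat.eqb_refl | lia |].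
           intros j _ Hne. destruct (Nat.eqb_spec j (S a)); [contradiction | auto].
        -- apply csum_0. intros j Hj. destruct (Nat.eqb_spec j (S a)); [lia | auto].
    + intros b _. destruct (Nat.eqb_spec a b) as [-> | Hne].
      * rewrite Nat.eqb_refl. destruct (Nat.eqb_spec b (S b)); [lia |]. ring.
      * destruct (Nat.eqb_spec b a); [congruence |]. ring.
Qed.

(** The predicted mean of f times the first n kernels at a frequency x in which the first n
    exponents do not occur: beyond the mean of f, the kernels contribute only at x = 0. *)
Definition fejer_value (m : nat) (lam th : nat -> R) (A : R -> C) (n : nat) (x : R) : C :=
  (A x + if Req_EM_T x 0
         then RtoC (INR m / INR (S m)) * csum (fun j => cis (- th j) * A (lam j)) n else 0)%C.

(* Expanding the last kernel shifts [x] by multiples of [lam n]; by independence the only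
   shift leading from [x] to an exponent is the one from [0] to [lam n]. *)
Lemma fejer_prod_mean (card : option nat) (lam th : nat -> R) (m : nat) (f : R -> C) (A : R -> C) (N : nat) :
  Z_independent card lam -> le_card N card ->
  (forall x, umean (fun t => f t * cis (- x * t))%C (A x)) ->
  (forall x, A x <> 0 -> x = 0 \/ exists i, lt_card i card /\ x = lam i) ->
  forall n, (n <= N)%nat -> forall k : nat -> Z, (forall j, (j < n)%nat -> k j = 0%Z) ->
  umean (fun t => f t * fejer_prod m lam th n t * cis (- Zcomb lam k N * t))%C
    (fejer_value m lam th A n (Zcomb lam k N)).
Proof.
  intros Hi HN HA Hsupp. induction n as [|n IH]; intros Hn k Hk.
  - simpl. apply umean_ext with (fun t => f t * cis (- Zcomb lam k N * t))%C; [intros; ring |].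
    unfold fejer_value. simpl csum.
    replace (A (Zcomb lam k N) + _)%C with (A (Zcomb lam k N)); [apply HA |].
    destruct Req_EM_T; ring.
  - assert (Hp : INR (S m) <> 0) by (apply not_0_INR; lia).
    set (x := Zcomb lam k N).
    set (y := fun a b : nat => x - (INR a - INR b) * lam n).
    (* The term (a, b) of the last kernel moves the frequency x to [y a b], whose coefficient at
       [lam n] is b - a. *)
    set (ky := fun (a b : nat) (j : nat) => if Nat.eqb j n then (Z.of_nat b - Z.of_nat a)%Z else k j).
    assert (Ey : forall a b, Zcomb lam (ky a b) N = y a b).
    { intros a b. unfold ky. rewrite Zcomb_update by lia. fold x. unfold y.
      rewrite (Hk n) by lia. rewrite minus_IZR, <- !INR_IZR_INZ. ring. }
    assert (Hlamn : lt_card n card) by (apply (lt_le_card n N); [lia | auto]).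
    (* Off the diagonal [y a b] is nonzero, so it carries mass only if it is an exponent;
       independence then forces b = a + 1 and x = 0. *)
    assert (Val : forall a b, (cis ((INR a - INR b) * th n) * fejer_value m lam th A n (y a b))%C =
      if Nat.eqb a b then fejer_value m lam th A n x
      else if Nat.eqb b (S a) then (if Req_EM_T x 0 then cis (- th n) * A (lam n) else 0)%C else 0).
    { intros a b. destruct (Nat.eqb_spec a b) as [-> | Hab].
      - unfold y. rewrite Rminus_diag, !Rmult_0_l, Rminus_0_r, cis_0. ring.
      - assert (Hky : ky a b n <> 0%Z) by (unfold ky; rewrite Nat.eqb_refl; lia).
        assert (Hy0 : y a b <> 0).
        { rewrite <- Ey. intros E. apply Hky. apply (Hi N _ HN E). lia. }
        unfold fejer_value at 1. destruct (Req_EM_T (y a b) 0) as [E | _]; [contradiction |].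
        rewrite Cplus_0_r.
        destruct (classic (A (y a b) = 0)) as [Az | Anz].
        + rewrite Az. destruct (Nat.eqb_spec b (S a)) as [-> | _]; [| ring].
          destruct (Req_EM_T x 0) as [E0 | _]; [| ring].
          assert (El : y a (S a) = lam n) by (unfold y; rewrite E0, S_INR; ring).
          rewrite <- El, Az. ring.
        + destruct (Hsupp _ Anz) as [E | [i [Hic Ei]]]; [contradiction |].
          assert (S1 := Zcomb_eq_single card lam (ky a b) N i Hi HN Hic).
          rewrite Ey in S1. specialize (S1 Ei).
          assert (Sn := S1 n ltac:(lia)).
          destruct (Nat.eqb_spec n i) as [<- | Hni]; [| contradiction].
          unfold ky in Sn. rewrite Nat.eqb_refl in Sn.
          assert (Hb : b = S a) by lia. subst b. rewrite Nat.eqb_refl.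
          destruct (Req_EM_T x 0) as [E0 | En0].
          * rewrite Ei. f_equal. f_equal. rewrite S_INR. ring.
          * exfalso. apply En0. unfold x. apply Zcomb_0. intros j Hj.
            specialize (S1 j Hj). unfold ky in S1.
            destruct (Nat.eqb_spec j n) as [E | _]; [rewrite E; apply Hk; lia | exact S1]. }
    apply umean_ext with (fun t => RtoC (/ INR (S m)) * csum (fun a => csum (fun b =>
      cis ((INR a - INR b) * th n) * (f t * fejer_prod m lam th n t * cis (- y a b * t))) (S m)) (S m))%C.
    + intros t. simpl fejer_prod. unfold fejer.
      set (P := (f t * fejer_prod m lam th n t * cis (- x * t))%C).
      replace (f t * (fejer_prod m lam th n t * _) * cis (- x * t))%C with
        (RtoC (/ INR (S m)) * (P * csum (fun a => csum (fun b => cis ((INR a - INR b) * (lam n * t + th n))) (S m)) (S m)))%C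
        by (unfold P; ring).
      f_equal. rewrite <- csum_scal. apply csum_ext. intros a _.
      rewrite <- csum_scal. apply csum_ext. intros b _. unfold P, y.
      replace (- (x - (INR a - INR b) * lam n) * t) with (- x * t + (INR a - INR b) * (lam n * t)) by ring.
      replace ((INR a - INR b) * (lam n * t + th n)) with ((INR a - INR b) * (lam n * t) + (INR a - INR b) * th n) by ring.
      rewrite !cis_plus. ring.
    + replace (fejer_value m lam th A (S n) x) with
        (RtoC (/ INR (S m)) * csum (fun a => csum (fun b =>
          cis ((INR a - INR b) * th n) * fejer_value m lam th A n (y a b)) (S m)) (S m))%C.
      * apply umean_scal.
        apply (umean_csum (fun a t => csum (fun b =>
          cis ((INR a - INR b) * th n) * (f t * fejer_prod m lam th n t * cis (- y a b * t)))%C (S m))).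
        intros a _.
        apply (umean_csum (fun b t =>
          cis ((INR a - INR b) * th n) * (f t * fejer_prod m lam th n t * cis (- y a b * t)))%C).
        intros b _. apply umean_scal. rewrite <- Ey. apply IH; [lia |].
        intros j Hj. unfold ky. destruct (Nat.eqb_spec j n); [lia |]. apply Hk. lia.
      * rewrite (csum_ext _ (fun a => csum (fun b => if Nat.eqb a b then fejer_value m lam th A n x
          else if Nat.eqb b (S a) then (if Req_EM_T x 0 then cis (- th n) * A (lam n) else 0)%C else 0) (S m)))
          by (intros a _; apply csum_ext; intros b _; apply Val).
        rewrite double_sum_near_diagonal. unfold fejer_value.
        destruct (Req_EM_T x 0) as [E0 | En0]; simpl csum.
        -- unfold Rdiv. rewrite RtoC_mult, RtoC_inv by auto. field.
           intros E. apply RtoC_inj in E. auto.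
        -- rewrite RtoC_inv by auto. field. intros E. apply RtoC_inj in E. auto.
Qed.

(** * Coefficients of a bounded function with independent exponents *)

Lemma polar_form (z : C) : exists th, (cis (- th) * z)%C = RtoC (Cmod z).
Proof.
  destruct (classic (z = 0)) as [-> | Hz].
  { exists 0. rewrite Cmod_0. ring. }
  assert (Hp : 0 < Cmod z) by (apply Cmod_gt_0; exact Hz).
  assert (Hsq : Re z ^ 2 + Im z ^ 2 = Cmod z ^ 2) by (rewrite Cmod2_alt; reflexivity).
  set (c := Re z / Cmod z). set (s := Im z / Cmod z).
  assert (Hcs : c ^ 2 + s ^ 2 = 1).
  { unfold c, s. replace ((Re z / Cmod z) ^ 2 + (Im z / Cmod z) ^ 2) with ((Re z ^ 2 + Im z ^ 2) / Cmod z ^ 2) by (field; lra).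
    rewrite Hsq. field. lra. }
  assert (Hc : -1 <= c <= 1) by nra.
  assert (Hth : exists th, cos th = c /\ sin th = s).
  { destruct (Rle_dec 0 s) as [Hs | Hs].
    - exists (acos c). split; [apply cos_acos, Hc |]. rewrite sin_acos by exact Hc.
      apply sqrt_lem_1; unfold Rsqr; nra.
    - exists (- acos c). rewrite cos_neg, sin_neg. split; [apply cos_acos, Hc |].
      rewrite sin_acos by exact Hc.
      rewrite (sqrt_lem_1 _ (- s)); unfold Rsqr; nra. }
  destruct Hth as [th [Ec Es]]. exists th.
  assert (E1 : Re z = c * Cmod z) by (unfold c; field; lra).
  assert (E2 : Im z = s * Cmod z) by (unfold s; field; lra).
  rewrite (surjective_pairing z) at 1. change (fst z) with (Re z). change (snd z) with (Im z).
  unfold cis. rewrite cos_neg, sin_neg, Ec, Es, E1, E2.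
  unfold Cmult, RtoC; simpl. f_equal; [| ring].
  replace (c * (c * Cmod z) - - s * (s * Cmod z)) with ((c ^ 2 + s ^ 2) * Cmod z) by ring.
  rewrite Hcs. ring.
Qed.

(** The kernel product K has mean 1 and f K is bounded by B K, so the mean of f K, which is a0 + m /
    (m + 1) times the sum, is at most B; then m grows. The constant term a0 is what the proof of
    Kronecker's theorem uses. *)
Lemma fourier_sum_le_sup (card : option nat) (lam : nat -> R) (f : R -> C) (A : R -> C) (B a0 : R) (n : nat) :
  Z_independent card lam -> le_card n card ->
  (forall x, umean (fun t => f t * cis (- x * t))%C (A x)) ->
  (forall x, A x <> 0 -> x = 0 \/ exists i, lt_card i card /\ x = lam i) ->
  A 0 = RtoC a0 -> 0 <= a0 -> (forall t, Cmod (f t) <= B) ->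
  a0 + rsum (fun j => Cmod (A (lam j))) n <= B.
Proof.
  intros Hi Hn HA Hs H0 Ha0 HB.
  assert (HB0 : 0 <= B) by (eapply Rle_trans; [apply Cmod_ge_0 | apply (HB 0)]).
  destruct (choice (fun j th => (cis (- th) * A (lam j))%C = RtoC (Cmod (A (lam j))))) as [th Hth].
  { intros j. apply polar_form. }
  set (S0 := rsum (fun j => Cmod (A (lam j))) n).
  assert (HS0 : 0 <= S0) by (apply rsum_nonneg; intros; apply Cmod_ge_0).
  assert (Z0 : Zcomb lam (fun _ => 0%Z) n = 0) by (apply Zcomb_0; auto).
  assert (Main : forall m, a0 + INR m / INR (S m) * S0 <= B).
  { intros m.
    assert (M1 := fejer_prod_mean card lam th m f A n Hi Hn HA Hs n (Nat.le_refl n) (fun _ => 0%Z) (fun _ _ => eq_refl)).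
    rewrite Z0 in M1. unfold fejer_value in M1. destruct (Req_EM_T 0 0) as [_ | H]; [| congruence].
    rewrite (csum_ext _ (fun j => RtoC (Cmod (A (lam j))))) in M1 by auto.
    assert (ES : csum (fun j => RtoC (Cmod (A (lam j)))) n = RtoC S0).
    { unfold S0. clear. induction n as [|n IH]; simpl; [reflexivity | now rewrite IH, RtoC_plus]. }
    rewrite ES, H0, <- RtoC_mult, <- RtoC_plus in M1.
    (* The Fourier means of the constant function 1; applied to it, [fejer_prod_mean] computes the
       mean of the kernel product. *)
    set (A1 := fun x : R => if Req_EM_T x 0 then RtoC 1 else RtoC 0).
    assert (M2 := fejer_prod_mean card lam th m (fun _ => RtoC 1) A1 n Hi Hn).
    specialize (M2 ltac:(intros x; unfold A1; destruct (Req_EM_T x 0) as [-> | Hx];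
      [ apply umean_ext with (fun _ => RtoC 1); [intros t; rewrite Ropp_0, Rmult_0_l, cis_0; ring | apply umean_const]
      | apply umean_ext with (fun t => cis (- x * t)); [intros; ring | apply umean_cis; lra ] ])).
    specialize (M2 ltac:(intros x; unfold A1; destruct (Req_EM_T x 0); [auto | congruence])).
    specialize (M2 n (Nat.le_refl n) (fun _ => 0%Z) (fun _ _ => eq_refl)).
    rewrite Z0 in M2. unfold fejer_value in M2. destruct (Req_EM_T 0 0) as [_ | H]; [| congruence].
    rewrite (csum_0 (fun j => cis (- th j) * A1 (lam j))%C) in M2.
    2: { intros j Hj. unfold A1. destruct (Req_EM_T (lam j) 0) as [E | _]; [| ring].
         exfalso. revert E. apply (Z_independent_neq_0 card); auto. eapply lt_le_card; eauto. }
    rewrite Cmult_0_r, Cplus_0_r in M2.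
    replace (A1 0) with (RtoC 1) in M2 by (unfold A1; destruct (Req_EM_T 0 0); congruence).
    assert (Bd := umean_bound_fun _ _ _ _ B HB0 M1 M2).
    change (Re 1) with 1 in Bd. rewrite Cmod_R in Bd.
    assert (Hq : 0 <= INR m / INR (S m)).
    { apply Rmult_le_pos; [apply pos_INR |]. left. apply Rinv_0_lt_compat, lt_0_INR. lia. }
    assert (Hq2 : 0 <= INR m / INR (S m) * S0) by (apply Rmult_le_pos; auto).
    rewrite Rabs_pos_eq, Rmult_1_r in Bd by lra. apply Bd.
    intros t. destruct (fejer_prod_nonneg m lam th n t) as [r [Hr E]]. rewrite E.
    rewrite !Cmod_mult, Cmod_cis, Cmod_R, Rabs_pos_eq by auto.
    rewrite Ropp_0, Rmult_0_l, cis_0, Cmult_1_l, Cmult_1_r, Rmult_1_r.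
    apply Rmult_le_compat_r; auto. }
  apply le_epsilon. intros eps He.
  (* The weight m / (m + 1) loses S0 / (m + 1), which is at most eps for this m. *)
  destruct (INR_large (S0 / eps)) as [m Hm]. specialize (Hm m (Nat.le_refl m)). specialize (Main m).
  assert (Hp : 0 < INR (S m)) by (apply lt_0_INR; lia).
  assert (E : INR m / INR (S m) * S0 = S0 - S0 / INR (S m)) by (rewrite S_INR; field; generalize (pos_INR m); lra).
  assert (L : S0 / INR (S m) <= eps).
  { apply Rmult_le_reg_r with (INR (S m)); auto. unfold Rdiv. rewrite Rmult_assoc, Rinv_l, Rmult_1_r by lra.
    rewrite S_INR. replace S0 with (S0 / eps * eps) by (field; lra).
    assert (S0 / eps * eps <= INR m * eps) by (apply Rmult_le_compat_r; lra). lra. }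
  lra.
Qed.

(** * Kronecker's theorem *)

Definition kron (x : R) : C := if Req_EM_T x 0 then RtoC 1 else RtoC 0.

Lemma kron_0 : kron 0 = RtoC 1.
Proof. unfold kron. destruct (Req_EM_T 0 0); congruence. Qed.

Lemma kron_neq (x : R) : x <> 0 -> kron x = RtoC 0.
Proof. intros H. unfold kron. destruct (Req_EM_T x 0); congruence. Qed.

Lemma umean_kron (x : R) : umean (fun t => cis (x * t)) (kron x).
Proof.
  unfold kron. destruct (Req_EM_T x 0) as [-> | Hx]; [| apply umean_cis; auto].
  apply umean_ext with (fun _ => RtoC 1); [| apply umean_const].
  intros t. now rewrite Rmult_0_l, cis_0.
Qed.

(** By the parallelogram identity the squares of |1 + cis x| and |cis x - 1| add up to 4, and 4 -
    eps^2 <= (2 - eps^2 / 4)^2. *)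
Lemma unit_circle_gap (x : R) (eps : R) :
  0 < eps -> eps < Cmod (cis x - 1) -> Cmod (1 + cis x) <= 2 - eps ^ 2 / 4.
Proof.
  intros He H.
  assert (P : Cmod (1 + cis x) ^ 2 + Cmod (cis x - 1) ^ 2 = 4).
  { rewrite !Cmod2_alt. unfold cis, Cplus, Cminus, Copp, Re, Im, RtoC; simpl.
    generalize (sin2_cos2 x). unfold Rsqr. intros E.
    transitivity (2 + 2 * (sin x * sin x + cos x * cos x)); [ring | rewrite E; ring]. }
  assert (H1 := Cmod_ge_0 (1 + cis x)).
  assert (H2 : Cmod (cis x - 1) <= 2).
  { eapply Rle_trans; [apply Cmod_triangle |]. rewrite Cmod_opp, Cmod_cis, Cmod_1. lra. }
  apply Rnot_lt_le. intros Hc. simpl in *. rewrite !Rmult_1_r in *.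
  assert (Q1 : eps * eps < Cmod (cis x - 1) * Cmod (cis x - 1)) by nra.
  assert (Q2 : eps * eps < 4) by nra.
  set (e2 := eps * eps) in *. set (u := Cmod (1 + cis x)) in *.
  assert ((2 - e2 / 4) * (2 - e2 / 4) <= u * u) by (apply Rmult_le_compat; lra).
  assert (0 <= e2 * e2) by apply Rle_0_sqr. lra.
Qed.

Lemma kronecker (card : option nat) (lam phi : nat -> R) (n : nat) (eps : R) :
  Z_independent card lam -> le_card n card -> 0 < eps ->
  exists t, forall j, (j < n)%nat -> Cmod (cis (lam j * t) - cis (phi j)) <= eps.
Proof.
  intros Hi Hn He. apply NNPP. intros Hno.
  assert (Hj : forall t, exists j, (j < n)%nat /\ eps < Cmod (cis (lam j * t) - cis (phi j))).
  { intros t. apply NNPP. intros Hc. apply Hno. exists t. intros j Hj. apply Rnot_lt_le.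
    intros Hlt. apply Hc. exists j. auto. }
  set (f := fun t => (1 + csum (fun j => cis (- phi j) * cis (lam j * t)) n)%C).
  (* The Fourier means of [f]: 1 at 0, and of modulus 1 at each of the first n exponents. *)
  set (A := fun x => (kron x + csum (fun j => cis (- phi j) * kron (lam j - x)%R) n)%C).
  assert (HA : forall x, umean (fun t => f t * cis (- x * t))%C (A x)).
  { intros x. apply umean_ext with (fun t => cis (- x * t) +
      csum (fun j => cis (- phi j) * cis ((lam j - x) * t)) n)%C.
    - intros t. unfold f. rewrite (csum_ext _ (fun j => cis (- x * t) * (cis (- phi j) * cis (lam j * t)))%C).
      + rewrite csum_scal. ring.
      + intros j _. replace ((lam j - x) * t) with (lam j * t + - x * t) by ring. rewrite cis_plus. ring.
    - apply umean_plus.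
      + replace (kron x) with (kron (- x)); [apply umean_kron |]. unfold kron.
        destruct (Req_EM_T (- x) 0), (Req_EM_T x 0); auto; lra.
      + apply (umean_csum (fun j t => cis (- phi j) * cis ((lam j - x) * t))%C).
        intros j _. apply umean_scal, umean_kron. }
  assert (Hs : forall x, A x <> 0 -> x = 0 \/ exists i, lt_card i card /\ x = lam i).
  { intros x Hx. apply NNPP. intros Hc. apply Hx. unfold A, kron.
    destruct (Req_EM_T x 0) as [E | _]; [exfalso; auto |].
    rewrite csum_0; [ring |]. intros j Hjn.
    destruct (Req_EM_T (lam j - x) 0) as [E | _]; [| ring].
    exfalso. apply Hc. right. exists j. split; [eapply lt_le_card; eauto | lra]. }
  assert (A0 : A 0 = RtoC 1).
  { unfold A. rewrite kron_0, csum_0; [ring |]. intros j Hjn. rewrite kron_neq; [ring |].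
    rewrite Rminus_0_r. apply (Z_independent_neq_0 card); auto. eapply lt_le_card; eauto. }
  assert (Aj : forall j, (j < n)%nat -> Cmod (A (lam j)) = 1).
  { intros j Hjn. unfold A. rewrite kron_neq.
    2: { apply (Z_independent_neq_0 card); auto. eapply lt_le_card; eauto. }
    rewrite (csum_single _ _ j); auto.
    - rewrite Rminus_diag, kron_0, Cplus_0_l, Cmult_1_r. apply Cmod_cis.
    - intros i Hin Hne. rewrite kron_neq; [ring |]. intros E.
      assert (Ei : Zcomb lam (fun l => if Nat.eqb l i then 1%Z else 0%Z) n = lam j).
      { rewrite (Zcomb_update lam (fun _ => 0%Z)), Zcomb_0 by auto. lra. }
      assert (Q := Zcomb_eq_single card lam _ n j Hi Hn (lt_le_card _ _ _ Hjn Hn) Ei i Hin).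
      simpl in Q. rewrite Nat.eqb_refl in Q. destruct (Nat.eqb_spec i j); [contradiction | discriminate]. }
  (* At each t some phase misses its target; this term, paired with the constant 1, loses eps^2 / 4,
     and the others are bounded by 1. *)
  assert (Bd : forall t, Cmod (f t) <= 1 + INR n - eps ^ 2 / 4).
  { intros t. destruct (Hj t) as [j [Hjn Hlt]].
    set (u := fun j => (cis (- phi j) * cis (lam j * t))%C).
    assert (Eu : forall j, u j = cis (lam j * t - phi j)).
    { intros i. unfold u. rewrite <- cis_plus. f_equal. ring. }
    assert (E : f t = ((1 + u j) + csum (fun i => if Nat.eqb i j then 0 else u i)%C n)%C).
    { unfold f. rewrite (csum_update u) by auto. fold u. ring. }
    rewrite E. eapply Rle_trans; [apply Cmod_triangle |].
    assert (G : Cmod (1 + u j) <= 2 - eps ^ 2 / 4).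
    { rewrite Eu. apply unit_circle_gap; auto.
      replace (cis (lam j * t - phi j) - 1)%C with (cis (- phi j) * (cis (lam j * t) - cis (phi j)))%C.
      - rewrite Cmod_mult, Cmod_cis, Rmult_1_l. exact Hlt.
      - rewrite <- cis_0. replace 0 with (- phi j + phi j) by ring.
        replace (lam j * t - phi j) with (- phi j + lam j * t) by ring. rewrite !cis_plus. ring. }
    assert (T : Cmod (csum (fun i => if Nat.eqb i j then 0 else u i)%C n) <= INR n - 1).
    { eapply Rle_trans; [apply Cmod_csum |].
      apply Rle_trans with (rsum (fun i => if Nat.eqb i j then 0 else 1) n).
      - apply rsum_le. intros i _. destruct (Nat.eqb i j); [rewrite Cmod_0; lra |].
        rewrite Eu, Cmod_cis. lra.
      - rewrite (rsum_update (fun _ => 1)) by auto. rewrite rsum_const. lra. }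
    lra. }
  assert (F := fourier_sum_le_sup card lam f A _ 1 n Hi Hn HA Hs A0 ltac:(lra) Bd).
  rewrite (rsum_ext _ (fun _ => 1)), rsum_const in F by auto.
  assert (0 < eps ^ 2) by (apply pow_lt; auto). lra.
Qed.

(** * Absolutely convergent series of complex numbers *)

Definition csums (c : nat -> C) (s : C) : Prop :=
  forall eps, 0 < eps -> exists n0, forall n, (n0 <= n)%nat -> Cmod (csum c n - s) <= eps.

Lemma csums_ext (c d : nat -> C) (s : C) : (forall j, c j = d j) -> csums c s -> csums d s.
Proof.
  intros E H eps He. destruct (H eps He) as [n0 Hn]. exists n0. intros n Hle.
  rewrite <- (csum_ext c d) by auto. auto.
Qed.

Lemma csums_plus (c d : nat -> C) (s t : C) :
  csums c s -> csums d t -> csums (fun j => c j + d j)%C (s + t)%C.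
Proof.
  intros Hc Hd eps He.
  destruct (Hc (eps / 2)) as [n1 H1]; [lra |]. destruct (Hd (eps / 2)) as [n2 H2]; [lra |].
  exists (n1 + n2)%nat. intros n Hn. rewrite csum_plus.
  replace (_ - _)%C with ((csum c n - s) + (csum d n - t))%C by ring.
  eapply Rle_trans; [apply Cmod_triangle |].
  specialize (H1 n ltac:(lia)). specialize (H2 n ltac:(lia)). lra.
Qed.

Lemma csums_scal (k : C) (c : nat -> C) (s : C) :
  csums c s -> csums (fun j => k * c j)%C (k * s)%C.
Proof.
  intros Hc eps He. assert (Hk := Cmod_ge_0 k).
  destruct (Hc (eps / (Cmod k + 1))) as [n0 H0]; [apply Rdiv_lt_0_compat; lra |].
  exists n0. intros n Hn. rewrite csum_scal.
  replace (_ - _)%C with (k * (csum c n - s))%C by ring. rewrite Cmod_mult.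
  apply Rle_trans with ((Cmod k + 1) * (eps / (Cmod k + 1))).
  - apply Rmult_le_compat; auto; try apply Cmod_ge_0. lra.
  - right. field. lra.
Qed.

Lemma csums_csum (c : nat -> nat -> C) (s : nat -> C) (K : nat) :
  (forall k, (k < K)%nat -> csums (c k) (s k)) ->
  csums (fun j => csum (fun k => c k j) K) (csum s K).
Proof.
  induction K as [|K IH]; simpl; intros H.
  - intros eps He. exists 0%nat. intros n _. rewrite csum_0 by auto.
    replace (_ - _)%C with (RtoC 0) by ring. rewrite Cmod_0. lra.
  - apply (csums_plus (fun j => csum (fun k => c k j) K)); auto.
Qed.

Lemma csums_bound (c : nat -> C) (s : C) (B : R) :
  csums c s -> (forall n, Cmod (csum c n) <= B) -> Cmod s <= B.
Proof.
  intros Hc HB. apply le_epsilon. intros eps He.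
  destruct (Hc eps He) as [n0 H0]. specialize (H0 n0 (Nat.le_refl n0)). specialize (HB n0).
  generalize (Cmod_triangle_rev s (csum c n0)). rewrite Cmod_minus_sym. lra.
Qed.

Definition rsum_bounded (r : nat -> R) : Prop := exists B, forall n, rsum r n <= B.

Lemma rsum_incr (r : nat -> R) (m n : nat) :
  (forall j, 0 <= r j) -> (m <= n)%nat -> rsum r m <= rsum r n.
Proof. intros Hr H. induction H as [|n H IH]; simpl; [lra | specialize (Hr n); lra]. Qed.

Lemma rsum_tail_small (r : nat -> R) :
  (forall j, 0 <= r j) -> rsum_bounded r ->
  forall eps, 0 < eps -> exists m, forall n, (m <= n)%nat -> rsum r n - rsum r m <= eps.
Proof.
  intros Hr [B HB] eps He.
  destruct (completeness (fun x => exists n, x = rsum r n)) as [S [U L]].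
  - exists B. intros x [n ->]. auto.
  - exists (rsum r 0), 0%nat. auto.
  - assert (E : exists m, S - eps < rsum r m).
    { apply NNPP. intros Hn. assert (S <= S - eps); [| lra]. apply L. intros x [n ->].
      apply Rnot_lt_le. intros Hlt. apply Hn. eauto. }
    destruct E as [m Hm]. exists m. intros n _.
    assert (rsum r n <= S) by (apply U; eauto). lra.
Qed.

Lemma csum_tail (c : nat -> C) (r : nat -> R) (m n : nat) :
  (forall j, Cmod (c j) <= r j) -> (m <= n)%nat ->
  Cmod (csum c n - csum c m) <= rsum r n - rsum r m.
Proof.
  intros Hc H. induction H as [|n H IH].
  - replace (_ - _)%C with (RtoC 0) by ring. rewrite Cmod_0. lra.
  - simpl. replace (_ - _)%C with ((csum c n - csum c m) + c n)%C by ring.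
    eapply Rle_trans; [apply Cmod_triangle |]. specialize (Hc n). lra.
Qed.

Lemma csums_tail (c : nat -> C) (r : nat -> R) (s : C) (m : nat) (eps : R) :
  (forall j, Cmod (c j) <= r j) -> csums c s ->
  (forall n, (m <= n)%nat -> rsum r n - rsum r m <= eps) -> Cmod (s - csum c m) <= eps.
Proof.
  intros Hc Hs Hm. apply le_epsilon. intros e He. destruct (Hs e He) as [n0 H0].
  set (n := (n0 + m)%nat). specialize (H0 n ltac:(unfold n; lia)).
  assert (T := csum_tail c r m n Hc ltac:(unfold n; lia)).
  specialize (Hm n ltac:(unfold n; lia)).
  eapply Rle_trans; [apply (Cmod_triangle_minus _ (csum c n)) |].
  rewrite Cmod_minus_sym. lra.
Qed.

Lemma csums_exists (c : nat -> C) (r : nat -> R) :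
  (forall j, Cmod (c j) <= r j) -> rsum_bounded r -> exists s, csums c s.
Proof.
  intros Hc Hb.
  assert (Hr : forall j, 0 <= r j) by (intros j; eapply Rle_trans; [apply Cmod_ge_0 | apply Hc]).
  destruct (C_complete (csum c)) as [s Hs]; [| exists s; exact Hs].
  intros eps He. destruct (rsum_tail_small r Hr Hb (eps / 2)) as [m Hm]; [lra |].
  exists m. intros p q Hp Hq.
  eapply Rle_trans; [apply (Cmod_triangle_minus _ (csum c m)) |].
  rewrite (Cmod_minus_sym (csum c m)).
  assert (T1 := csum_tail c r m p Hc Hp). assert (T2 := csum_tail c r m q Hc Hq).
  assert (M1 := Hm p Hp). assert (M2 := Hm q Hq). lra.
Qed.

(** * Absolutely convergent exponential sums on a line *)

Lemma contR_unif_limit (g : R -> C) :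
  (forall eps, 0 < eps -> exists h, contR h /\ forall t, Cmod (g t - h t) <= eps) -> contR g.
Proof.
  intros H t. apply continuous_C_eps_R. intros eps He.
  destruct (H (eps / 4)) as [h [Hc Hh]]; [lra |].
  destruct (proj1 (continuous_C_eps_R h t) (Hc t) (eps / 4)) as [d [Hd Hy]]; [lra |].
  exists d. split; auto. intros y Hyt. specialize (Hy y Hyt).
  assert (A := Hh y). assert (B := Hh t). rewrite Cmod_minus_sym in B.
  assert (T1 := Cmod_triangle_minus (g y) (h y) (g t)).
  assert (T2 := Cmod_triangle_minus (h y) (h t) (g t)). lra.
Qed.

Section ExponentialSum.

Context (c : nat -> C) (lam : nat -> R) (g : R -> C).
Context (Hb : rsum_bounded (fun j => Cmod (c j))).
Context (Hg : forall t, csums (fun j => c j * cis (lam j * t))%C (g t)).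

Let P (n : nat) (t : R) : C := csum (fun j => c j * cis (lam j * t))%C n.

Lemma expsum_approx (eps : R) :
  0 < eps -> exists m, forall n, (m <= n)%nat -> forall t, Cmod (g t - P n t) <= eps.
Proof.
  intros He.
  destruct (rsum_tail_small _ (fun j => Cmod_ge_0 (c j)) Hb eps He) as [m Hm].
  exists m. intros n Hn t. apply (csums_tail _ (fun j => Cmod (c j))).
  - intros j. rewrite Cmod_mult, Cmod_cis. lra.
  - apply Hg.
  - intros p Hp. assert (I := rsum_incr _ m n (fun j => Cmod_ge_0 (c j)) Hn).
    specialize (Hm p ltac:(lia)). simpl in *. lra.
Qed.

Lemma expsum_contR : contR g.
Proof.
  apply contR_unif_limit. intros eps He. destruct (expsum_approx eps He) as [m Hm].
  exists (P m). split; [| apply Hm; lia].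
  apply (contR_csum (fun j t => c j * cis (lam j * t))%C). intros j _. apply contR_scal, contR_cis.
Qed.

Lemma expsum_TB : TB g.
Proof.
  apply TB_unif_limit. intros eps He. destruct (expsum_approx eps He) as [m Hm].
  exists (P m). split; [| apply Hm; lia].
  apply (TB_csum (fun j t => c j * cis (lam j * t))%C). intros j _. apply TB_scal, TB_cis.
Qed.

(** The partial sums converge uniformly in t, so means pass to the limit; from [n0] on the partial
    sums already have mean [v] at frequency x. *)
Lemma expsum_mean (x : R) (v : C) (n0 : nat) :
  (forall n, (n0 <= n)%nat -> csum (fun j => c j * kron (lam j - x))%C n = v) ->
  umean (fun t => g t * cis (- x * t))%C v.
Proof.
  intros Hv. apply umean_unif_limit.
  - apply contR_mult; [apply expsum_contR | apply contR_cis].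
  - intros eps He. destruct (expsum_approx eps He) as [m Hm].
    exists (fun t => csum (fun j => c j * cis ((lam j - x) * t))%C (n0 + m)), v.
    split; [| split].
    + rewrite <- (Hv (n0 + m)%nat) by lia.
      apply (umean_csum (fun j t => c j * cis ((lam j - x) * t))%C).
      intros j _. apply umean_scal, umean_kron.
    + intros t. replace (csum _ _) with (P (n0 + m) t * cis (- x * t))%C.
      * replace (_ - _)%C with ((g t - P (n0 + m) t) * cis (- x * t))%C by ring.
        rewrite Cmod_mult, Cmod_cis, Rmult_1_r. apply Hm. lia.
      * unfold P. rewrite Cmult_comm, <- csum_scal. apply csum_ext. intros j _.
        replace ((lam j - x) * t) with (lam j * t + - x * t) by ring. rewrite cis_plus. ring.
    + replace (v - v)%C with (RtoC 0) by ring. rewrite Cmod_0. lra.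
Qed.

(** Injectivity is stated for nonzero coefficients because beyond a finite cardinal [lam] takes
    arbitrary values, while the coefficients are padded with zeros there. *)
Lemma expsum_mean_exponent (i : nat) :
  (forall j, c j <> 0 -> lam j = lam i -> j = i) ->
  umean (fun t => g t * cis (- lam i * t))%C (c i).
Proof.
  intros H. apply (expsum_mean (lam i) (c i) (S i)). intros n Hn.
  rewrite (csum_single _ _ i); [| lia |].
  - rewrite Rminus_diag, kron_0. ring.
  - intros j _ Hne. destruct (classic (c j = 0)) as [-> | Hc]; [ring |].
    rewrite kron_neq; [ring |]. intros E. apply Hne, H; auto. lra.
Qed.

Lemma expsum_mean_other (x : R) :
  (forall j, c j <> 0 -> lam j <> x) -> umean (fun t => g t * cis (- x * t))%C 0.
Proof.
  intros H. apply (expsum_mean x 0 0). intros n _. apply csum_0. intros j _.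
  destruct (classic (c j = 0)) as [-> | Hc]; [ring |].
  rewrite kron_neq; [ring |]. specialize (H j Hc). lra.
Qed.

End ExponentialSum.

(** * The Dirichlet series of an almost periodic function with independent exponents *)

Definition trunc_coef (card : option nat) (a : nat -> C) (j : nat) : C :=
  match card with
  | Some N => if Nat.ltb j N then a j else RtoC 0
  | None => a j
  end.

Lemma trunc_coef_in (card : option nat) (a : nat -> C) (j : nat) :
  lt_card j card -> trunc_coef card a j = a j.
Proof. destruct card; simpl; auto. intros H. apply Nat.ltb_lt in H. now rewrite H. Qed.

Lemma trunc_coef_neq_0 (card : option nat) (a : nat -> C) (j : nat) :
  trunc_coef card a j <> 0 -> lt_card j card.
Proof. destruct card; simpl; auto. destruct (Nat.ltb_spec j n); auto. congruence. Qed.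

(** [fourier_sum_le_sup] speaks of prefixes within the cardinal; this reduces an arbitrary partial
    sum to such a prefix. *)
Lemma rsum_trunc (card : option nat) (r : nat -> R) :
  (forall j, ~ lt_card j card -> r j = 0) ->
  forall n, exists m, le_card m card /\ rsum r n = rsum r m.
Proof.
  intros H. induction n as [|n [m [Hm E]]].
  - exists 0%nat. split; auto. destruct card; simpl; auto. lia.
  - destruct (classic (lt_card n card)) as [Hc | Hc].
    + exists (S n). split; [apply lt_card_le_S, Hc | reflexivity].
    + exists m. split; auto. simpl. rewrite H, E by auto. ring.
Qed.

Definition dirichlet_term (a : nat -> C) (lam : nat -> R) (s : C) (j : nat) : C :=
  (a j * Cexp (lam j * s))%C.

Lemma dirichlet_term_pair (a : nat -> C) (lam : nat -> R) (x t : R) (j : nat) :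
  dirichlet_term a lam (x, t) j = (a j * RtoC (exp (lam j * x)) * cis (lam j * t))%C.
Proof.
  unfold dirichlet_term. rewrite Cexp_cis.
  replace (Re (lam j * (x, t))) with (lam j * x) by (unfold Re, Cmult, RtoC; simpl; ring).
  replace (Im (lam j * (x, t))) with (lam j * t) by (unfold Im, Cmult, RtoC; simpl; ring).
  ring.
Qed.

Lemma fourier_exponent_iff (al be : Rbar) (f : C -> C) (A : R -> C) (lam : R) :
  is_fourier_coeff al be f lam (A lam) ->
  (forall a, is_fourier_coeff al be f lam a -> a = A lam) ->
  (fourier_exponent al be f lam <-> A lam <> 0).
Proof.
  intros H1 H2. split.
  - intros [a [Ha Hc]]. rewrite <- (H2 a Hc). exact Ha.
  - intros H. exists (A lam). auto.
Qed.

(** The clause that bounds the partial sums by any bound of f on the line is kept in the conclusion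
    for the converse direction, where the bound comes from the other function. *)
Lemma AP_dirichlet (al be : Rbar) (f : C -> C) (card : option nat) (lam : nat -> R) :
  Rbar_lt al be -> AP al be f ->
  enumerates card lam (fourier_exponent al be f) -> Z_independent card lam ->
  exists a : nat -> C,
    (forall j, lt_card j card -> is_fourier_coeff al be f (lam j) (a j) /\ a j <> 0 /\
       forall b, is_fourier_coeff al be f (lam j) b -> b = a j) /\
    (forall j, ~ lt_card j card -> a j = 0) /\
    (forall x B, in_interval al be x -> (forall t, Cmod (f (x, t)) <= B) ->
       forall n, rsum (fun j => Cmod (a j) * exp (lam j * x)) n <= B) /\
    (forall x, in_interval al be x -> rsum_bounded (fun j => Cmod (a j) * exp (lam j * x))) /\
    (forall s, in_strip al be s -> csums (dirichlet_term a lam s) (f s)).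
Proof.
  intros Hab HAP [Hinj Henum] Hi.
  destruct (AP_coefficients al be f Hab HAP) as [A HA].
  set (a := trunc_coef card (fun j => A (lam j))).
  assert (Hexp : forall x, fourier_exponent al be f x <-> A x <> 0).
  { intros x. destruct (HA x) as [H1 [H2 _]]. apply fourier_exponent_iff; auto. }
  assert (Ha : forall j, lt_card j card -> a j = A (lam j)).
  { intros j Hj. apply trunc_coef_in, Hj. }
  assert (Ha0 : forall j, ~ lt_card j card -> a j = 0).
  { intros j Hj. apply NNPP. intros Hc. apply Hj, (trunc_coef_neq_0 card (fun j => A (lam j))), Hc. }
  assert (Hsup : forall x B, in_interval al be x -> (forall t, Cmod (f (x, t)) <= B) ->
       forall n, rsum (fun j => Cmod (a j) * exp (lam j * x)) n <= B).
  { intros x B Hx HB n.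
    destruct (rsum_trunc card (fun j => Cmod (a j) * exp (lam j * x))) with (n := n) as [m [Hm E]].
    { intros j Hj. rewrite Ha0, Cmod_0 by auto. ring. }
    rewrite E.
    assert (F := fourier_sum_le_sup card lam (fun t => f (x, t)) (fun l => A l * RtoC (exp (l * x)))%C
      B 0 m Hi Hm (fun l => proj2 (proj2 (HA l)) x Hx)).
    rewrite Rplus_0_l in F.
    rewrite (rsum_ext _ (fun j => Cmod (A (lam j) * RtoC (exp (lam j * x))))).
    - apply F; auto; [| | lra].
      + intros y Hy. right. destruct (proj1 (Henum y)) as [i [H1 H2]]; [| eauto].
        apply Hexp. intros E0. apply Hy. rewrite E0. ring.
      (* An independent family does not contain 0, so the constant term is 0. *)
      + destruct (classic (A 0 = 0)) as [-> | Hn]; [ring |].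
        apply Hexp, Henum in Hn. destruct Hn as [i [H1 H2]].
        exfalso. revert H2. apply (Z_independent_neq_0 card); auto.
    - intros j Hj. rewrite Ha by (eapply lt_le_card; eauto).
      rewrite Cmod_mult, Cmod_R, Rabs_pos_eq; auto. left; apply exp_pos. }
  assert (Hbd : forall x, in_interval al be x -> rsum_bounded (fun j => Cmod (a j) * exp (lam j * x))).
  { intros x Hx. destruct (AP_line al be f x HAP Hx) as [_ HT].
    destruct (TB_bounded _ HT) as [B [_ HB]]. exists B. intros n. apply (Hsup x B Hx HB). }
  exists a. split; [| split; [| split; [| split]]]; auto.
  - intros j Hj. rewrite Ha by auto. destruct (HA (lam j)) as [H1 [H2 _]].
    split; auto. split; auto. apply Hexp, Henum. eauto.
  - intros [x t] Hx. change (in_interval al be x) in Hx.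
    destruct (AP_line al be f x HAP Hx) as [HC HT].
    set (c := fun j => (a j * RtoC (exp (lam j * x)))%C).
    assert (Hcm : forall j, Cmod (c j) = Cmod (a j) * exp (lam j * x)).
    { intros j. unfold c. rewrite Cmod_mult, Cmod_R, Rabs_pos_eq; auto. left; apply exp_pos. }
    assert (Hcb : rsum_bounded (fun j => Cmod (c j))).
    { destruct (Hbd x Hx) as [B HB]. exists B. intros n. rewrite (rsum_ext _ (fun j => Cmod (a j) * exp (lam j * x))); auto. }
    destruct (choice (fun t z => csums (fun j => c j * cis (lam j * t))%C z)) as [g Hg].
    { intros y. apply csums_exists with (fun j => Cmod (c j)); auto.
      intros j. rewrite Cmod_mult, Cmod_cis. lra. }
    assert (Cg := expsum_contR c lam g Hcb Hg). assert (Tg := expsum_TB c lam g Hcb Hg).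
    assert (Hc0 : forall j, c j <> 0 -> lt_card j card).
    { intros j Hj. apply NNPP. intros Hn. apply Hj. unfold c. rewrite Ha0 by auto. ring. }
    assert (Mg : forall y, umean (fun t => g t * cis (- y * t))%C (A y * RtoC (exp (y * x)))%C).
    { intros y. destruct (classic (A y = 0)) as [E | Hn].
      - rewrite E, Cmult_0_l. apply (expsum_mean_other c lam g Hcb Hg). intros j Hj Ej.
        assert (Hl := Hc0 j Hj). apply Hj. unfold c. rewrite Ha, Ej, E by auto. ring.
      - apply Hexp, Henum in Hn. destruct Hn as [i [H1 <-]].
        rewrite <- Ha by auto. fold (c i). apply (expsum_mean_exponent c lam g Hcb Hg).
        intros j Hj Ej. apply Hinj; auto. }
    assert (Hz : forall t, (f (x, t) + - (1) * g t)%C = 0).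
    { apply umean_zero_unique.
      - apply contR_plus; [auto | apply contR_scal; auto].
      - apply (TB_plus (fun t => f (x, t))); [auto | apply TB_scal; auto].
      - intros y. apply umean_ext with (fun t => f (x, t) * cis (- y * t) + - (1) * (g t * cis (- y * t)))%C.
        + intros. ring.
        + replace (RtoC 0) with (A y * RtoC (exp (y * x)) + - (1) * (A y * RtoC (exp (y * x))))%C by ring.
          apply umean_plus; [apply HA, Hx | apply umean_scal, Mg]. }
    replace (f (x, t)) with (g t).
    2: { replace (f (x, t)) with ((f (x, t) + - (1) * g t) + g t)%C by ring. rewrite Hz. ring. }
    apply csums_ext with (fun j => c j * cis (lam j * t))%C; auto.
    intros j. symmetry. apply dirichlet_term_pair.
Qed.

(** * Taylor expansions *)

Lemma pow_fact_le_exp (K : nat) (t : R) : 0 <= t -> t ^ K / INR (fact K) <= exp t.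
Proof.
  destruct K as [|K]; intros Ht.
  - simpl. replace (1 / 1) with 1 by field. generalize (exp_ineq1_le t). lra.
  - revert t Ht. induction K as [|K IH]; intros t Ht.
    + simpl. generalize (exp_ineq1_le t). lra.
    + assert (E := monomial_integral 1 (S K) t Ht).
      assert (B : Cmod (Cint (fun s => RtoC (s ^ S K / INR (fact (S K))) * 1)%C 0 t) <= RInt exp 0 t).
      { apply Cint_bound_fun; auto.
        - intros x _. apply continuous_Cmult; [apply continuous_monomial | apply continuous_Cconst].
        - apply (ex_RInt_continuous (V := R_CompleteNormedModule)). intros z _.
          apply continuity_pt_filterlim. reg.
        - intros x Hx. rewrite Cmult_1_r, Cmod_R, Rabs_pos_eq; [apply IH; lra |].
          apply Rmult_le_pos; [apply pow_le; lra | left; apply Rinv_0_lt_compat, INR_fact_lt_0]. }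
      rewrite E, Cmult_1_r, Cmod_R in B.
      assert (I : RInt exp 0 t = exp t - exp 0).
      { apply is_RInt_unique. apply (is_RInt_derive (V := R_CompleteNormedModule) exp exp).
        - intros x _. apply is_derive_exp.
        - intros x _. apply continuity_pt_filterlim. reg. }
      rewrite I, exp_0 in B. generalize (Rle_abs (t ^ S (S K) / INR (fact (S (S K))))). lra.
Qed.

(** One power series with a remainder bound for every order. The constants [rho] and [B] are
    explicit so that they can be shared by all points of a vertical line. *)
Definition taylor_at (rho B : R) (G : C -> C) : Prop :=
  exists m : nat -> C, forall (K : nat) (z : C), Cmod z <= rho ->
    Cmod (G z - csum (fun k => m k * z ^ k)%C K) <= B * (Cmod z / rho) ^ K.

Lemma taylor_at_minus (rho B1 B2 : R) (G1 G2 : C -> C) :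
  taylor_at rho B1 G1 -> taylor_at rho B2 G2 -> taylor_at rho (B1 + B2) (fun z => G1 z - G2 z)%C.
Proof.
  intros [m1 H1] [m2 H2]. exists (fun k => m1 k - m2 k)%C. intros K z Hz.
  rewrite (csum_ext _ (fun k => m1 k * z ^ k - m2 k * z ^ k)%C) by (intros; ring).
  rewrite csum_minus.
  replace (_ - _)%C with ((G1 z - csum (fun k => m1 k * z ^ k)%C K) + - (G2 z - csum (fun k => m2 k * z ^ k)%C K))%C by ring.
  eapply Rle_trans; [apply Cmod_triangle |]. rewrite Cmod_opp.
  specialize (H1 K z Hz). specialize (H2 K z Hz). lra.
Qed.

Lemma taylor_at_const (rho : R) (w : C) : 0 < rho -> taylor_at rho (Cmod w) (fun _ => w).
Proof.
  intros Hr. exists (fun k => if Nat.eqb k 0 then w else RtoC 0). intros K z Hz.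
  destruct K as [|K].
  - simpl. replace (w - 0)%C with w by ring. lra.
  - rewrite (csum_single _ _ 0%nat); [| lia |].
    + simpl. replace (w - w * 1)%C with (RtoC 0) by ring. rewrite Cmod_0.
      apply Rmult_le_pos; [apply Cmod_ge_0 |].
      apply (pow_le _ (S K)). apply Rmult_le_pos; [apply Cmod_ge_0 | left; apply Rinv_0_lt_compat; auto].
    + intros j _ Hj. destruct (Nat.eqb_spec j 0); [contradiction | ring].
Qed.

(** Expand each exponential and exchange the sums: the majorant e^(2 rho |lam_j|) controls the
    coefficients and the remainders of all orders at once. *)
Lemma expsum_taylor (c : nat -> C) (lam : nat -> R) (rho B : R) (G : C -> C) :
  0 < rho ->
  (forall n, rsum (fun j => Cmod (c j) * exp (Rabs (lam j) * (2 * rho))) n <= B) ->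
  (forall z, Cmod z <= rho -> csums (fun j => c j * Cexp (lam j * z))%C (G z)) ->
  taylor_at rho B G.
Proof.
  intros Hr HB HG.
  (* The sum of [d k j] over j is the Taylor coefficient of order k. *)
  set (d := fun (k j : nat) => (c j * (RtoC (/ INR (fact k)) * RtoC (lam j) ^ k))%C).
  destruct (choice (fun k m => csums (d k) m)) as [m Hm].
  { intros k.
    apply csums_exists with (fun j => / (2 * rho) ^ k * (Cmod (c j) * exp (Rabs (lam j) * (2 * rho)))).
    - intros j. unfold d. rewrite !Cmod_mult, Cmod_pow, !Cmod_R.
      rewrite (Rabs_pos_eq (/ _)) by (left; apply Rinv_0_lt_compat, INR_fact_lt_0).
      assert (Hp : 0 < (2 * rho) ^ k) by (apply pow_lt; lra).
      replace (/ (2 * rho) ^ k * (Cmod (c j) * exp (Rabs (lam j) * (2 * rho)))) with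
        (Cmod (c j) * (/ (2 * rho) ^ k * exp (Rabs (lam j) * (2 * rho)))) by ring.
      apply Rmult_le_compat_l; [apply Cmod_ge_0 |].
      apply Rmult_le_reg_l with ((2 * rho) ^ k); auto.
      rewrite <- (Rmult_assoc ((2 * rho) ^ k) (/ (2 * rho) ^ k)), Rinv_r, Rmult_1_l by lra.
      assert (L := pow_fact_le_exp k (Rabs (lam j) * (2 * rho))
        ltac:(apply Rmult_le_pos; [apply Rabs_pos | lra])).
      rewrite Rpow_mult_distr in L. unfold Rdiv in L. lra.
    - exists (/ (2 * rho) ^ k * B). intros n. rewrite rsum_scal. apply Rmult_le_compat_l; auto.
      left. apply Rinv_0_lt_compat, pow_lt. lra. }
  exists m. intros K z Hz.
  assert (Hz0 := Cmod_ge_0 z).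
  assert (Hq : 0 <= Cmod z / rho) by (apply Rmult_le_pos; auto; left; apply Rinv_0_lt_compat; auto).
  assert (HD : csums (fun j => c j * (Cexp (lam j * z) - exp_poly (lam j * z) K))%C
     (G z - csum (fun k => m k * z ^ k)%C K)).
  { apply csums_ext with (fun j => c j * Cexp (lam j * z) + - (1) * csum (fun k => z ^ k * d k j) K)%C.
    - intros j. unfold exp_poly.
      rewrite (csum_ext (fun k => z ^ k * d k j)%C (fun k => c j * (RtoC (/ INR (fact k)) * (lam j * z) ^ k))%C).
      + rewrite csum_scal. ring.
      + intros k _. unfold d. rewrite Cpow_mult_l. ring.
    - unfold Cminus. apply csums_plus; [apply HG, Hz |].
      replace (- csum (fun k => m k * z ^ k) K)%C with (- (1) * csum (fun k => z ^ k * m k) K)%C.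
      + apply csums_scal. apply (csums_csum (fun k j => z ^ k * d k j)%C (fun k => z ^ k * m k)%C).
        intros k _. apply csums_scal, Hm.
      + rewrite (csum_ext _ (fun k => m k * z ^ k)%C) by (intros; ring). ring. }
  apply (csums_bound _ _ _ HD). intros n.
  eapply Rle_trans; [apply Cmod_csum |].
  apply Rle_trans with (rsum (fun j => (Cmod z / rho) ^ K * (Cmod (c j) * exp (Rabs (lam j) * (2 * rho)))) n).
  - apply rsum_le. intros j _. rewrite Cmod_mult.
    apply Rle_trans with (Cmod (c j) * ((Cmod z / rho) ^ K * exp (Rabs (lam j) * (2 * rho)))); [| lra].
    apply Rmult_le_compat_l; [apply Cmod_ge_0 |].
    eapply Rle_trans; [apply Cexp_taylor |]. rewrite Cmod_mult, Cmod_R.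
    set (u := Rabs (lam j)). assert (Hu : 0 <= u) by apply Rabs_pos.
    replace (u * Cmod z) with ((Cmod z / rho) * (u * rho)) at 1 by (field; lra).
    rewrite Rpow_mult_distr. unfold Rdiv at 1. rewrite !Rmult_assoc.
    apply Rmult_le_compat_l; [apply pow_le; auto |].
    (* One factor e^(u rho) absorbs (u rho)^K / K!, the other the exponential in the Taylor
       remainder; this is the origin of the radius 2 * rho. *)
    replace (u * (2 * rho)) with (u * rho + u * rho) by ring. rewrite exp_plus.
    rewrite <- Rmult_assoc. apply Rmult_le_compat.
    + apply Rmult_le_pos; [apply pow_le, Rmult_le_pos; lra | left; apply Rinv_0_lt_compat, INR_fact_lt_0].
    + left; apply exp_pos.
    + apply pow_fact_le_exp. apply Rmult_le_pos; lra.
    + apply exp_monotone, Rmult_le_compat_l; auto.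
  - rewrite rsum_scal, Rmult_comm. apply Rmult_le_compat_r; auto. apply pow_le; auto.
Qed.

(** A quantitative form of the isolation of zeros: if some coefficient is nonzero, the first such
    term dominates the remainder on all small circles. *)
Lemma taylor_dichotomy (rho B : R) (G : C -> C) :
  0 < rho -> taylor_at rho B G ->
  (forall z, Cmod z < rho -> G z = 0) \/
  (exists r0, 0 < r0 <= rho /\ forall r, 0 < r < r0 -> exists mu, 0 < mu /\
     forall z, Cmod z = r -> mu <= Cmod (G z)).
Proof.
  intros Hr [m Hm].
  destruct (classic (forall k, m k = 0)) as [Hz | Hn].
  - left. intros z Hzr. apply Cmod_eq_0. apply Rle_antisym; [| apply Cmod_ge_0].
    assert (Hz0 := Cmod_ge_0 z).
    assert (Hq : 0 <= Cmod z / rho) by (apply Rmult_le_pos; auto; left; apply Rinv_0_lt_compat; auto).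
    assert (Hq1 : Cmod z / rho < 1).
    { apply Rmult_lt_reg_r with rho; auto. unfold Rdiv. rewrite Rmult_assoc, Rinv_l, Rmult_1_r; lra. }
    apply le_epsilon. intros eps He. rewrite Rplus_0_l.
    assert (HB : Rabs B + 1 > 0) by (generalize (Rabs_pos B); lra).
    destruct (pow_lt_1_zero (Cmod z / rho)) with (y := eps / (Rabs B + 1)) as [K HK].
    { rewrite Rabs_pos_eq; auto. } { apply Rdiv_lt_0_compat; auto. }
    specialize (HK K (Nat.le_refl K)). specialize (Hm K z ltac:(lra)).
    rewrite csum_0 in Hm by (intros; rewrite Hz; ring).
    replace (G z - 0)%C with (G z) in Hm by ring.
    eapply Rle_trans; [exact Hm |].
    rewrite Rabs_pos_eq in HK by (apply pow_le; auto).
    apply Rle_trans with ((Rabs B + 1) * (eps / (Rabs B + 1))).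
    + apply Rle_trans with ((Rabs B + 1) * (Cmod z / rho) ^ K).
      * apply Rmult_le_compat_r; [apply pow_le; auto | generalize (Rle_abs B); lra].
      * apply Rmult_le_compat_l; lra.
    + right. field. lra.
  - right. assert (HK : exists K, m K <> 0 /\ forall k, (k < K)%nat -> m k = 0).
    { apply not_all_ex_not in Hn. destruct Hn as [n Hn].
      revert Hn. induction n as [n IH] using (well_founded_induction Wf_nat.lt_wf). intros Hn.
      destruct (classic (exists k, (k < n)%nat /\ m k <> 0)) as [[k [Hk Hmk]] | Hc]; [eauto |].
      exists n. split; auto. intros k Hk. apply NNPP. intros Hmk. apply Hc. eauto. }
    destruct HK as [K [HK1 HK2]].
    assert (HmK : 0 < Cmod (m K)) by (apply Cmod_gt_0; exact HK1).
    set (B1 := Rabs B + 1). assert (HB1 : 0 < B1) by (unfold B1; generalize (Rabs_pos B); lra).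
    assert (HrK : 0 < rho ^ S K) by (apply pow_lt; auto).
    (* For r below this radius, B * (r / rho)^(K + 1) is at most half of the leading term |m K| *
       r^K. *)
    exists (Rmin rho (Cmod (m K) * rho ^ S K / (2 * B1))). split.
    { split; [| apply Rmin_l]. apply Rmin_glb_lt; auto. apply Rdiv_lt_0_compat; [| lra].
      apply Rmult_lt_0_compat; auto. }
    intros r [Hr0 Hr1].
    assert (R1 : r < rho) by (eapply Rlt_le_trans; [exact Hr1 | apply Rmin_l]).
    assert (R2 : r < Cmod (m K) * rho ^ S K / (2 * B1)) by (eapply Rlt_le_trans; [exact Hr1 | apply Rmin_r]).
    assert (HrKp : 0 < r ^ K) by (apply pow_lt; auto).
    exists (Cmod (m K) * r ^ K / 2). split.
    { apply Rdiv_lt_0_compat; [apply Rmult_lt_0_compat; auto | lra]. }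
    intros z Hz. specialize (Hm (S K) z ltac:(lra)). rewrite Hz in Hm. simpl csum in Hm.
    rewrite csum_0 in Hm by (intros; rewrite HK2 by auto; ring).
    rewrite Cplus_0_l in Hm.
    assert (T := Cmod_triangle_rev (m K * z ^ K)%C (G z)).
    rewrite Cmod_minus_sym, Cmod_mult, Cmod_pow, Hz in T.
    assert (L : B * (r / rho) ^ S K <= Cmod (m K) * r ^ K / 2).
    { apply Rle_trans with (B1 * (r / rho) ^ S K).
      - apply Rmult_le_compat_r; [| unfold B1; generalize (Rle_abs B); lra].
        apply pow_le. left. apply Rdiv_lt_0_compat; auto.
      - unfold Rdiv at 1. rewrite Rpow_mult_distr, pow_inv.
        apply Rmult_le_reg_r with (rho ^ S K); auto.
        replace (B1 * (r ^ S K * / rho ^ S K) * rho ^ S K) with (B1 * r ^ S K) by (field; lra).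
        replace (r ^ S K) with (r * r ^ K) by reflexivity.
        replace (Cmod (m K) * r ^ K / 2 * rho ^ S K) with ((Cmod (m K) * rho ^ S K / (2 * B1)) * (B1 * r ^ K))
          by (field; lra).
        replace (B1 * (r * r ^ K)) with (r * (B1 * r ^ K)) by ring.
        apply Rmult_le_compat_r; [| lra]. left. apply Rmult_lt_0_compat; auto. }
    lra.
Qed.

(* All points of the vertical line have Taylor discs of the same radius, so vanishing
   propagates along the line in steps of fixed length. *)
Lemma vertical_continuation (D : C -> C) (x rho B : R) :
  0 < rho -> (forall t, taylor_at rho B (fun z => D ((x, t) + z)%C)) ->
  forall t0, (forall z, Cmod z < rho -> D ((x, t0) + z)%C = 0) -> forall t, D (x, t) = 0.
Proof.
  intros Hr HD t0 H0.
  assert (Step : forall t h, Rabs h <= rho / 2 ->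
    (forall z, Cmod z < rho -> D ((x, t) + z)%C = 0) ->
    forall z, Cmod z < rho -> D ((x, (t + h)%R) + z)%C = 0).
  { intros t h Hh Ht.
    destruct (taylor_dichotomy rho B _ Hr (HD (t + h))) as [A | [r0 [[Hr0 Hr1] A]]]; [exact A |].
    (* The point r0 / 4 to the right of the new centre still lies in the old disc, where [D]
       vanishes, as r0 / 4 + rho / 2 < rho. *)
    exfalso. destruct (A (r0 / 4)) as [mu [Hmu Hz]]; [lra |].
    assert (E : Cmod (RtoC (r0 / 4)%R) = r0 / 4) by (rewrite Cmod_R, Rabs_pos_eq; lra).
    specialize (Hz (RtoC (r0 / 4)%R) E).
    replace ((x, (t + h)%R) + RtoC (r0 / 4)%R)%C with ((x, t) + ((r0 / 4)%R, h))%C in Hz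
      by (unfold Cplus, RtoC; simpl; f_equal; ring).
    rewrite Ht, Cmod_0 in Hz; [lra |].
    eapply Rle_lt_trans; [apply Cmod_pair_le |]. rewrite (Rabs_pos_eq (r0 / 4)); lra. }
  assert (Steps : forall h, Rabs h <= rho / 2 -> forall n z, Cmod z < rho -> D ((x, (t0 + INR n * h)%R) + z)%C = 0).
  { intros h Hh. induction n as [|n IH].
    - simpl. rewrite Rmult_0_l, Rplus_0_r. exact H0.
    - rewrite S_INR. replace (t0 + (INR n + 1) * h) with (t0 + INR n * h + h) by ring.
      apply Step; auto. }
  intros t. destruct (INR_large (Rabs (t - t0) / (rho / 2))) as [N HN].
  specialize (HN (S N) ltac:(lia)).
  assert (Hp : 0 < INR (S N)) by (apply lt_0_INR; lia).
  assert (Hh : Rabs ((t - t0) / INR (S N)) <= rho / 2).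
  { unfold Rdiv. rewrite Rabs_mult, Rabs_inv, (Rabs_pos_eq (INR (S N))) by lra.
    apply Rmult_le_reg_r with (INR (S N)); auto. rewrite Rmult_assoc, Rinv_l, Rmult_1_r by lra.
    replace (Rabs (t - t0)) with (Rabs (t - t0) / (rho / 2) * (rho / 2)) by (field; lra).
    rewrite (Rmult_comm (rho * / 2)). apply Rmult_le_compat_r; lra. }
  assert (F := Steps _ Hh (S N) 0). rewrite Cmod_0 in F. specialize (F Hr).
  rewrite Cplus_0_r in F.
  replace (t0 + INR (S N) * ((t - t0) / INR (S N))) with t in F by (field; lra). exact F.
Qed.

(** * Functions represented by an absolutely convergent Dirichlet series *)

Definition dirichlet_on (al be : Rbar) (a : nat -> C) (lam : nat -> R) (F : C -> C) : Prop :=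
  (forall x, in_interval al be x -> rsum_bounded (fun j => Cmod (a j) * exp (lam j * x))) /\
  (forall s, in_strip al be s -> csums (dirichlet_term a lam s) (F s)).

(** Exponents of both signs occur, so both ends of the interval are needed in the majorant. *)
Lemma exp_two_sided (u x y r : R) :
  Rabs (y - x) <= r -> exp (u * y) <= exp (u * (x + r)) + exp (u * (x - r)).
Proof.
  intros H. apply Rabs_le_between in H.
  assert (H1 := exp_pos (u * (x + r))). assert (H2 := exp_pos (u * (x - r))).
  destruct (Rle_dec 0 u).
  - assert (exp (u * y) <= exp (u * (x + r))) by (apply exp_monotone, Rmult_le_compat_l; lra). lra.
  - assert (exp (u * y) <= exp (u * (x - r))); [| lra].
    apply exp_monotone. assert (- u * (x - r) <= - u * y) by (apply Rmult_le_compat_l; lra). lra.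
Qed.

Lemma dirichlet_two_sided (al be : Rbar) (a : nat -> C) (lam : nat -> R) (F : C -> C) (x r : R) :
  dirichlet_on al be a lam F -> in_interval al be (x - r) -> in_interval al be (x + r) ->
  exists B, forall n, rsum (fun j => Cmod (a j) * (exp (lam j * (x + r)) + exp (lam j * (x - r)))) n <= B.
Proof.
  intros [Hb _] H1 H2. destruct (Hb _ H1) as [B1 HB1]. destruct (Hb _ H2) as [B2 HB2].
  exists (B2 + B1). intros n.
  rewrite (rsum_ext _ (fun j => Cmod (a j) * exp (lam j * (x + r)) + Cmod (a j) * exp (lam j * (x - r))))
    by (intros; ring).
  rewrite rsum_plus. specialize (HB1 n). specialize (HB2 n). lra.
Qed.

Lemma Cmod_dirichlet_term (a : nat -> C) (lam : nat -> R) (s : C) (j : nat) :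
  Cmod (dirichlet_term a lam s j) = Cmod (a j) * exp (lam j * Re s).
Proof.
  destruct s as [x t]. rewrite dirichlet_term_pair, !Cmod_mult, Cmod_cis, Cmod_R, Rmult_1_r.
  rewrite Rabs_pos_eq; auto. left; apply exp_pos.
Qed.

(** The bound [B] is uniform in t because the moduli of the terms depend only on the abscissa. *)
Lemma dirichlet_taylor (al be : Rbar) (a : nat -> C) (lam : nat -> R) (F : C -> C) (x rho : R) :
  0 < rho -> dirichlet_on al be a lam F ->
  in_interval al be (x - 2 * rho) -> in_interval al be (x + 2 * rho) ->
  exists B, forall t, taylor_at rho B (fun z => F ((x, t) + z)%C).
Proof.
  intros Hr HF H1 H2.
  destruct (dirichlet_two_sided al be a lam F x (2 * rho) HF H1 H2) as [B HB].
  exists B. intros t.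
  apply (expsum_taylor (dirichlet_term a lam (x, t)) lam); auto.
  - intros n. eapply Rle_trans; [| apply (HB n)]. apply rsum_le. intros j _.
    rewrite Cmod_dirichlet_term. simpl Re. rewrite Rmult_assoc.
    apply Rmult_le_compat_l; [apply Cmod_ge_0 |]. rewrite <- exp_plus.
    change (Re (x, t)) with x.
    assert (Hp := exp_pos (lam j * (x + 2 * rho))). assert (Hq := exp_pos (lam j * (x - 2 * rho))).
    unfold Rabs. destruct Rcase_abs.
    + replace (lam j * x + - lam j * (2 * rho)) with (lam j * (x - 2 * rho)) by ring. lra.
    + replace (lam j * x + lam j * (2 * rho)) with (lam j * (x + 2 * rho)) by ring. lra.
  - intros z Hz. destruct HF as [_ HF].
    apply csums_ext with (dirichlet_term a lam ((x, t) + z)%C).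
    + intros j. unfold dirichlet_term. rewrite Cmult_plus_distr_l, Cexp_plus. ring.
    + apply HF. unfold in_strip. change (Re ((x, t) + z)%C) with (x + Re z).
      apply (in_interval_between al be (x - 2 * rho) _ (x + 2 * rho)); auto.
      assert (Rabs (Re z) <= rho) by (eapply Rle_trans; [apply re_le_Cmod | exact Hz]).
      apply Rabs_le_between in H. lra.
Qed.

Section DirichletMeans.

Context (al be : Rbar) (a : nat -> C) (lam : nat -> R) (F : C -> C) (x : R).
Context (HF : dirichlet_on al be a lam F) (Hx : in_interval al be x).

Let c (j : nat) : C := (a j * RtoC (exp (lam j * x)))%C.

Lemma dirichlet_line_bounded : rsum_bounded (fun j => Cmod (c j)).
Proof.
  destruct HF as [Hb _]. destruct (Hb x Hx) as [B HB]. exists B. intros n.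
  rewrite (rsum_ext _ (fun j => Cmod (a j) * exp (lam j * x))); auto.
  intros j _. unfold c. rewrite Cmod_mult, Cmod_R, Rabs_pos_eq; auto. left; apply exp_pos.
Qed.

Lemma dirichlet_line_sums (t : R) : csums (fun j => c j * cis (lam j * t))%C (F (x, t)).
Proof.
  destruct HF as [_ Hs]. apply csums_ext with (dirichlet_term a lam (x, t)); [| apply Hs, Hx].
  intros j. apply dirichlet_term_pair.
Qed.

Lemma line_coef_neq_0 (j : nat) : c j <> 0 <-> a j <> 0.
Proof.
  split; intros H E; apply H.
  - unfold c. rewrite E. ring.
  - apply Cmod_eq_0. assert (Z : Cmod (c j) = 0) by (rewrite E; apply Cmod_0).
    unfold c in Z. rewrite Cmod_mult, Cmod_R, Rabs_pos_eq in Z by (left; apply exp_pos).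
    apply Rmult_integral in Z. destruct Z as [Z | Z]; auto.
    generalize (exp_pos (lam j * x)). lra.
Qed.

Lemma dirichlet_mean_exponent (i : nat) :
  (forall j, a j <> 0 -> lam j = lam i -> j = i) ->
  umean (fun t => F (x, t) * cis (- lam i * t))%C (a i * RtoC (exp (lam i * x)))%C.
Proof.
  intros H.
  apply (expsum_mean_exponent c lam (fun t => F (x, t)) dirichlet_line_bounded dirichlet_line_sums).
  intros j Hj. apply H, line_coef_neq_0, Hj.
Qed.

Lemma dirichlet_mean_other (y : R) :
  (forall j, a j <> 0 -> lam j <> y) -> umean (fun t => F (x, t) * cis (- y * t))%C 0.
Proof.
  intros H.
  apply (expsum_mean_other c lam (fun t => F (x, t)) dirichlet_line_bounded dirichlet_line_sums).
  intros j Hj. apply H, line_coef_neq_0, Hj.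
Qed.

End DirichletMeans.

(** * Equality of the sets of values for *-equivalent functions *)

Lemma same_modulus_rotation (z w : C) : Cmod z = Cmod w -> exists phi, w = (z * cis phi)%C.
Proof.
  intros H. destruct (polar_form z) as [p Hp]. destruct (polar_form w) as [q Hq].
  exists (q - p). unfold Rminus. rewrite cis_plus.
  replace (z * (cis q * cis (- p)))%C with (cis q * (cis (- p) * z))%C by ring.
  rewrite Hp, H, <- Hq, Cmult_assoc, <- cis_plus, Rplus_opp_r, cis_0. ring.
Qed.

Lemma kronecker_card (card : option nat) (lam phi : nat -> R) (m : nat) (eps : R) :
  Z_independent card lam -> 0 < eps ->
  exists t, forall j, (j < m)%nat -> lt_card j card -> Cmod (cis (lam j * t) - cis (phi j)) <= eps.
Proof.
  intros Hi He.
  assert (Hn : exists n, le_card n card /\ forall j, (j < m)%nat -> lt_card j card -> (j < n)%nat).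
  { destruct card as [N|].
    - exists (Nat.min m N). simpl. split; [lia | intros; lia].
    - exists m. simpl. auto. }
  destruct Hn as [n [Hn Hm]]. destruct (kronecker card lam phi n eps Hi Hn He) as [t Ht].
  exists t. auto.
Qed.

(* Kronecker's theorem aligns the phases of the leading coefficients, and the tails are
   uniformly small on the disc. *)
Lemma translate_approximation (al1 be1 al2 be2 : Rbar) (card : option nat) (lam : nat -> R)
    (a1 a2 : nat -> C) (F1 F2 : C -> C) (x t r eps : R) :
  Z_independent card lam ->
  dirichlet_on al1 be1 a1 lam F1 -> dirichlet_on al2 be2 a2 lam F2 ->
  (forall j, Cmod (a1 j) = Cmod (a2 j)) -> (forall j, ~ lt_card j card -> a1 j = 0) ->
  in_interval al1 be1 (x - r) -> in_interval al1 be1 (x + r) ->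
  in_interval al2 be2 (x - r) -> in_interval al2 be2 (x + r) -> 0 < eps ->
  exists tau, forall z, Cmod z <= r -> Cmod (F1 ((x, (t + tau)%R) + z) - F2 ((x, t) + z))%C <= eps.
Proof.
  intros Hi H1 H2 Hmod H0 I1 I2 J1 J2 He.
  (* As the moduli of the coefficients agree, this is a common majorant of both series on the disc,
     at every height. *)
  set (w := fun j => Cmod (a1 j) * (exp (lam j * (x + r)) + exp (lam j * (x - r)))).
  assert (Hw : forall j, 0 <= w j).
  { intros j. apply Rmult_le_pos; [apply Cmod_ge_0 |].
    generalize (exp_pos (lam j * (x + r))) (exp_pos (lam j * (x - r))). lra. }
  destruct (dirichlet_two_sided _ _ _ _ _ x r H1 I1 I2) as [B HB]. fold w in HB.
  assert (HB0 : 0 <= B) by (apply (HB 0%nat)).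
  destruct (choice (fun j phi => a2 j = (a1 j * cis phi)%C)) as [phi Hphi].
  { intros j. apply same_modulus_rotation, Hmod. }
  destruct (rsum_tail_small w Hw (ex_intro _ B HB) (eps / 3)) as [m Hm]; [lra |].
  destruct (kronecker_card card lam phi m (eps / 3 / (B + 1)) Hi) as [tau Htau];
    [repeat apply Rdiv_lt_0_compat; lra |].
  exists tau. intros z Hz.
  assert (Hre : Rabs (x + Re z - x) <= r).
  { replace (x + Re z - x) with (Re z) by ring. eapply Rle_trans; [apply re_le_Cmod | exact Hz]. }
  assert (Hre' := Hre). apply Rabs_le_between in Hre'.
  assert (C1 : csums (dirichlet_term a1 lam ((x, (t + tau)%R) + z)%C) (F1 ((x, (t + tau)%R) + z)%C)).
  { apply H1. unfold in_strip. change (in_interval al1 be1 (x + Re z)).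
    apply (in_interval_between al1 be1 (x - r) _ (x + r)); auto. lra. }
  assert (C2 : csums (dirichlet_term a2 lam ((x, t) + z)%C) (F2 ((x, t) + z)%C)).
  { apply H2. unfold in_strip. change (in_interval al2 be2 (x + Re z)).
    apply (in_interval_between al2 be2 (x - r) _ (x + r)); auto. lra. }
  assert (W1 : forall j, Cmod (dirichlet_term a1 lam ((x, (t + tau)%R) + z)%C j) <= w j).
  { intros j. rewrite Cmod_dirichlet_term. apply Rmult_le_compat_l; [apply Cmod_ge_0 |].
    apply exp_two_sided. exact Hre. }
  assert (W2 : forall j, Cmod (dirichlet_term a2 lam ((x, t) + z)%C j) <= w j).
  { intros j. rewrite Cmod_dirichlet_term, <- Hmod. apply Rmult_le_compat_l; [apply Cmod_ge_0 |].
    apply exp_two_sided. exact Hre. }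
  assert (T1 := csums_tail _ w _ m (eps / 3) W1 C1 Hm).
  assert (T2 := csums_tail _ w _ m (eps / 3) W2 C2 Hm).
  assert (T3 : Cmod (csum (dirichlet_term a1 lam ((x, (t + tau)%R) + z)%C) m
      - csum (dirichlet_term a2 lam ((x, t) + z)%C) m) <= eps / 3).
  { rewrite <- csum_minus. eapply Rle_trans; [apply Cmod_csum |].
    apply Rle_trans with (rsum (fun j => eps / 3 / (B + 1) * w j) m).
    - apply rsum_le. intros j Hj.
      replace (dirichlet_term a1 lam ((x, (t + tau)%R) + z) j - dirichlet_term a2 lam ((x, t) + z) j)%C
        with (dirichlet_term a1 lam ((x, t) + z) j * (cis (lam j * tau) - cis (phi j)))%C.
      2: { unfold dirichlet_term. rewrite Hphi.
           replace (lam j * ((x, (t + tau)%R) + z))%C with (lam j * ((x, t) + z) + (0, (lam j * tau)%R))%C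
             by (unfold Cplus, Cmult, RtoC; simpl; f_equal; ring).
           rewrite Cexp_plus. replace (Cexp (0, (lam j * tau)%R)) with (cis (lam j * tau)).
           - ring.
           - rewrite Cexp_cis. simpl. rewrite exp_0. ring. }
      rewrite Cmod_mult, Rmult_comm.
      destruct (classic (lt_card j card)) as [Hc | Hc].
      + apply Rmult_le_compat; try apply Cmod_ge_0; auto.
        rewrite Cmod_dirichlet_term. apply Rmult_le_compat_l; [apply Cmod_ge_0 |].
        apply exp_two_sided. exact Hre.
      + rewrite Cmod_dirichlet_term. unfold w. rewrite H0, Cmod_0 by auto. lra.
    - rewrite rsum_scal. apply Rle_trans with (eps / 3 / (B + 1) * (B + 1)).
      + apply Rmult_le_compat_l; [left; repeat apply Rdiv_lt_0_compat; lra |].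
        specialize (HB m). lra.
      + right. field. lra. }
  set (p1 := csum (dirichlet_term a1 lam ((x, (t + tau)%R) + z)%C) m) in *.
  set (p2 := csum (dirichlet_term a2 lam ((x, t) + z)%C) m) in *.
  eapply Rle_trans; [apply (Cmod_triangle_minus _ p1) |].
  eapply Rle_trans; [apply Rplus_le_compat_l, (Cmod_triangle_minus _ p2) |].
  rewrite (Cmod_minus_sym p2). lra.
Qed.

(* Hurwitz's argument: translates of [F1] converge to [F2] near [(x0, t0)]; if they all
   avoided [w = F2 (x0, t0)], the mean value property of [1 / (F1 - w)] on a circle where
   [F2 - w] does not vanish would be violated at its centre. *)
Lemma value_transfer (al1 be1 al2 be2 : Rbar) (card : option nat) (lam : nat -> R)
    (a1 a2 : nat -> C) (F1 F2 : C -> C) (E : R -> Prop) (x0 t0 : R) :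
  Z_independent card lam ->
  (forall i j, lt_card i card -> lt_card j card -> lam i = lam j -> i = j) ->
  dirichlet_on al1 be1 a1 lam F1 -> dirichlet_on al2 be2 a2 lam F2 ->
  (forall x y, in_interval al1 be1 x -> cdiff F1 (x, y)) ->
  (forall j, Cmod (a1 j) = Cmod (a2 j)) -> (forall j, ~ lt_card j card -> a1 j = 0) ->
  (exists i, lt_card i card /\ a2 i <> 0) ->
  open E -> (forall x, E x -> in_interval al1 be1 x /\ in_interval al2 be2 x) -> E x0 ->
  exists x t, E x /\ F1 (x, t) = F2 (x0, t0).
Proof.
  intros Hi Hinj H1 H2 Hd Hmod H0 [i [Hic Hai]] HE HEs Hx0.
  destruct (HE x0 Hx0) as [dl Hdl]. assert (Hdp := cond_pos dl).
  assert (HEx : forall y, Rabs (y - x0) < dl -> E y) by (intros y Hy; apply Hdl, Hy).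
  (* [dirichlet_taylor] needs abscissae up to distance 2 * rho, and these must stay in [E]. *)
  set (rho := dl / 4). assert (Hrho : 0 < rho) by (unfold rho; lra).
  assert (HEr : forall u, Rabs u <= 2 * rho -> E (x0 + u)).
  { intros u Hu. apply HEx. replace (x0 + u - x0) with u by ring. unfold rho in Hu. lra. }
  set (w := F2 (x0, t0)).
  assert (HEm : forall u, 0 <= u <= 2 * rho -> E (x0 - u) /\ E (x0 + u)).
  { intros u Hu. split; [unfold Rminus; apply HEr; rewrite Rabs_Ropp | apply HEr]; rewrite Rabs_pos_eq; lra. }
  destruct (HEm (2 * rho)) as [Em Ep]; [lra |].
  destruct (dirichlet_taylor al2 be2 a2 lam F2 x0 rho Hrho H2) as [B HB]; try (apply HEs; auto).
  assert (HT : forall t, taylor_at rho (B + Cmod w) (fun z => F2 ((x0, t) + z)%C - w)%C).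
  { intros t. apply (taylor_at_minus rho B (Cmod w) (fun z => F2 ((x0, t) + z)%C) (fun _ => w));
      [apply HB | apply taylor_at_const, Hrho]. }
  destruct (taylor_dichotomy _ _ _ Hrho (HT t0)) as [Z | [r0 [Hr0 Hmu]]].
  - exfalso.
    (* If F2 - w vanished on a disc, F2 would be constant on the whole line; as [lam i] is nonzero,
       its mean at [lam i] would be 0, contrary to [a2 i] <> 0. *)
    assert (Zv := vertical_continuation (fun s => F2 s - w)%C x0 rho (B + Cmod w) Hrho HT t0 Z).
    assert (M1 : umean (fun t => F2 (x0, t) * cis (- lam i * t))%C (a2 i * RtoC (exp (lam i * x0)))%C).
    { apply (dirichlet_mean_exponent al2 be2); auto.
      - apply HEs, Hx0.
      - intros j Hj. apply Hinj; auto. apply NNPP. intros Hc. apply Hj.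
        apply Cmod_eq_0. rewrite <- Hmod, H0 by auto. apply Cmod_0. }
    assert (M2 : umean (fun t => F2 (x0, t) * cis (- lam i * t))%C (w * 0)%C).
    { apply umean_ext with (fun t => w * cis (- lam i * t))%C.
      - intros t. f_equal. specialize (Zv t). simpl in Zv.
        replace (F2 (x0, t)) with (F2 (x0, t) - w + w)%C by ring. rewrite Zv. ring.
      - apply umean_scal, umean_cis. apply Ropp_neq_0_compat, (Z_independent_neq_0 card); auto. }
    assert (Eq := umean_unique _ _ _ M1 M2). rewrite Cmult_0_r in Eq.
    apply Hai. apply Cmod_eq_0. assert (Z0 : Cmod (a2 i * RtoC (exp (lam i * x0))) = 0) by (rewrite Eq; apply Cmod_0).
    rewrite Cmod_mult, Cmod_R, Rabs_pos_eq in Z0 by (left; apply exp_pos).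
    apply Rmult_integral in Z0. destruct Z0 as [Z0 | Z0]; auto.
    generalize (exp_pos (lam i * x0)). lra.
  - apply NNPP. intros Hno.
    assert (Hne : forall x t, E x -> (F1 (x, t) - w)%C <> 0).
    { intros x t Hx Hc. apply Hno. exists x, t. split; auto. fold w.
      replace (F1 (x, t)) with (F1 (x, t) - w + w)%C by ring. rewrite Hc. ring. }
    set (r := r0 / 2). assert (Hr : 0 < r < r0) by (unfold r; lra).
    destruct (Hmu r Hr) as [mu [Hmu0 Hmu1]].
    assert (Er : E (x0 - r) /\ E (x0 + r)) by (apply HEm; lra). destruct Er as [Er1 Er2].
    (* With the error mu / 4, |F1 - w| is at least 3 mu / 4 on the circle about s but at most mu / 4
       at s itself. *)
    destruct (translate_approximation al1 be1 al2 be2 card lam a1 a2 F1 F2 x0 t0 r (mu / 4)) as [tau Htau];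
      auto; try (apply HEs; auto); [lra |].
    set (s := (x0, (t0 + tau)%R) : C).
    assert (HEz : forall z, Cmod (z - s)%C <= r -> E (fst z)).
    { intros z Hz. apply HEx. assert (Rabs (Re (z - s)%C) <= r) by (eapply Rle_trans; [apply re_le_Cmod | exact Hz]).
      change (Re (z - s)%C) with (fst z - x0) in H. unfold rho in *. lra. }
    assert (Hz0 := Htau 0). rewrite Cmod_0, !Cplus_0_r in Hz0. specialize (Hz0 ltac:(lra)).
    fold s w in Hz0.
    assert (Hc : Cmod (/ (F1 s - w)) <= / (3 * mu / 4)).
    { apply (circle_mean_bound (fun z => / (F1 z - w))%C s r); [lra | |].
      - intros z Hz. assert (HEf := HEz z Hz). destruct z as [x y].
        apply (cdiff_comp (fun v => / v)%C (fun z => F1 z - w)%C).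
        + destruct (Hd x y (proj1 (HEs x HEf))) as [p [Ep1 Hp]]. exists p. split; auto.
          intros v. rewrite (Ep1 v). ring.
        + apply cdiff_inv, Hne. exact HEf.
      - intros z Hz.
        assert (HEf : E (fst z)) by (apply HEz; lra).
        assert (Hn : (F1 z - w)%C <> 0) by (destruct z as [x y]; apply Hne, HEf).
        rewrite Cmod_inv by exact Hn. apply Rinv_le_contravar; [lra |].
        assert (A := Htau (z - s)%C ltac:(lra)). assert (Bm := Hmu1 (z - s)%C Hz). fold s in A.
        replace (s + (z - s))%C with z in A by ring.
        set (q := F2 ((x0, t0) + (z - s))%C) in *.
        assert (T := Cmod_triangle_rev (q - w) (F1 z - w)).
        replace (q - w - (F1 z - w))%C with (- (F1 z - q))%C in T by ring. rewrite Cmod_opp in T. lra. }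
    assert (Hn : (F1 s - w)%C <> 0) by (apply Hne; exact Hx0).
    rewrite Cmod_inv in Hc by exact Hn.
    assert (Hp : 0 < Cmod (F1 s - w)) by (apply Cmod_gt_0; exact Hn).
    assert (Rinv (Cmod (F1 s - w)) >= / (mu / 4)) by (apply Rle_ge, Rinv_le_contravar; lra).
    assert (/ (3 * mu / 4) < / (mu / 4)) by (apply Rinv_lt_contravar; [apply Rmult_lt_0_compat |]; lra).
    lra.
Qed.

(** * From equality of value sets to equality of moduli *)

(** Coefficients of the majorant series. At real points it sums the moduli, and as an analytic
    function of s it can be continued from there. *)
Definition abs_coef (a : nat -> C) (j : nat) : C := RtoC (Cmod (a j)).

Lemma Cmod_abs_coef (a : nat -> C) (j : nat) : Cmod (abs_coef a j) = Cmod (a j).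
Proof. unfold abs_coef. rewrite Cmod_R, Rabs_pos_eq; auto. apply Cmod_ge_0. Qed.

Lemma dirichlet_abs (al be : Rbar) (a : nat -> C) (lam : nat -> R) (f : C -> C) :
  dirichlet_on al be a lam f -> exists F, dirichlet_on al be (abs_coef a) lam F.
Proof.
  intros [Hb _].
  assert (Hb' : forall x, in_interval al be x -> rsum_bounded (fun j => Cmod (abs_coef a j) * exp (lam j * x))).
  { intros x Hx. destruct (Hb x Hx) as [B HB]. exists B. intros n.
    rewrite (rsum_ext _ (fun j => Cmod (a j) * exp (lam j * x))); auto.
    intros j _. now rewrite Cmod_abs_coef. }
  destruct (choice (fun s z => in_strip al be s -> csums (dirichlet_term (abs_coef a) lam s) z)) as [F HF].
  { intros s. destruct (classic (in_strip al be s)) as [Hs | Hn]; [| exists 0; contradiction].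
    destruct (csums_exists (dirichlet_term (abs_coef a) lam s) _ (fun j => Req_le _ _ (Cmod_dirichlet_term _ _ _ j))
      (Hb' _ Hs)) as [z Hz]. exists z. auto. }
  exists F. split; auto.
Qed.

Lemma dirichlet_abs_sup (al be : Rbar) (a : nat -> C) (lam : nat -> R) (F : C -> C) (x : R) :
  dirichlet_on al be (abs_coef a) lam F -> in_interval al be x ->
  exists S, F (x, 0) = RtoC S /\ (forall n, rsum (fun j => Cmod (a j) * exp (lam j * x)) n <= S) /\
    (forall B, (forall n, rsum (fun j => Cmod (a j) * exp (lam j * x)) n <= B) -> S <= B).
Proof.
  intros [_ HF] Hx. specialize (HF (x, 0) Hx).
  set (r := fun j => Cmod (a j) * exp (lam j * x)).
  assert (Hr : forall j, 0 <= r j) by (intros; apply Rmult_le_pos; [apply Cmod_ge_0 | left; apply exp_pos]).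
  assert (E : forall n, csum (dirichlet_term (abs_coef a) lam (x, 0)) n = RtoC (rsum r n)).
  { induction n as [|n IH]; [reflexivity |]. simpl. rewrite IH, RtoC_plus. f_equal.
    rewrite dirichlet_term_pair, Rmult_0_r, cis_0. unfold r. rewrite RtoC_mult. unfold abs_coef. ring. }
  assert (Conv : forall eps, 0 < eps -> exists n0, forall n, (n0 <= n)%nat ->
     Rabs (rsum r n - Re (F (x, 0))) <= eps /\ Rabs (Im (F (x, 0))) <= eps).
  { intros eps He. destruct (HF eps He) as [n0 H]. exists n0. intros n Hn. specialize (H n Hn).
    rewrite E in H. split.
    - eapply Rle_trans; [| exact H]. apply (re_le_Cmod (RtoC (rsum r n) - F (x, 0))).
    - eapply Rle_trans; [| exact H].
      replace (Rabs (Im (F (x, 0)))) with (Rabs (Im (RtoC (rsum r n) - F (x, 0)))).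
      + apply im_le_Cmod.
      + rewrite <- Rabs_Ropp. f_equal. unfold Im, Cminus, Cplus, Copp, RtoC; simpl. ring. }
  exists (Re (F (x, 0))). split; [| split].
  - apply injective_projections; [reflexivity |]. simpl. apply Rabs_eq_0.
    apply Rle_antisym; [| apply Rabs_pos]. apply le_epsilon. intros eps He.
    destruct (Conv eps He) as [n0 H]. destruct (H n0 (Nat.le_refl _)) as [_ H']. rewrite Rplus_0_l. exact H'.
  - intros n. apply le_epsilon. intros eps He. destruct (Conv eps He) as [n0 H].
    destruct (H (n0 + n)%nat ltac:(lia)) as [H' _]. apply Rabs_le_between in H'.
    assert (I := rsum_incr r n (n0 + n) Hr ltac:(lia)). lra.
  - intros B HB. apply le_epsilon. intros eps He. destruct (Conv eps He) as [n0 H].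
    destruct (H n0 (Nat.le_refl _)) as [H' _]. apply Rabs_le_between in H'. specialize (HB n0). fold r in HB. lra.
Qed.

Lemma open_ball_R (x d : R) : open (fun y => Rabs (y - x) < d).
Proof.
  intros y Hy. assert (Hp : 0 < d - Rabs (y - x)) by lra.
  exists (mkposreal _ Hp). intros z Hz. change (Rabs (z - y) < d - Rabs (y - x)) in Hz.
  replace (z - x) with ((z - y) + (y - x)) by ring.
  eapply Rle_lt_trans; [apply Rabs_triang | lra].
Qed.

(** A value of f1 above x is a value of f2 above some y near x, hence bounded by F2 (y, 0), which is
    close to F2 (x, 0) by continuity. So [S2] + eps bounds f1 on the line, and [Hsup] applies. *)
Lemma abs_sum_le (al be al1 be1 al2 be2 : Rbar) (a1 a2 : nat -> C) (lam1 lam2 : nat -> R)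
    (f1 f2 F2 : C -> C) (x S1 S2 : R) :
  dirichlet_on al2 be2 a2 lam2 f2 -> dirichlet_on al2 be2 (abs_coef a2) lam2 F2 ->
  (forall x, in_interval al be x -> in_interval al1 be1 x /\ in_interval al2 be2 x) ->
  (forall x B, in_interval al1 be1 x -> (forall t, Cmod (f1 (x, t)) <= B) ->
       forall n, rsum (fun j => Cmod (a1 j) * exp (lam1 j * x)) n <= B) ->
  (forall E : R -> Prop, open E -> (forall x, E x -> in_interval al be x) ->
     forall w, (exists sigma, E sigma /\ Img f1 sigma w) -> exists sigma, E sigma /\ Img f2 sigma w) ->
  in_interval al be x ->
  (forall B, (forall n, rsum (fun j => Cmod (a1 j) * exp (lam1 j * x)) n <= B) -> S1 <= B) ->
  F2 (x, 0) = RtoC S2 -> S1 <= S2.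
Proof.
  intros Hf2 HF2 Hin Hsup Himg Hx HS1 HS2. apply le_epsilon. intros eps He.
  apply HS1. apply Hsup; [apply Hin, Hx |].
  destruct (in_interval_nbhd _ _ _ Hx) as [d [Hd Hdx]].
  set (rho := d / 2). assert (Hrho : 0 < rho) by (unfold rho; lra).
  assert (I1 : in_interval al2 be2 (x - 2 * rho)).
  { apply Hin, Hdx. replace (x - 2 * rho - x) with (- d) by (unfold rho; field). rewrite Rabs_Ropp, Rabs_pos_eq; lra. }
  assert (I2 : in_interval al2 be2 (x + 2 * rho)).
  { apply Hin, Hdx. replace (x + 2 * rho - x) with d by (unfold rho; field). rewrite Rabs_pos_eq; lra. }
  destruct (dirichlet_taylor al2 be2 _ lam2 F2 x rho Hrho HF2 I1 I2) as [B HB].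
  destruct (HB 0) as [m Hm].
  (* The remainder estimate of order 1 at the centre identifies the constant term. *)
  assert (Hm0 : m 0%nat = RtoC S2).
  { assert (H := Hm 1%nat 0). rewrite Cmod_0, Cplus_0_r, HS2 in H. specialize (H ltac:(lra)).
    simpl in H. replace (B * (0 / rho * 1)) with 0 in H by (field; lra).
    assert (Z : Cmod (S2 - (0 + m 0%nat * 1))%C = 0) by (generalize (Cmod_ge_0 (S2 - (0 + m 0%nat * 1))%C); lra).
    apply Cmod_eq_0 in Z. replace (m 0%nat) with (S2 - (S2 - (0 + m 0%nat * 1)))%C by ring. rewrite Z. ring. }
  assert (HB0 := Rabs_pos B).
  (* Makes the remainder B * |y - x| / rho of order 1 at most eps. *)
  set (dl := Rmin rho (eps * rho / (Rabs B + 1))).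
  assert (Hdl : 0 < dl).
  { apply Rmin_glb_lt; auto. apply Rdiv_lt_0_compat; [apply Rmult_lt_0_compat; auto | lra]. }
  assert (Near : forall y, Rabs (y - x) < dl -> Re (F2 (y, 0)) <= S2 + eps).
  { intros y Hy.
    assert (Ec : Cmod (RtoC (y - x)) = Rabs (y - x)) by apply Cmod_R.
    assert (Hy1 : Rabs (y - x) < rho) by (eapply Rlt_le_trans; [exact Hy | apply Rmin_l]).
    assert (Hy2 : Rabs (y - x) < eps * rho / (Rabs B + 1)) by (eapply Rlt_le_trans; [exact Hy | apply Rmin_r]).
    assert (H := Hm 1%nat (RtoC (y - x)) ltac:(rewrite Ec; lra)).
    replace ((x, 0) + RtoC (y - x))%C with ((y, 0) : C) in H by (unfold Cplus, RtoC; simpl; f_equal; ring).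
    simpl in H. rewrite Hm0, Ec in H.
    assert (Re (F2 (y, 0)) - S2 <= B * (Rabs (y - x) / rho * 1)).
    { eapply Rle_trans; [| exact H]. eapply Rle_trans; [| apply re_le_Cmod].
      eapply Rle_trans; [| apply Rle_abs]. right. unfold Re, Cminus, Cplus, Copp, Cmult, RtoC; simpl. ring. }
    assert (B * (Rabs (y - x) / rho * 1) <= eps); [| lra].
    apply Rle_trans with ((Rabs B + 1) * (eps / (Rabs B + 1))); [| right; field; lra].
    apply Rle_trans with ((Rabs B + 1) * (Rabs (y - x) / rho * 1)).
    - apply Rmult_le_compat_r; [| generalize (Rle_abs B); lra].
      rewrite Rmult_1_r. apply Rmult_le_pos; [apply Rabs_pos | left; apply Rinv_0_lt_compat; auto].
    - apply Rmult_le_compat_l; [lra |]. rewrite Rmult_1_r.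
      apply Rmult_le_reg_r with rho; auto. unfold Rdiv at 1. rewrite Rmult_assoc, Rinv_l, Rmult_1_r by lra.
      replace (eps / (Rabs B + 1) * rho) with (eps * rho / (Rabs B + 1)) by (field; lra). lra. }
  intros t.
  destruct (Himg (fun y => Rabs (y - x) < dl) (open_ball_R x dl)) with (w := f1 (x, t)) as [y [Hy [t' Et]]].
  { intros y Hy. apply Hdx. unfold dl in Hy. generalize (Rmin_l rho (eps * rho / (Rabs B + 1))). unfold rho in *. lra. }
  { exists x. split; [rewrite Rminus_diag, Rabs_R0; exact Hdl | exists t; reflexivity]. }
  rewrite Et.
  assert (Hyi : in_interval al2 be2 y).
  { apply Hin, Hdx. unfold dl in Hy. generalize (Rmin_l rho (eps * rho / (Rabs B + 1))). unfold rho in *. lra. }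
  destruct (dirichlet_abs_sup al2 be2 a2 lam2 F2 y HF2 Hyi) as [Sy [Ey [Hy1 _]]].
  assert (N := Near y Hy). rewrite Ey in N. simpl in N.
  apply Rle_trans with Sy; [| exact N].
  destruct Hf2 as [_ Hf2]. apply (csums_bound (dirichlet_term a2 lam2 (y, t'))); [apply Hf2; exact Hyi |].
  intros n. eapply Rle_trans; [apply Cmod_csum |].
  rewrite (rsum_ext _ (fun j => Cmod (a2 j) * exp (lam2 j * y))); auto.
  intros j _. apply Cmod_dirichlet_term.
Qed.

Lemma abs_sums_coefficients (al be al1 be1 al2 be2 : Rbar) (a1 a2 : nat -> C) (lam1 lam2 : nat -> R)
    (F1 F2 : C -> C) (i : nat) :
  Rbar_lt al be ->
  dirichlet_on al1 be1 (abs_coef a1) lam1 F1 -> dirichlet_on al2 be2 (abs_coef a2) lam2 F2 ->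
  (forall x, in_interval al be x -> in_interval al1 be1 x /\ in_interval al2 be2 x) ->
  (forall x, in_interval al be x -> F1 (x, 0) = F2 (x, 0)) ->
  (forall j, a1 j <> 0 -> lam1 j = lam1 i -> j = i) ->
  (forall j k, a2 j <> 0 -> a2 k <> 0 -> lam2 j = lam2 k -> j = k) ->
  a1 i <> 0 -> exists j, a2 j <> 0 /\ lam2 j = lam1 i /\ Cmod (a2 j) = Cmod (a1 i).
Proof.
  intros Hab H1 H2 Hin Heq Hinj1 Hinj2 Hi.
  assert (Habs : forall a j, abs_coef a j <> 0 <-> a j <> 0).
  { intros a j. rewrite !Cmod_gt_0, Cmod_abs_coef. tauto. }
  destruct (in_interval_ex _ _ Hab) as [x Hx].
  destruct (in_interval_nbhd _ _ _ Hx) as [d [Hd Hdx]].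
  set (rho := d / 2). assert (Hrho : 0 < rho) by (unfold rho; lra).
  assert (I1 : in_interval al be (x - 2 * rho)).
  { apply Hdx. replace (x - 2 * rho - x) with (- d) by (unfold rho; field). rewrite Rabs_Ropp, Rabs_pos_eq; lra. }
  assert (I2 : in_interval al be (x + 2 * rho)).
  { apply Hdx. replace (x + 2 * rho - x) with d by (unfold rho; field). rewrite Rabs_pos_eq; lra. }
  destruct (dirichlet_taylor al1 be1 _ lam1 F1 x rho Hrho H1) as [B1 HB1]; try (apply Hin; auto).
  destruct (dirichlet_taylor al2 be2 _ lam2 F2 x rho Hrho H2) as [B2 HB2]; try (apply Hin; auto).
  assert (HT : forall t, taylor_at rho (B1 + B2) (fun z => F1 ((x, t) + z)%C - F2 ((x, t) + z)%C)%C).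
  { intros t. apply (taylor_at_minus rho B1 B2 (fun z => F1 ((x, t) + z)%C) (fun z => F2 ((x, t) + z)%C)); auto. }
  assert (Z : forall t, (F1 (x, t) - F2 (x, t))%C = 0).
  { apply (vertical_continuation (fun s => F1 s - F2 s)%C x rho (B1 + B2) Hrho HT 0).
    (* The difference vanishes at real points, and every small circle about (x, 0) contains one;
       this excludes the lower bound. *)
    destruct (taylor_dichotomy _ _ _ Hrho (HT 0)) as [Z | [r0 [Hr0 Hmu]]]; [exact Z |].
    exfalso. destruct (Hmu (r0 / 2)) as [mu [Hmu0 Hmu1]]; [lra |].
    specialize (Hmu1 (RtoC (r0 / 2))). rewrite Cmod_R, Rabs_pos_eq in Hmu1 by lra.
    specialize (Hmu1 eq_refl).
    replace ((x, 0) + RtoC (r0 / 2))%C with (((x + r0 / 2)%R, 0) : C) in Hmu1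
      by (unfold Cplus, RtoC; simpl; f_equal; ring).
    rewrite Heq in Hmu1.
    - replace (F2 ((x + r0 / 2)%R, 0) - F2 ((x + r0 / 2)%R, 0))%C with (RtoC 0) in Hmu1 by ring.
      rewrite Cmod_0 in Hmu1. lra.
    - apply Hdx. replace (x + r0 / 2 - x) with (r0 / 2) by ring. rewrite Rabs_pos_eq; unfold rho in *; lra. }
  assert (M1 : umean (fun t => F1 (x, t) * cis (- lam1 i * t))%C (abs_coef a1 i * RtoC (exp (lam1 i * x)))%C).
  { apply (dirichlet_mean_exponent al1 be1); auto; [apply Hin, Hx |].
    intros j Hj. apply Hinj1, Habs, Hj. }
  assert (M2 : umean (fun t => F2 (x, t) * cis (- lam1 i * t))%C (abs_coef a1 i * RtoC (exp (lam1 i * x)))%C).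
  { apply umean_ext with (2 := M1). intros t. f_equal.
    replace (F1 (x, t)) with (F1 (x, t) - F2 (x, t) + F2 (x, t))%C by ring. rewrite Z. ring. }
  assert (Hex : exp (lam1 i * x) <> 0) by (apply Rgt_not_eq, exp_pos).
  assert (HeC : RtoC (exp (lam1 i * x)) <> 0) by (intros E; apply RtoC_inj in E; auto).
  destruct (classic (exists j, a2 j <> 0 /\ lam2 j = lam1 i)) as [[j [Hj Ej]] | Hn].
  - exists j. split; auto. split; auto.
    assert (M3 : umean (fun t => F2 (x, t) * cis (- lam2 j * t))%C (abs_coef a2 j * RtoC (exp (lam2 j * x)))%C).
    { apply (dirichlet_mean_exponent al2 be2); auto; [apply Hin, Hx |].
      intros k Hk. apply Hinj2; auto. apply Habs, Hk. }
    rewrite Ej in M3. assert (E := umean_unique _ _ _ M2 M3).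
    rewrite <- (Cmod_abs_coef a2), <- (Cmod_abs_coef a1). f_equal.
    replace (abs_coef a2 j) with (abs_coef a2 j * RtoC (exp (lam1 i * x)) / RtoC (exp (lam1 i * x)))%C by (field; auto).
    rewrite <- E. field. auto.
  - exfalso. apply (proj2 (Habs a1 i) Hi).
    (* If [lam1 i] were missing from the second series, its mean at that frequency would vanish. *)
    assert (M3 : umean (fun t => F2 (x, t) * cis (- lam1 i * t))%C 0).
    { apply (dirichlet_mean_other al2 be2 (abs_coef a2) lam2); auto; [apply Hin, Hx |].
      intros j Hj E. apply Hn. exists j. split; auto. apply Habs, Hj. }
    assert (E := umean_unique _ _ _ M2 M3).
    replace (abs_coef a1 i) with (abs_coef a1 i * RtoC (exp (lam1 i * x)) / RtoC (exp (lam1 i * x)))%C by (field; auto).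
    rewrite E. field. auto.
Qed.

(** * *-equivalence for independent exponents *)

Lemma rsum_kronecker (v : nat -> R) (n j : nat) :
  (j < n)%nat -> rsum (fun i => Q2R (if Nat.eqb i j then 1 else 0) * v i) n = v j.
Proof.
  intros Hj. rewrite (rsum_ext _ (fun i => if Nat.eqb i j then v j else 0)).
  - rewrite (rsum_update (fun _ => 0)) by auto. rewrite rsum_const. ring.
  - intros i _. destruct (Nat.eqb_spec i j) as [-> | _].
    + unfold Q2R; simpl. field.
    + unfold Q2R; simpl. ring.
Qed.

(** On a basis the values can be prescribed freely. [psi] evaluates a chosen coordinate vector of x,
    and independence makes the result the same for every choice. *)
Lemma Q_linear_extension (card : option nat) (lam phi : nat -> R) (L : R -> Prop) (n : nat) :
  enumerates card lam L -> Q_independent L -> le_card n card ->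
  exists psi, Q_linear_on (Qspan (map lam (seq 0 n))) psi /\ forall j, (j < n)%nat -> psi (lam j) = phi j.
Proof.
  intros He Hi Hn.
  set (comb := fun (p : nat -> Q) (v : nat -> R) => rsum (fun j => Q2R (p j) * v j) n).
  set (P := fun x => epsilon (inhabits (fun _ : nat => 0%Q)) (fun p => x = comb p lam)).
  set (psi := fun x => comb (P x) phi).
  assert (HP : forall x p, x = comb p lam -> psi x = comb p phi).
  { intros x p Hx.
    assert (Hs : x = comb (P x) lam)
      by (apply (epsilon_spec (inhabits (fun _ : nat => 0%Q)) (fun p => x = comb p lam)); eauto).
    assert (D := Q_independent_enum card lam L n (fun j => (P x j - p j)%Q) He Hi Hn).
    assert (Z : rsum (fun j => Q2R (P x j - p j) * lam j) n = 0).
    { rewrite (rsum_ext _ (fun j => Q2R (P x j) * lam j + -1 * (Q2R (p j) * lam j)))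
        by (intros; rewrite Q2R_minus; ring).
      rewrite rsum_plus, rsum_scal. fold (comb (P x) lam). fold (comb p lam). lra. }
    specialize (D Z). unfold psi. apply rsum_ext. intros j Hj. f_equal.
    (* Coordinates are unique only up to [Qeq], so they are compared after passage to the reals. *)
    specialize (D j Hj). simpl in D. apply Qeq_eqR in D. rewrite Q2R_minus in D.
    replace (Q2R 0) with 0 in D by (unfold Q2R; simpl; ring). lra. }
  assert (HS : forall x, Qspan (map lam (seq 0 n)) x -> exists p, x = comb p lam).
  { intros x [q Hq]. exists (fun j => q (lam j)). rewrite Hq. unfold Qcomb.
    rewrite map_map, fold_right_Rplus_seq. reflexivity. }
  exists psi. split; [split |].
  - intros x y Hx Hy. destruct (HS x Hx) as [p Ep]. destruct (HS y Hy) as [p' Ep'].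
    assert (C : forall v, comb (fun j => p j + p' j)%Q v = comb p v + comb p' v).
    { intros v. unfold comb. rewrite <- rsum_plus. apply rsum_ext. intros j _. rewrite Q2R_plus. ring. }
    rewrite (HP (x + y) (fun j => p j + p' j)%Q), (HP x p Ep), (HP y p' Ep'), C; auto.
    rewrite C. lra.
  - intros q x Hx. destruct (HS x Hx) as [p Ep].
    assert (C : forall v, comb (fun j => q * p j)%Q v = Q2R q * comb p v).
    { intros v. unfold comb. rewrite <- rsum_scal. apply rsum_ext. intros j _. rewrite Q2R_mult. ring. }
    rewrite (HP (Q2R q * x) (fun j => q * p j)%Q), (HP x p Ep), C; auto.
    rewrite C, <- Ep. reflexivity.
  - intros j Hj. rewrite (HP (lam j) (fun i => if Nat.eqb i j then 1%Q else 0%Q)).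
    + apply rsum_kronecker, Hj.
    + symmetry. apply rsum_kronecker, Hj.
Qed.

Lemma Cexp_Ci (r : R) : Cexp (Ci * r) = cis r.
Proof.
  rewrite Cexp_cis. replace (Re (Ci * r)) with 0 by (unfold Re, Ci, Cmult, RtoC; simpl; ring).
  replace (Im (Ci * r)) with r by (unfold Im, Ci, Cmult, RtoC; simpl; ring).
  rewrite exp_0. ring.
Qed.

Lemma enumerates_iff (card : option nat) (lam : nat -> R) (L L' : R -> Prop) :
  (forall x, L x <-> L' x) -> enumerates card lam L -> enumerates card lam L'.
Proof. intros E [H1 H2]. split; auto. intros x. rewrite <- E. apply H2. Qed.

Theorem theorem10 :
  forall (alpha1 beta1 alpha2 beta2 : Rbar) (L1 L2 : R -> Prop) (f1 f2 : C -> C),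
    Rbar_lt alpha1 beta1 ->
    Rbar_lt alpha2 beta2 ->
    (exists s : C, in_strip alpha1 beta1 s /\ in_strip alpha2 beta2 s) ->
    countable_set L1 -> countable_set L2 ->
    Q_independent L1 -> Q_independent L2 ->
    AP alpha1 beta1 f1 -> AP alpha2 beta2 f2 ->
    (forall lambda : R, fourier_exponent alpha1 beta1 f1 lambda <-> L1 lambda) ->
    (forall lambda : R, fourier_exponent alpha2 beta2 f2 lambda <-> L2 lambda) ->
    (star_equiv alpha1 beta1 f1 alpha2 beta2 f2 <->
     exists alpha beta : Rbar,
       Rbar_lt alpha beta /\
       (forall x : R, in_interval alpha beta x ->
          in_interval alpha1 beta1 x /\ in_interval alpha2 beta2 x) /\
       forall E : R -> Prop,
         open E -> (forall x : R, E x -> in_interval alpha beta x) ->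
         forall w : C,
           (exists sigma : R, E sigma /\ Img f1 sigma w) <->
           (exists sigma : R, E sigma /\ Img f2 sigma w)).
Proof.
  intros alpha1 beta1 alpha2 beta2 L1 L2 f1 f2 Hab1 Hab2 [s0 [Hs1 Hs2]] Hc1 Hc2 HI1 HI2 HA1 HA2 HL1 HL2.
  split.
  - intros [card [lam [a [b [En1 [En2 [Hco Hst]]]]]]].
    assert (Hi : Z_independent card lam).
    { apply (Q_independent_Z card lam L1); auto. apply (enumerates_iff card lam _ _ HL1 En1). }
    destruct (AP_dirichlet _ _ f1 card lam Hab1 HA1 En1 Hi) as [a1 [P1 [Q1 [_ [R1 S1]]]]].
    destruct (AP_dirichlet _ _ f2 card lam Hab2 HA2 En2 Hi) as [a2 [P2 [Q2 [_ [R2 S2]]]]].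
    assert (Hmod : forall j, Cmod (a1 j) = Cmod (a2 j)).
    { intros j. destruct (classic (lt_card j card)) as [Hj | Hj].
      - destruct (Hco j Hj) as [C1 C2].
        rewrite <- (proj2 (proj2 (P1 j Hj)) _ C1), <- (proj2 (proj2 (P2 j Hj)) _ C2).
        (* Indices start at 0, so the prefix of length S j is the shortest that contains j. *)
        destruct (Hst (S j) ltac:(lia) (lt_card_le_S _ _ Hj)) as [psi [_ Hpsi]].
        rewrite (Hpsi j) by lia. rewrite Cexp_Ci, Cmod_mult, Cmod_cis. ring.
      - rewrite Q1, Q2 by auto. reflexivity. }
    destruct (in_interval_nbhd _ _ _ Hs1) as [d1 [Hd1 N1]].
    destruct (in_interval_nbhd _ _ _ Hs2) as [d2 [Hd2 N2]].
    set (d := Rmin d1 d2). assert (Hd : 0 < d) by (apply Rmin_glb_lt; auto).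
    assert (Hdd1 : d <= d1) by apply Rmin_l. assert (Hdd2 : d <= d2) by apply Rmin_r.
    exists (Finite (Re s0 - d)), (Finite (Re s0 + d)). split; [simpl; lra |].
    assert (Hin : forall x, in_interval (Finite (Re s0 - d)) (Finite (Re s0 + d)) x ->
      in_interval alpha1 beta1 x /\ in_interval alpha2 beta2 x).
    { intros x [X1 X2]. simpl in X1, X2. split; [apply N1 | apply N2]; apply Rabs_le; lra. }
    split; [exact Hin |].
    intros E HE HEs w.
    (* [value_transfer] requires a nonzero coefficient; without exponents both functions are 0 on
       their strips and the two sets of values agree at once. *)
    destruct (classic (exists i, lt_card i card)) as [[i Hic] | Hn].
    + assert (D1 : dirichlet_on alpha1 beta1 a1 lam f1) by (split; auto).
      assert (D2 : dirichlet_on alpha2 beta2 a2 lam f2) by (split; auto).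
      split; intros [x [Hx [t Et]]].
      * destruct (value_transfer alpha2 beta2 alpha1 beta1 card lam a2 a1 f2 f1 E x t) as [y [u [Hy Eu]]]; auto.
        -- apply En1.
        -- intros; apply (AP_cdiff alpha2 beta2); auto.
        -- exists i. split; auto. apply P1, Hic.
        -- intros y Hy. destruct (Hin y (HEs y Hy)). auto.
        -- exists y. split; auto. exists u. congruence.
      * destruct (value_transfer alpha1 beta1 alpha2 beta2 card lam a1 a2 f1 f2 E x t) as [y [u [Hy Eu]]]; auto.
        -- apply En1.
        -- intros; apply (AP_cdiff alpha1 beta1); auto.
        -- exists i. split; auto. apply P2, Hic.
        -- exists y. split; auto. exists u. congruence.
    + assert (Zero : forall al be (a : nat -> C) f, (forall j, ~ lt_card j card -> a j = 0) ->
        (forall s, in_strip al be s -> csums (dirichlet_term a lam s) (f s)) ->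
        forall x t, in_interval al be x -> f (x, t) = 0).
      { intros al be a0 f Ha Hs x t Hx. specialize (Hs (x, t) Hx).
        assert (Cmod (f (x, t)) <= 0).
        { apply (csums_bound _ _ _ Hs). intros n. rewrite csum_0; [rewrite Cmod_0; lra |].
          intros j _. unfold dirichlet_term. rewrite Ha; [ring |]. intros Hj. apply Hn. eauto. }
        apply Cmod_eq_0. generalize (Cmod_ge_0 (f (x, t))). lra. }
      split; intros [x [Hx [t Et]]]; exists x; split; auto; exists t; rewrite Et;
        destruct (Hin x (HEs x Hx)) as [X1 X2];
        rewrite (Zero alpha1 beta1 a1 f1 Q1 S1), (Zero alpha2 beta2 a2 f2 Q2 S2); auto.
  - intros [al [be [Hab [Hin HE]]]].
    destruct Hc1 as [card1 [lam1 En1]]. destruct Hc2 as [card2 [lam2 En2]].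
    assert (Hi1 := Q_independent_Z _ _ _ En1 HI1). assert (Hi2 := Q_independent_Z _ _ _ En2 HI2).
    apply (enumerates_iff _ _ _ _ (fun x => iff_sym (HL1 x))) in En1 as Ef1.
    apply (enumerates_iff _ _ _ _ (fun x => iff_sym (HL2 x))) in En2 as Ef2.
    destruct (AP_dirichlet _ _ f1 card1 lam1 Hab1 HA1 Ef1 Hi1) as [a1 [P1 [Q1 [U1 [R1 S1]]]]].
    (* The comparison is run twice: first to identify the two sets of exponents, then
       with a common enumeration to compare the coefficients. *)
    assert (Cmp : forall card lam, enumerates card lam (fourier_exponent alpha2 beta2 f2) ->
      Z_independent card lam -> exists a2,
      (forall j, lt_card j card -> is_fourier_coeff alpha2 beta2 f2 (lam j) (a2 j)) /\
      (forall i, lt_card i card1 -> exists j, lt_card j card /\ lam j = lam1 i /\ Cmod (a2 j) = Cmod (a1 i)) /\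
      (forall j, lt_card j card -> exists i, lt_card i card1 /\ lam1 i = lam j)).
    { intros card lam Ef Hi.
      destruct (AP_dirichlet _ _ f2 card lam Hab2 HA2 Ef Hi) as [a2 [P2 [Q2 [U2 [R2 S2]]]]].
      assert (D1 : dirichlet_on alpha1 beta1 a1 lam1 f1) by (split; auto).
      assert (D2 : dirichlet_on alpha2 beta2 a2 lam f2) by (split; auto).
      destruct (dirichlet_abs _ _ _ _ _ D1) as [F1 HF1]. destruct (dirichlet_abs _ _ _ _ _ D2) as [F2 HF2].
      assert (Heq : forall x, in_interval al be x -> F1 (x, 0) = F2 (x, 0)).
      { intros x Hx. destruct (Hin x Hx) as [X1 X2].
        destruct (dirichlet_abs_sup _ _ _ _ _ _ HF1 X1) as [T1 [E1 [_ L1']]].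
        destruct (dirichlet_abs_sup _ _ _ _ _ _ HF2 X2) as [T2 [E2 [_ L2']]].
        rewrite E1, E2. f_equal. apply Rle_antisym.
        - apply (abs_sum_le al be alpha1 beta1 alpha2 beta2 a1 a2 lam1 lam f1 f2 F2 x); auto.
          intros E HEo HEs w. apply HE; auto.
        - apply (abs_sum_le al be alpha2 beta2 alpha1 beta1 a2 a1 lam lam1 f2 f1 F1 x); auto.
          + intros y Hy. destruct (Hin y Hy). auto.
          + intros E HEo HEs w. apply HE; auto. }
      assert (N1 : forall j, a1 j <> 0 -> lt_card j card1).
      { intros j Hj. apply NNPP. intros Hc. auto. }
      assert (N2 : forall j, a2 j <> 0 -> lt_card j card).
      { intros j Hj. apply NNPP. intros Hc. auto. }
      exists a2. split; [intros j Hj; apply P2, Hj |]. split.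
      - intros i Hic.
        destruct (abs_sums_coefficients al be alpha1 beta1 alpha2 beta2 a1 a2 lam1 lam F1 F2 i) as [j [J1 [J2 J3]]]; auto.
        + intros j Hj. apply Ef1; auto.
        + intros j k Hj Hk. apply Ef; auto.
        + apply P1, Hic.
        + exists j. auto.
      - intros j Hjc.
        destruct (abs_sums_coefficients al be alpha2 beta2 alpha1 beta1 a2 a1 lam lam1 F2 F1 j) as [i [J1 [J2 J3]]]; auto.
        + intros y Hy. destruct (Hin y Hy). auto.
        + intros y Hy. symmetry. auto.
        + intros k Hk. apply Ef; auto.
        + intros k l Hk Hl. apply Ef1; auto.
        + apply P2, Hjc.
        + exists i. auto. }
    destruct (Cmp card2 lam2 Ef2 Hi2) as [a2' [_ [Y1 Y2]]].
    assert (Ef2' : enumerates card1 lam1 (fourier_exponent alpha2 beta2 f2)).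
    { split; [apply En1 |]. intros x. split.
      - intros Hx. apply Ef2 in Hx. destruct Hx as [j [Hj <-]]. destruct (Y2 j Hj) as [i [I1 I2]]. eauto.
      - intros [i [I1 <-]]. destruct (Y1 i I1) as [j [J1 [J2 _]]]. apply Ef2. eauto. }
    destruct (Cmp card1 lam1 Ef2' Hi1) as [b [B1 [B2 _]]].
    assert (Hmod : forall i, lt_card i card1 -> Cmod (a1 i) = Cmod (b i)).
    { intros i Hic. destruct (B2 i Hic) as [j [J1 [J2 J3]]].
      assert (j = i) by (apply En1; auto). subst j. auto. }
    exists card1, lam1, a1, b. split; [exact Ef1 |]. split; [exact Ef2' |]. split.
    + intros j Hj. split; [apply P1, Hj | apply B1, Hj].
    + intros n Hn0 Hn.
      (* Equal moduli provide a phase for each index, and independence lets a linear map take these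
         phases as values at the exponents. *)
      destruct (choice (fun j phi => lt_card j card1 -> b j = (a1 j * cis phi)%C)) as [phi Hphi].
      { intros j. destruct (classic (lt_card j card1)) as [Hj | Hj]; [| exists 0; contradiction].
        destruct (same_modulus_rotation _ _ (Hmod j Hj)) as [p Hp]. exists p. auto. }
      destruct (Q_linear_extension card1 lam1 phi L1 n En1 HI1 Hn) as [psi [Hlin Hpsi]].
      exists psi. split; auto. intros j Hj. rewrite Cexp_Ci, Hpsi by auto.
      apply Hphi. apply (lt_le_card j n); auto.
Qed.
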